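(* Let $d\ge 1$ and let $\mathcal H$ be a Hilbert space which is continuously embedded in $\mathscr S'(\mathbb R^d)$, and suppose there is a constant $C_0\ge 1$ such that for every $f\in\mathcal H$ and $x,\xi\in\mathbb R^d$ the distribution $e^{i\langle\cdot,\xi\rangle}f(\cdot-x)$ belongs to $\mathcal H$ and $$\|e^{i\langle\cdot,\xi\rangle}f(\cdot-x)\|_{\mathcal H}\le C_0\|f\|_{\mathcal H}.$$ If $\mathcal H\neq\{0\}$, then $\mathcal H=L^2(\mathbb R^d)$, and there is a constant $C>0$, independent of $f$, such that $$C_0^{-1}C\|f\|_{L^2(\mathbb R^d)}\le\|f\|_{\mathcal H}\le C_0C\|f\|_{L^2(\mathbb R^d)},\qquad f\in\mathcal H=L^2(\mathbb R^d).$$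
   Context: $\mathscr S'(\mathbb R^d)$ denotes the space of tempered distributions on $\mathbb R^d$, and $\langle\cdot,\cdot\rangle$ the standard inner product on $\mathbb R^d$. *)

(* Defs.v *)
From HB Require Import structures.
From mathcomp Require Import all_boot all_order all_algebra.
From mathcomp Require Import all_classical all_reals all_analysis.
From mathcomp Require Import complex.
Set Implicit Arguments. Unset Strict Implicit. Unset Printing Implicit Defensive.
Import Order.TTheory GRing.Theory Num.Theory.
Import numFieldNormedType.Exports.
Local Open Scope classical_set_scope.
Local Open Scope ring_scope.
Local Open Scope complex_scope.

Section Defs.
Variable R : realType.
Variable d : nat.

Definition creal (z : R[i]) : R := complex.Re z.
Definition cimag (z : R[i]) : R := complex.Im z.
Definition cabs (z : R[i]) : R := Num.sqrt (creal z ^+ 2 + cimag z ^+ 2).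
Definition cconj (z : R[i]) : R[i] := creal z -i* cimag z.
Definition cexpi (t : R) : R[i] := cos t +i* sin t.
Definition dotR (x y : 'rV[R]_d) : R := \sum_(i < d) x ord0 i * y ord0 i.
Definition unitv (j : 'I_d) : 'rV[R]_d := delta_mx ord0 j.

Fixpoint dpart (js : seq 'I_d) (u : 'rV[R]_d -> R) : 'rV[R]_d -> R :=
  match js with
  | [::] => u
  | j :: js' => fun x => 'D_(unitv j) (dpart js' u) x
  end.

Definition dpartC (js : seq 'I_d) (phi : 'rV[R]_d -> R[i]) : 'rV[R]_d -> R[i] :=
  fun x => dpart js (fun y => creal (phi y)) x +i* dpart js (fun y => cimag (phi y)) x.

Definition smoothR (u : 'rV[R]_d -> R) : Prop :=
  forall js : seq 'I_d, continuous (dpart js u) /\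
    forall (j : 'I_d) (x : 'rV[R]_d), derivable (dpart js u) x (unitv j).

Definition schwartz (phi : 'rV[R]_d -> R[i]) : Prop :=
  smoothR (fun y => creal (phi y)) /\ smoothR (fun y => cimag (phi y)) /\
  forall (js : seq 'I_d) (n : nat), exists M : R, forall x : 'rV[R]_d,
    (1 + `|x|) ^+ n * cabs (dpartC js phi x) <= M.

(** a (candidate) distribution is a functional on test functions; only its
    values on Schwartz functions matter *)
Definition distr := ('rV[R]_d -> R[i]) -> R[i].

Definition deq (u v : distr) : Prop :=
  forall phi, schwartz phi -> u phi = v phi.

(** tempered distributions: linear on S and continuous for the Frechet
    topology of S, i.e. bounded by one of the defining seminorms
    sup_{x, |alpha| <= N} (1+|x|)^N |d^alpha phi(x)| *)
Definition tempered (u : distr) : Prop :=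
  (forall (a : R[i]) phi psi, schwartz phi -> schwartz psi ->
      u (fun x => a * phi x + psi x) = a * u phi + u psi) /\
  exists (N : nat) (K : R), forall phi, schwartz phi ->
    forall M : R, (forall (js : seq 'I_d) x, (size js <= N)%N ->
                     (1 + `|x|) ^+ N * cabs (dpartC js phi x) <= M) ->
    cabs (u phi) <= K * M.

(** the distribution  e^{i<.,xi>} u(. - x0) :
    <e^{i<.,xi>} u(.-x0), phi> = <u, z |-> e^{i<z+x0,xi>} phi(z+x0)> *)
Definition modtrans (x0 xi : 'rV[R]_d) (u : distr) : distr :=
  fun phi => u (fun z => cexpi (dotR (z + x0) xi) * phi (z + x0)).

(** Lebesgue integral over R^d, as an iterated integral (by Tonelli/Fubini this
    is the integral for the d-dimensional Lebesgue measure on nonnegative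
    measurable resp. integrable functions) *)
Fixpoint intRd (n : nat) : ('rV[R]_n -> \bar R) -> \bar R :=
  match n with
  | 0 => fun f => f 0
  | n'.+1 => fun f =>
      (\int[@lebesgue_measure R]_(t in [set: R])
          intRd (fun y : 'rV[R]_n' => f (row_mx (t%:M : 'rV[R]_1) y)))%E
  end.

Definition borel_measurable (u : 'rV[R]_d -> R) : Prop :=
  forall A : set R, open A ->
    <<s [set U : set 'rV[R]_d | open U] >> (u @^-1` A).

Definition L2 (g : 'rV[R]_d -> R[i]) : Prop :=
  borel_measurable (fun x => creal (g x)) /\ borel_measurable (fun x => cimag (g x)) /\
  (intRd (fun x => ((cabs (g x)) ^+ 2)%:E) < +oo)%E.

Definition L2norm (g : 'rV[R]_d -> R[i]) : R :=
  Num.sqrt (fine (intRd (fun x => ((cabs (g x)) ^+ 2)%:E))).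

Definition distr_of_fun (g : 'rV[R]_d -> R[i]) : distr :=
  fun phi => fine (intRd (fun x => (creal (g x * phi x))%:E))
          +i* fine (intRd (fun x => (cimag (g x * phi x))%:E)).

End Defs.

Section Hilbert.
Variable R : realType.
Variable V : lmodType R[i].

Record hilbert_space := HilbertSpace {
  hip : V -> V -> R[i];
  hip_linear : forall (a : R[i]) (u v w : V), hip (a *: u + v) w = a * hip u w + hip v w;
  hip_conj : forall u v : V, hip v u = cconj (hip u v);
  hip_pos : forall u : V, cimag (hip u u) = 0 /\ 0 <= creal (hip u u);
  hip_def : forall u : V, hip u u = 0 -> u = 0;
  hip_complete : forall s : nat -> V,
    (forall e : R, 0 < e -> exists N : nat, forall m n : nat, (N <= m)%N -> (N <= n)%N ->
        Num.sqrt (creal (hip (s m - s n) (s m - s n))) < e) ->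
    exists l : V, forall e : R, 0 < e -> exists N : nat, forall n : nat, (N <= n)%N ->
        Num.sqrt (creal (hip (s n - l) (s n - l))) < e
}.

Definition hnorm (H : hilbert_space) (v : V) : R := Num.sqrt (creal (hip H v v)).
End Hilbert.

(* Main.v *)
(** Averaging the inner product over all time-frequency shifts with an invariant mean of the
    abelian group R^d x R^d produces an equivalent Hilbert norm, within factors C0^-1 and C0, for
    which the shifts are unitary.  For that norm the evaluations v |-> <v, phi> have Riesz kernels
    k_phi; a gliding hump argument bounds |k_phi| by one Schwartz seminorm of phi, so
    Q(phi, psi) = (k_phi, k_psi) is a continuous sesquilinear form on Schwartz functions which is
    invariant under translations and modulations.

    Such a form is a multiple of the L^2 inner product.  Let b be the real or imaginary part of Q
    on real functions, and G the one-dimensional Gaussian.  Modulation invariance gives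
    b(x_j u, v) = b(u, x_j v), and with translation invariance it makes
    int b(W(t + s x_0, x), W'(t + s x_0, x)) dt independent of s, its derivative in s being the
    integral of a t-derivative.  Taking W(r, x) = G(r) u(x) with s = 0 and s = -1, a translation
    in x_0, and then W(r, x) = G(x_0) u(r, x') with s = 1 and s = 0, yields
    sqrt(pi) b(u, v) = int b(G(x_0) u(t, x'), G(x_0) v(t, x')) dt.  The integrand is a form of the
    same kind in the variables x', and induction on the dimension gives b(u, v) = c int u v.

    Hence |k_phi|^2 = c |phi|_2^2 with c > 0, the kernels span a dense subspace, and completeness
    of L^2 together with the uniqueness of densities identifies the space with L^2, the averaged
    norm being exactly c^(-1/2) times the L^2 norm. *)

Require Import Defs.
From HB Require Import structures.
From mathcomp Require Import all_boot all_order all_algebra.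
From mathcomp Require Import all_classical all_reals all_analysis.
From mathcomp Require Import measurable_realfun complex.
From mathcomp Require Import ring lra.
Import Order.TTheory GRing.Theory Num.Theory.
Import numFieldNormedType.Exports.
Local Open Scope classical_set_scope.
Local Open Scope ring_scope.
Local Open Scope complex_scope.
Set Implicit Arguments.
Unset Strict Implicit.
Unset Printing Implicit Defensive.

(** * Complex numbers and Hilbert spaces *)

(** Time-frequency shifts compose only up to a phase, and here they are merely chosen vector by
    vector, so they form no group of operators. Inside an inner product the phases cancel, which is
    why the average can run over an abelian group. A more usual route would attach to Q a
    distribution kernel and show that it is carried by the diagonal; the shear argument replaces
    this by calculus in one variable with explicit remainders. Its price is uniformity: all
    derivatives of sheared, perturbed or modulated functions must be bounded simultaneously in the
    parameters, while smoothness is given only through iterated coordinate derivatives. Such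
    families are therefore handled as spans of atoms that are closed under differentiation. The
    Gaussian serves because it is even, because its products with polynomials are closed under
    differentiation and multiplication by the variable, and because its square has integral
    sqrt(pi). The identity with the L^2 product is proved in the extended reals, so that square
    integrability of Schwartz functions comes out of it instead of being an input. *)

Section ComplexNumbers.
Variable R : realType.
Implicit Types (z w : R[i]) (x y : R).

Lemma complex_ext z w : creal z = creal w -> cimag z = cimag w -> z = w.
Proof. by case: z w => [a b] [c d] /= -> ->. Qed.

Lemma crealD z w : creal (z + w) = creal z + creal w.
Proof. by case: z w => [a b] [c d]. Qed.
Lemma cimagD z w : cimag (z + w) = cimag z + cimag w.
Proof. by case: z w => [a b] [c d]. Qed.
Lemma crealN z : creal (- z) = - creal z.
Proof. by case: z. Qed.
Lemma cimagN z : cimag (- z) = - cimag z.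
Proof. by case: z. Qed.
Lemma crealB z w : creal (z - w) = creal z - creal w.
Proof. by rewrite crealD crealN. Qed.
Lemma cimagB z w : cimag (z - w) = cimag z - cimag w.
Proof. by rewrite cimagD cimagN. Qed.
Lemma crealM z w : creal (z * w) = creal z * creal w - cimag z * cimag w.
Proof. by case: z w => [a b] [c d]. Qed.
Lemma cimagM z w : cimag (z * w) = creal z * cimag w + cimag z * creal w.
Proof. by case: z w => [a b] [c d]. Qed.
Lemma creal_conj z : creal (cconj z) = creal z. Proof. by []. Qed.
Lemma cimag_conj z : cimag (cconj z) = - cimag z. Proof. by []. Qed.
Lemma creal_real x : creal (x%:C) = x. Proof. by []. Qed.
Lemma cimag_real x : cimag (x%:C) = 0. Proof. by []. Qed.

Definition cE := (crealB, cimagB, crealD, cimagD, crealN, cimagN, crealM, cimagM, creal_conj,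
  cimag_conj, creal_real, cimag_real).

Lemma cconjM z w : cconj (z * w) = cconj z * cconj w.
Proof. by apply: complex_ext; rewrite !cE; ring. Qed.

Lemma cconjD z w : cconj (z + w) = cconj z + cconj w.
Proof. by apply: complex_ext; rewrite !cE; ring. Qed.

Lemma cconjK z : cconj (cconj z) = z.
Proof. by apply: complex_ext; rewrite !cE; ring. Qed.

Lemma cabs_ge0 z : 0 <= cabs z. Proof. exact: sqrtr_ge0. Qed.

Lemma cabs_sqr z : cabs z ^+ 2 = creal z ^+ 2 + cimag z ^+ 2.
Proof. by rewrite sqr_sqrtr// addr_ge0 ?sqr_ge0. Qed.

Lemma cabsM z w : cabs (z * w) = cabs z * cabs w.
Proof.
rewrite /cabs -sqrtrM ?addr_ge0 ?sqr_ge0//; congr Num.sqrt.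
by rewrite !cE; ring.
Qed.

Lemma cabs_conj z : cabs (cconj z) = cabs z.
Proof. by rewrite /cabs !cE sqrrN. Qed.

Lemma le_creal_cabs z : `|creal z| <= cabs z.
Proof.
rewrite -(@ler_pXn2r _ 2) ?nnegrE ?cabs_ge0//.
by rewrite cabs_sqr real_normK ?num_real// lerDl sqr_ge0.
Qed.

Lemma le_cimag_cabs z : `|cimag z| <= cabs z.
Proof.
rewrite -(@ler_pXn2r _ 2) ?nnegrE ?cabs_ge0//.
by rewrite cabs_sqr real_normK ?num_real// lerDr sqr_ge0.
Qed.

Lemma cabs_le_add z : cabs z <= `|creal z| + `|cimag z|.
Proof.
rewrite -(@ler_pXn2r _ 2) ?nnegrE ?cabs_ge0 ?addr_ge0//.
rewrite cabs_sqr sqrrD !real_normK ?num_real//.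
have := mulr_ge0 (normr_ge0 (creal z)) (normr_ge0 (cimag z)); lra.
Qed.

Lemma cabs0 : cabs (0 : R[i]) = 0.
Proof. by rewrite /cabs !expr2 !mul0r addr0 sqrtr0. Qed.

Lemma cabs_real x : cabs (x%:C) = `|x|.
Proof. by rewrite /cabs !cE expr0n/= addr0 sqrtr_sqr. Qed.

Lemma cabs_expi x : cabs (cexpi x) = 1.
Proof. by rewrite /cabs /= cos2Dsin2 sqrtr1. Qed.

Lemma cexpiD x y : cexpi (x + y) = cexpi x * cexpi y.
Proof.
by apply: complex_ext; rewrite !cE /creal /cimag /=; rewrite (cosD, sinD)//; ring.
Qed.

Lemma cexpi0 : cexpi (0 : R) = 1.
Proof. by apply: complex_ext; rewrite /creal /cimag /= (cos0, sin0). Qed.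

Lemma cexpiNr x : cexpi (- x) * cexpi x = 1.
Proof. by rewrite -cexpiD addNr cexpi0. Qed.

End ComplexNumbers.

(** * Hilbert space geometry: representation of functionals and the gliding hump *)

Section HilbertTheory.
Variables (R : realType) (V : lmodType R[i]) (H : hilbert_space V).
Implicit Types (u v w : V) (a : R[i]).

Lemma hipDl u v w : hip H (u + v) w = hip H u w + hip H v w.
Proof. by have := hip_linear H 1 u v w; rewrite scale1r mul1r. Qed.

Lemma hip0l w : hip H 0 w = 0.
Proof. by have := hipDl 0 0 w; rewrite addr0 => /eqP; rewrite -subr_eq subrr => /eqP. Qed.

Lemma hipZl a u w : hip H (a *: u) w = a * hip H u w.
Proof. by have := hip_linear H a u 0 w; rewrite addr0 hip0l addr0. Qed.

Lemma hipNl u w : hip H (- u) w = - hip H u w.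
Proof. by rewrite -scaleN1r hipZl mulN1r. Qed.

Lemma hipBl u v w : hip H (u - v) w = hip H u w - hip H v w.
Proof. by rewrite hipDl hipNl. Qed.

Lemma hipDr u v w : hip H w (u + v) = hip H w u + hip H w v.
Proof. by rewrite ![hip H w _]hip_conj hipDl cconjD. Qed.

Lemma hipZr a u w : hip H w (a *: u) = cconj a * hip H w u.
Proof. by rewrite ![hip H w _]hip_conj hipZl cconjM. Qed.

Lemma hipNr u w : hip H w (- u) = - hip H w u.
Proof.
by rewrite -scaleN1r hipZr; apply: complex_ext; rewrite !cE /creal /cimag/=; ring.
Qed.

Lemma hipBr u v w : hip H w (u - v) = hip H w u - hip H w v.
Proof. by rewrite hipDr hipNr. Qed.

Lemma hip0r w : hip H w 0 = 0.
Proof.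
by rewrite hip_conj hip0l; apply: complex_ext; rewrite !cE /creal /cimag /= ?oppr0.
Qed.

Lemma hnorm_ge0 u : 0 <= hnorm H u. Proof. exact: sqrtr_ge0. Qed.

Lemma hnorm_sqr u : hnorm H u ^+ 2 = creal (hip H u u).
Proof. by rewrite /hnorm sqr_sqrtr//; case: (hip_pos H u). Qed.

Lemma hip_diag u : hip H u u = (hnorm H u ^+ 2)%:C.
Proof.
apply: complex_ext; first by rewrite hnorm_sqr.
by rewrite cE; case: (hip_pos H u).
Qed.

Lemma ripC u v : creal (hip H u v) = creal (hip H v u).
Proof. by rewrite hip_conj. Qed.

Lemma hnorm_sqrD u v :
  hnorm H (u + v) ^+ 2 = hnorm H u ^+ 2 + 2 * creal (hip H u v) + hnorm H v ^+ 2.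
Proof.
rewrite !hnorm_sqr !(hipDl, hipDr) !cE (ripC v u); ring.
Qed.

Lemma hnormZ a u : hnorm H (a *: u) = cabs a * hnorm H u.
Proof.
apply/eqP; rewrite -(@eqrXn2 _ 2) ?mulr_ge0 ?cabs_ge0 ?hnorm_ge0//.
rewrite exprMn !hnorm_sqr hipZl hipZr cabs_sqr hip_diag !cE; apply/eqP; ring.
Qed.

Lemma hnormN u : hnorm H (- u) = hnorm H u.
Proof.
rewrite -scaleN1r hnormZ /cabs /creal /cimag /=.
by rewrite oppr0 expr0n/= addr0 sqrrN expr1n sqrtr1 mul1r.
Qed.

Lemma hnormB u v : hnorm H (u - v) = hnorm H (v - u).
Proof. by rewrite -hnormN opprB. Qed.

Lemma hnorm0 : hnorm H 0 = 0.
Proof. by rewrite /hnorm hip0l sqrtr0. Qed.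

Lemma hnorm_eq0 u : hnorm H u = 0 -> u = 0.
Proof. by move=> u0; apply: (@hip_def _ _ H); rewrite hip_diag u0 expr0n. Qed.

Lemma hip_cauchy_schwarz u v : cabs (hip H u v) <= hnorm H u * hnorm H v.
Proof.
have [v0|v0] := eqVneq (hnorm H v) 0.
  by rewrite (hnorm_eq0 v0) hip0r cabs0 hnorm0 mulr0.
have vp : 0 < hnorm H v by rewrite lt_def v0 hnorm_ge0.
set z := hip H u v.
have : 0 <= hnorm H ((hnorm H v ^+ 2)%:C *: u - z *: v) ^+ 2 by rewrite exprn_ge0 ?hnorm_ge0.
rewrite hnorm_sqr hipBl !hipBr !hipZl !hipZr (hip_conj H u v) -/z !hip_diag !cE.
rewrite !(mulr0, mul0r, subr0, addr0, oppr0) => h.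
rewrite -(@ler_pXn2r _ 2) ?nnegrE ?mulr_ge0 ?cabs_ge0 ?hnorm_ge0//.
rewrite exprMn cabs_sqr -(@ler_pM2r _ (hnorm H v ^+ 2)) ?exprn_gt0//.
rewrite -subr_ge0; apply: le_trans h _; rewrite le_eqVlt; apply/orP; left; apply/eqP; ring.
Qed.

Lemma rip_le u v : `|creal (hip H u v)| <= hnorm H u * hnorm H v.
Proof. by apply: le_trans (hip_cauchy_schwarz u v); exact: le_creal_cabs. Qed.

Lemma hnormD u v : hnorm H (u + v) <= hnorm H u + hnorm H v.
Proof.
rewrite -(@ler_pXn2r _ 2) ?nnegrE ?addr_ge0 ?hnorm_ge0// hnorm_sqrD sqrrD.
by have := rip_le u v; have := ler_norm (creal (hip H u v)); lra.
Qed.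

Lemma hnorm_distm u v w : hnorm H (u - w) <= hnorm H (u - v) + hnorm H (v - w).
Proof. by rewrite -[u - w](subrKA v) hnormD. Qed.

Definition hcvg (s : nat -> V) (l : V) := forall e : R, 0 < e ->
  exists n0 : nat, forall n, (n0 <= n)%N -> hnorm H (s n - l) < e.

(* Minimise [|s|^2 - 2 Re L s] over S: by the parallelogram law minimising
   sequences are Cauchy, and their limit represents L.  Taking S = V is the
   Riesz theorem; taking L = (., v) is orthogonal projection. *)
Lemma riesz_on_subspace (S : V -> Prop) (L : V -> R[i]) (B : R) :
  S 0 -> (forall a u v, S u -> S v -> S (a *: u + v)) ->
  (forall a u v, S u -> S v -> L (a *: u + v) = a * L u + L v) ->
  (forall u, S u -> - B <= hnorm H u ^+ 2 - 2 * creal (L u)) ->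
  exists w, (forall u, S u -> hip H u w = L u) /\
    exists2 s : nat -> V, (forall n, S (s n)) & hcvg s w.
Proof.
move=> S0 Slin Llin Lb.
pose F u := hnorm H u ^+ 2 - 2 * creal (L u).
pose E := [set F u | u in [set u | S u]].
have hE : has_inf E.
  split; first by exists (F 0), 0.
  by exists (- B) => _ [u Su <-]; exact: Lb.
pose m := inf E.
have mF u : S u -> m <= F u by move=> Su; apply: ge_inf => //; [case: hE | exists u].
have near_m n : exists u, S u /\ F u < m + n.+1%:R^-1.
  have [_ [u Su <-] Fu] := inf_adherent (ltac:(by rewrite invr_gt0 ltr0n) : 0 < n.+1%:R^-1 :> R) hE.
  by exists u.
have [s sP] := choice near_m.
have Ss n : S (s n) by case: (sP n).
have SZ a u : S u -> S (a *: u) by move=> Su; have := Slin a u 0 Su S0; rewrite addr0.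
have SD u v : S u -> S v -> S (u + v) by move=> Su Sv; rewrite -[u]scale1r; exact: Slin.
have L0 : L 0 = 0.
  by have := Llin 1 0 0 S0 S0; rewrite scale1r mul1r addr0 => /eqP; rewrite -subr_eq subrr => /eqP.
have LZ a u : S u -> L (a *: u) = a * L u.
  by move=> Su; have := Llin a u 0 Su S0; rewrite addr0 L0 addr0.
have LD u v : S u -> S v -> L (u + v) = L u + L v.
  by move=> Su Sv; rewrite -{1}[u]scale1r Llin// mul1r.
have para u v : S u -> S v -> hnorm H (u - v) ^+ 2 <= 2 * (F u + F v) - 4 * m.
  move=> Su Sv; have Sm : S ((2^-1 : R)%:C *: (u + v)) by apply/SZ/SD.
  have := mF _ Sm; rewrite /F hnormZ (LZ _ _ (SD _ _ Su Sv)) LD// exprMn hnorm_sqrD cabs_real.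
  rewrite hnorm_sqrD hipNr hnormN !cE ger0_norm ?invr_ge0//.
  by rewrite mul0r subr0; lra.
have [w wP] : exists w, hcvg s w.
  apply: (@hip_complete _ _ H) => e e0.
  (* Beyond [n0] the values of [F] are at most [m + 1 / (n0 + 1)], and [para] then gives
     [4 / (n0 + 1)]. *)
  have [n0 n0P] : exists n0 : nat, 4 * n0.+1%:R^-1 < e ^+ 2.
    exists (Num.truncn (4 / e ^+ 2)); rewrite ltr_pdivrMr ?ltr0n// mulrC -ltr_pdivrMr ?exprn_gt0//.
    exact: truncnS_gt.
  exists n0 => i j ni nj; rewrite -/(hnorm H _) -(@ltr_pXn2r _ 2) ?nnegrE ?hnorm_ge0 ?ltW//.
  apply: le_lt_trans (para _ _ (Ss i) (Ss j)) (le_lt_trans _ n0P).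
  have h k : (n0 <= k)%N -> F (s k) <= m + n0.+1%:R^-1.
    move=> nk; apply: le_trans (ltW (proj2 (sP k))) _.
    by rewrite lerD2l lef_pV2 ?posrE ?ltr0n// ler_nat ltnS.
  move: (h _ ni) (h _ nj); set q := _^-1; set Fi := F _; set Fj := F _; lra.
exists w; split; last by exists s.
have real_part u : S u -> creal (hip H u w) = creal (L u).
  move=> Su; apply/eqP; rewrite -subr_eq0; apply/negP => /negP D0.
  set D := _ - _ in D0.
  (* Moving [s n] by [t u] with [t = - D / A] changes [F] by at most [2 e - D^2 / A], because [s n]
     is close to [w]. Since [F (s n) < m + e] and [e = D^2 / (4 A)], the result would lie below the
     infimum [m]. *)
  pose A := hnorm H u ^+ 2 + 1.
  have A0 : 0 < A by rewrite ltr_pwDr// exprn_ge0 ?hnorm_ge0.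
  have D2 : 0 < D ^+ 2 by rewrite exprn_even_gt0.
  pose t := - D / A.
  pose e := D ^+ 2 / A / 4.
  have e0 : 0 < e by rewrite !divr_gt0.
  pose e1 := e / ((`|t| + 1) * (hnorm H u + 1)).
  have tu0 : 0 < (`|t| + 1) * (hnorm H u + 1).
    by rewrite mulr_gt0// ltr_pwDr// hnorm_ge0.
  have e10 : 0 < e1 by rewrite divr_gt0.
  have [n1 n1P] := wP _ e10.
  pose n := maxn n1 (Num.truncn (e^-1)).
  have ne : n.+1%:R^-1 < e.
    rewrite -[e]invrK ltf_pV2 ?posrE ?ltr0n ?invr_gt0//.
    by apply: lt_le_trans (truncnS_gt _) _; rewrite ler_nat ltnS leq_maxr.
  have sw : `|creal (hip H u (s n - w))| * `|t| <= e.
    have h1 : `|creal (hip H u (s n - w))| <= (hnorm H u + 1) * e1.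
      apply: le_trans (rip_le _ _) _; apply: ler_pM; rewrite ?hnorm_ge0 ?lerDl//.
      by apply/ltW/n1P; rewrite leq_maxl.
    apply: le_trans (_ : (hnorm H u + 1) * e1 * (`|t| + 1) <= _).
      by apply: ler_pM => //; rewrite lerDl.
    rewrite le_eqVlt; apply/orP; left; apply/eqP; rewrite /e1; field.
    by rewrite !gt_eqF// ?ltr_pwDr ?hnorm_ge0.
  have := mF (s n + t%:C *: u) (SD _ _ (Ss n) (SZ _ _ Su)).
  rewrite /F hnorm_sqrD LD// ?LZ//; last exact: SZ.
  rewrite hipZr hnormZ cabs_real exprMn real_normK ?num_real// !cE.
  have := proj2 (sP n); rewrite /F.
  have -> : creal (hip H (s n) u) = creal (hip H u (s n - w)) + creal (hip H u w).
    by rewrite hipBr crealB subrK ripC.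
  have := sw; rewrite -normrM; set P := _ * t => Pe.
  have := ler_norm P.
  have tD : t * D = - (D ^+ 2 / A) by rewrite /t; ring.
  have tA : t ^+ 2 * hnorm H u ^+ 2 <= D ^+ 2 / A.
    have -> : D ^+ 2 / A = t ^+ 2 * A by rewrite /t; field; rewrite gt_eqF.
    by rewrite ler_wpM2l ?sqr_ge0// /A lerDl.
  rewrite !(mul0r, oppr0, subr0) => h1 h2 h3.
  have eqP_ : 2 * (t * (creal (hip H u (s n - w)) + creal (hip H u w))) - 2 * (t * creal (L u))
    = 2 * P + 2 * (t * D) by rewrite /P /D; ring.
  have g0 : 0 < D ^+ 2 / A by rewrite divr_gt0.
  move: h3 Pe h1 h2 ne tA eqP_ g0; rewrite tD /e; set q := n.+1%:R^-1; set g := D ^+ 2 / A.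
  set nP := `|P|; set s2 := hnorm H (s n) ^+ 2; set Ls := creal (L (s n)); set T2 := t ^+ 2 * _.
  by set X := t * _; set Y := t * _; lra.
move=> u Su; apply: complex_ext; first exact: real_part.
have := real_part ('i *: u) (SZ _ _ Su); rewrite hipZl LZ// !crealM /creal /cimag /=.
by rewrite !mul0r !mul1r !sub0r => /oppr_inj.
Qed.

Lemma riesz (L : V -> R[i]) (A : R) :
  (forall a u v, L (a *: u + v) = a * L u + L v) ->
  (forall u, cabs (L u) <= A * hnorm H u) -> exists w, forall u, hip H u w = L u.
Proof.
move=> Llin LA.
have [||||w [wP _]] := @riesz_on_subspace (fun=> True) L (A ^+ 2) => //.
  move=> u _; have h1 := LA u; have h2 := le_creal_cabs (L u); have h3 := ler_norm (creal (L u)).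
  by have := sqr_ge0 (hnorm H u - A); rewrite sqrrB; lra.
by exists w => u; exact: wP.
Qed.

(** The vector [l] is a sum of steps of length [3^-(n+1)] along [k n], each signed so as not to
    cancel the pairing of the earlier sum with [k n]. All later steps together have at most half the
    length of the n-th, so [|(l, k n)|] is at least [3^-(n+1) 4^n / 2 = (4/3)^n / 6], against
    eventual boundedness. *)
Lemma gliding_hump (k : nat -> V) :
  (forall v, exists A : R, exists n0, forall n, (n0 <= n)%N -> cabs (hip H v (k n)) <= A) ->
  ~ (forall n, 4 ^+ n <= hnorm H (k n)).
Proof.
move=> kb k4.
have kp n : 0 < hnorm H (k n) by apply: lt_le_trans (k4 n); rewrite exprn_gt0.
pose st n v := (if 0 <= creal (hip H v (k n)) then 1 else -1) * (3^-1 ^+ n.+1 / hnorm H (k n)).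
pose x := fix x n := if n is n'.+1 then x n' + (st n' (x n'))%:C *: k n' else 0.
have xS n : x n.+1 = x n + (st n (x n))%:C *: k n by [].
have xd n : hnorm H (x n.+1 - x n) = 3^-1 ^+ n.+1.
  rewrite xS addrC addKr hnormZ cabs_real /st normrM.
  rewrite [X in X * _ * _](_ : _ = 1); last by case: ifP => _; rewrite ?normrN normr1.
  rewrite mul1r ger0_norm ?mulrVK ?unitfE ?gt_eqF//.
  by rewrite divr_ge0 ?exprn_ge0 ?invr_ge0 ?hnorm_ge0.
have xk n : 3^-1 ^+ n.+1 * hnorm H (k n) <= `|creal (hip H (x n.+1) (k n))|.
  rewrite xS hipDl hipZl hip_diag !cE /st; set q := 3^-1 ^+ n.+1.
  have q0 : 0 <= q by rewrite exprn_ge0// invr_ge0.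
  have e r : r * (q / hnorm H (k n)) * hnorm H (k n) ^+ 2 - 0 * 0 = r * (q * hnorm H (k n)).
    by field; rewrite gt_eqF.
  rewrite e; have qk : 0 <= q * hnorm H (k n) by rewrite mulr_ge0 ?hnorm_ge0.
  case: ifPn => [h|]; first by rewrite mul1r ger0_norm ?addr_ge0// lerDr.
  rewrite -ltNge => h; rewrite mulN1r ler0_norm; last by lra.
  by lra.
have xij n j : hnorm H (x (n + j)%N - x n) <= 3^-1 ^+ n / 2 * (1 - 3^-1 ^+ j).
  elim: j => [|j ih]; first by rewrite addn0 subrr hnorm0 expr0 subrr mulr0.
  rewrite addnS; apply: le_trans (hnorm_distm _ (x (n + j)%N) _) _.
  apply: le_trans (lerD (lexx _) ih) _; rewrite xd.
  rewrite le_eqVlt; apply/orP; left; apply/eqP; rewrite -addnS exprD exprS; lra.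
have xij' n m : (n <= m)%N -> hnorm H (x m - x n) <= 3^-1 ^+ n / 2.
  move=> nm; rewrite -(subnKC nm); apply: le_trans (xij _ _) _.
  have q0 i : 0 <= 3^-1 ^+ i :> R by rewrite exprn_ge0// invr_ge0.
  by rewrite ler_piMr ?divr_ge0 ?q0// lerBlDr lerDl q0.
have [l lP] : exists l, hcvg x l.
  apply: (@hip_complete _ _ H) => e e0.
  have : (3^-1 ^+ n : R) @[n --> \oo] --> (0 : R).
    by apply: cvg_expr; rewrite ger0_norm ?invr_ge0// invf_lt1// ltr1n.
  move=> /cvgrPdist_lt/(_ _ e0)[n0 _ n0P].
  have := n0P n0 (leqnn _); rewrite sub0r normrN ger0_norm ?exprn_ge0 ?invr_ge0// => q0.
  exists n0 => i j ni nj; rewrite -/(hnorm H _).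
  apply: le_lt_trans (hnorm_distm _ (x n0) _) _; rewrite (hnormB (x n0)).
  have := xij' _ _ ni; have := xij' _ _ nj; lra.
have lx n : hnorm H (l - x n) <= 3^-1 ^+ n / 2.
  apply/ler_addgt0Pr => e e0; have [n0 n0P] := lP _ e0.
  apply: le_trans (hnorm_distm _ (x (maxn n0 n)) _) _; rewrite addrC lerD ?xij' ?leq_maxr//.
  by rewrite hnormB ltW// n0P// leq_maxl.
have lk n : 6^-1 * (4 / 3) ^+ n <= cabs (hip H l (k n)).
  apply: le_trans (le_creal_cabs _).
  have -> : hip H l (k n) = hip H (x n.+1) (k n) - hip H (x n.+1 - l) (k n).
    by rewrite hipBl opprB addrC subrK.
  rewrite crealB; apply: le_trans (lerB_dist _ _).
  have := xk n; have := rip_le (x n.+1 - l) (k n); rewrite (hnormB (x n.+1)).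
  have := ler_wpM2r (hnorm_ge0 (k n)) (lx n.+1).
  set q := 3^-1 ^+ n.+1; set K := hnorm H (k n); rewrite mulrAC => h1 h2 h3.
  have : q / 2 * 4 ^+ n <= q / 2 * K.
    apply: ler_wpM2l; last exact: k4.
    by apply: divr_ge0 => //; apply: exprn_ge0; rewrite invr_ge0.
  have -> : 6^-1 * (4 / 3) ^+ n = q / 2 * 4 ^+ n :> R.
    by rewrite /q exprMn exprS; field.
  lra.
have [A [n0 AP]] := kb l.
have : (3 / 4 : R) ^+ n @[n --> \oo] --> (0 : R).
  by apply: cvg_expr; rewrite ger0_norm ?divr_ge0// ltr_pdivrMr// mul1r ltr_nat.
have A1 : 0 < (6 * (`|A| + 1))^-1 by rewrite invr_gt0 mulr_gt0// ltr_pwDr.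
move=> /cvgrPdist_lt/(_ _ A1)[n1 _ n1P].
have := n1P (maxn n0 n1) (leq_maxr _ _); set n := maxn n0 n1.
rewrite sub0r normrN ger0_norm ?exprn_ge0 ?divr_ge0//.
rewrite -ltf_pV2 ?posrE ?exprn_gt0 ?divr_gt0 ?invr_gt0 ?mulr_gt0 ?ltr_pwDr//.
rewrite invrK -exprVn invf_div => h.
have := le_trans (lk n) (AP n (leq_maxl _ _)); have := ler_norm A.
move: h; set Q := _ ^+ n; lra.
Qed.

End HilbertTheory.

(** * Invariant means *)

Section InvariantMean.
Variables (R : realType) (G : zmodType).
Implicit Types (f h : G -> R) (g x : G) (F : seq G).

Definition bounded_by (B : R) f := forall x, `|f x| <= B.

Definition cesaro g n f x : R := (\sum_(k < n.+1) f (x + g *+ k)) / n.+1%:R.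

(** The average over the box of all sums of [k_g g] with [g] in [F] and [k_g <= n]: one box serves
    all elements of [F] at once. *)
Definition multi_cesaro F n f : G -> R := foldr (fun g f => cesaro g n f) f F.

Lemma cesaro_linear g n a f h :
  cesaro g n (fun x => a * f x + h x) = fun x => a * cesaro g n f x + cesaro g n h x.
Proof.
by apply/funext => x; rewrite /cesaro big_split -mulr_sumr mulrDl mulrA.
Qed.

Lemma multi_cesaro_linear F n a f h :
  multi_cesaro F n (fun x => a * f x + h x) =
  fun x => a * multi_cesaro F n f x + multi_cesaro F n h x.
Proof. by elim: F => //= g F ->; rewrite cesaro_linear. Qed.

Lemma cesaro_bounded g n B f : bounded_by B f -> bounded_by B (cesaro g n f).
Proof.
move=> fB x; rewrite /cesaro normrM normfV (ger0_norm (ler0n _ _)) ler_pdivrMr ?ltr0n//.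
apply: le_trans (ler_norm_sum _ _ _) _; apply: le_trans (ler_sum _ (fun k _ => fB _)) _.
by rewrite sumr_const card_ord mulr_natr.
Qed.

Lemma multi_cesaro_bounded F n B f : bounded_by B f -> bounded_by B (multi_cesaro F n f).
Proof. by move=> fB; elim: F => //= g F; exact: cesaro_bounded. Qed.

Lemma multi_cesaro_ge0 F n f : (forall x, 0 <= f x) -> forall x, 0 <= multi_cesaro F n f x.
Proof.
move=> f0; elim: F => //= g F ih x.
by rewrite /cesaro divr_ge0 ?ler0n// sumr_ge0.
Qed.

Lemma multi_cesaro1 F n : multi_cesaro F n (fun=> 1) = fun=> 1.
Proof.
elim: F => //= g F ->; apply/funext => x.
by rewrite /cesaro sumr_const card_ord divff// pnatr_eq0.
Qed.

Lemma multi_cesaro_shift F n f t :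
  multi_cesaro F n (fun x => f (x + t)) = fun x => multi_cesaro F n f (x + t).
Proof.
elim: F => //= g F ->; apply/funext => x; rewrite /cesaro; congr (_ / _).
by apply: eq_bigr => k _; rewrite addrAC.
Qed.

(** Along [g] itself the sum telescopes to two end terms, each at most [B]. The group being abelian,
    the inner averages commute with the shift, and the outer ones preserve the bound. *)
Lemma multi_cesaro_almost_invariant F n B f g : g \in F -> bounded_by B f ->
  bounded_by (2 * B / n.+1%:R) (multi_cesaro F n (fun x => -1 * f x + f (x + g))).
Proof.
elim: F => //= g' F ih; rewrite inE => /orP[/eqP <-{g'}|gF] fB; last first.
  by apply: cesaro_bounded; exact: ih.
rewrite multi_cesaro_linear multi_cesaro_shift; set h := multi_cesaro F n f.
have hB : bounded_by B h by exact: multi_cesaro_bounded.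
move=> x; rewrite /cesaro.
have -> : \sum_(k < n.+1) (-1 * h (x + g *+ k) + h (x + g *+ k + g)) = h (x + g *+ n.+1) - h x.
  elim: (n.+1) => [|m ihm]; first by rewrite big_ord0 mulr0n addr0 subrr.
  by rewrite big_ord_recr/= ihm -!addrA -mulrSr; lra.
rewrite normrM normfV (ger0_norm (ler0n _ _)) ler_pM2r ?invr_gt0 ?ltr0n//.
by apply: le_trans (ler_normB _ _) _; have := hB x; have := hB (x + g *+ n.+1); lra.
Qed.

(** The limit of the averages at 0 along an ultrafilter on the pairs [(F, n)] that contains all
    tails of their order. On bounded functions it exists because [[- B, B]] is compact, and every
    [g] belongs to [F] eventually. *)
Lemma invariant_mean : exists M : (G -> R) -> R,
  [/\ forall a f h A B, bounded_by A f -> bounded_by B h ->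
        M (fun x => a * f x + h x) = a * M f + M h,
      forall f B, bounded_by B f -> (forall x, 0 <= f x) -> 0 <= M f,
      M (fun=> 1) = 1 &
      forall f B g, bounded_by B f -> M (fun x => f (x + g)) = M f].
Proof.
pose T := (seq G * nat)%type.
pose D (p : T) : set T := [set q : T | {subset p.1 <= q.1} /\ (p.2 <= q.2)%N].
pose Fl := filter_from setT D.
have FlF : ProperFilter Fl.
  apply: filter_from_proper; last by move=> p _; exists p; split.
  apply: filter_from_filter; first by exists ([::], 0%N).
  move=> [F n] [F' n'] _ _; exists (F ++ F', maxn n n') => //.
  move=> [K m] [/= s nm]; move: nm; rewrite geq_max => /andP[nm nm']; split; split => //= y yF.
    by apply: s; rewrite mem_cat yF.
  by apply: s; rewrite mem_cat yF orbT.
have [U [UU FlU]] := ultraFilterLemma FlF.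
have PU : ProperFilter U by exact: ultra_proper.
have UE (P : set T) : (forall p, P p) -> U P by exact: (@filterE T U).
pose A f (p : T) := multi_cesaro p.1 p.2 f 0.
have Acvg f B : bounded_by B f -> cvg (A f @ U).
  move=> fB.
  have := @segment_compact R (- B) B; rewrite compact_ultra => /(_ (A f @ U) _).
  case.
  - split=> [|K KP UK]; first exact: fmap_proper_filter.
    apply/seteqP; split => [S KS|S]; last exact: UK.
    have [//|/= US] := in_ultra_setVsetC (A f @^-1` S) UU.
    have : K (S `&` ~` S) by apply: filterI => //; exact: UK.
    by rewrite setICr => /filter_not_empty.
  - apply: (UE (A f @^-1` `[- B, B])) => p /=; rewrite in_itv/= -ler_norml.
    exact: multi_cesaro_bounded.
  - by move=> l [_ lP]; apply/cvg_ex; exists l.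
exists (fun f => lim (A f @ U)); split.
- move=> a f h B B' fB hB'.
  have -> : A (fun x => a * f x + h x) = (fun p => a * A f p + A h p).
    by apply/funext => p; rewrite /A multi_cesaro_linear.
  apply/cvg_lim => //; apply: cvgD; last exact: Acvg hB'.
  by apply: cvgMr; exact: Acvg fB.
- move=> f B fB f0; apply: limr_ge; first exact: Acvg fB.
  by apply: UE => p; exact: multi_cesaro_ge0.
- have -> : A (fun=> 1) = fun=> 1 by apply/funext => p; rewrite /A multi_cesaro1.
  exact: lim_cst.
- move=> f B g fB; apply/eqP; rewrite -subr_eq0.
  have fgB : bounded_by B (fun x => f (x + g)) by move=> x; exact: fB.
  rewrite -limB; [|exact: Acvg fgB|exact: Acvg fB].
  apply/eqP/cvg_lim => //; apply/cvgrPdist_le => e e0.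
  (* Beyond [([:: g], n)] the defect of invariance [2 B / (m + 1)] is at most [e]. *)
  pose n := Num.truncn (2 * B / e).
  apply: (FlU); exists ([:: g], n) => // -[F m] [/= gF nm].
  rewrite sub0r normrN /A /=.
  have gF' : g \in F by apply: gF; rewrite inE.
  have := multi_cesaro_almost_invariant m gF' fB 0.
  rewrite multi_cesaro_linear mulN1r addrC => /le_trans; apply.
  rewrite ler_pdivrMr ?ltr0n// [e * _]mulrC -ler_pdivrMr//.
  by apply: le_trans (ltW (truncnS_gt _)) _; rewrite ler_nat ltnS.
Qed.

End InvariantMean.

(** * Real Schwartz functions *)

Section Calculus.
Variables (R : realType) (n : nat).
Notation T := 'rV[R]_n.
Implicit Types (u v : T -> R) (x y : T) (j : 'I_n) (js : seq 'I_n).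

Definition pd j u : T -> R := fun x => 'D_(unitv R j) u x.

(** Through this equivalence the rules of calculus on the real line apply in every direction. *)
Lemma is_derive_line u x (e : T) (l : R) :
  is_derive x e u l <-> is_derive (0 : R) 1 (fun h : R => u (h *: e + x)) l.
Proof.
have eqf : (fun h : R => h^-1 *: ((u \o shift x) (h *: e) - u x)) =
    (fun h : R => h^-1 *: (((fun h => u (h *: e + x)) \o shift 0) (h *: 1) - u (0 *: e + x))).
  by apply/funext => h /=; rewrite scale0r add0r addr0 [h *: 1]mulr1.
by split=> -[d1 d2]; split; move: d1 d2; rewrite /derivable /derive eqf.
Qed.

Lemma dpart_rcons js j u : dpart (rcons js j) u = dpart js (pd j u).
Proof. by elim: js => //= i js ->. Qed.

Lemma dpart_cons js j u : dpart (j :: js) u = pd j (dpart js u).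
Proof. by []. Qed.

Lemma smoothR_pd j u : smoothR u -> smoothR (pd j u).
Proof. by move=> su js; rewrite -dpart_rcons; exact: su. Qed.

Lemma smoothR_dpart js u : smoothR u -> smoothR (dpart js u).
Proof.
move=> su; elim: js => [|j js ih]; first exact: su.
exact: (smoothR_pd j ih).
Qed.

Lemma smoothR_continuous u : smoothR u -> continuous u.
Proof. by move=> /(_ [::])[]. Qed.

Lemma smoothR_derive u x j : smoothR u -> is_derive x (unitv R j) u (pd j u x).
Proof. by move=> /(_ [::])[_ h]; split=> //; exact: h. Qed.

Lemma smoothR_derive_line u x j (h : R) : smoothR u ->
  is_derive h 1 (fun h : R => u (h *: unitv R j + x)) (pd j u (h *: unitv R j + x)).
Proof.
move=> su; have := @smoothR_derive u (h *: unitv R j + x) j su.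
move=> /is_derive_line D.
have -> : (fun h : R => u (h *: unitv R j + x)) =
  (fun k : R => u (k *: unitv R j + (h *: unitv R j + x))) \o (fun k => k - h).
  by apply/funext => k /=; rewrite addrA -scalerDl subrK.
rewrite -[X in is_derive _ _ _ X]mulr1.
apply: is_derive1_comp; first by rewrite subrr.
by apply: is_derive_eq; rewrite subr0.
Qed.

(* Both mixed partials are limits of the same second difference quotient. *)
Lemma pdC i j u : smoothR u -> pd i (pd j u) = pd j (pd i u).
Proof.
move=> su; apply/funext => x.
have tri (e p q r : R) : `|q - r| < e / 2 -> `|p - r| < e / 2 -> `|p - q| <= e.
  move=> h1 h2; rewrite (_ : p - q = (p - r) - (q - r)); last by ring.
  by apply: le_trans (ler_normB _ _) _; lra.
have mixed i' j' (h : R) : 0 < h -> exists a b : R,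
    [/\ 0 <= a <= h, 0 <= b <= h &
      u (h *: unitv R i' + (h *: unitv R j' + x)) - u (h *: unitv R i' + x)
      - (u (h *: unitv R j' + x) - u x)
      = pd j' (pd i' u) (b *: unitv R j' + (a *: unitv R i' + x)) * h * h].
  move=> h0.
  pose f (s : R) := u (s *: unitv R i' + (h *: unitv R j' + x)) - u (s *: unitv R i' + x).
  have fd (s : R) : is_derive s 1 f (pd i' u (s *: unitv R i' + (h *: unitv R j' + x)) -
      pd i' u (s *: unitv R i' + x)).
    by apply: is_deriveB; exact: smoothR_derive_line.
  have [|a aI fa] := @MVT _ f _ _ _ h0 (fun s _ => fd s).
    by apply: derivable_within_continuous => s _; exact: ex_derive.
  pose g (t : R) := pd i' u (t *: unitv R j' + (a *: unitv R i' + x)).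
  have gd (t : R) : is_derive t 1 g (pd j' (pd i' u) (t *: unitv R j' + (a *: unitv R i' + x))).
    by apply: smoothR_derive_line; exact: smoothR_pd.
  have [|b bI gb] := @MVT _ g _ _ _ h0 (fun s _ => gd s).
    by apply: derivable_within_continuous => s _; exact: ex_derive.
  exists a, b; split.
  - by move: aI; rewrite in_itv/= => /andP[/ltW-> /ltW->].
  - by move: bI; rewrite in_itv/= => /andP[/ltW-> /ltW->].
  - move: fa gb; rewrite /f /g !scale0r !add0r subr0.
    by rewrite (addrCA (h *: _) (a *: _) x) => -> <-.
apply/eqP; rewrite -subr_eq0 -normr_eq0 eq_le normr_ge0 andbT.
apply/ler_addgt0Pr => e e0; rewrite add0r.
have cont i' j' : continuous (pd i' (pd j' u)).
  by apply: smoothR_continuous; do 2! apply: smoothR_pd.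
have e20 : 0 < e / 2 by rewrite divr_gt0.
have /cvgrPdist_lt/(_ _ e20) := cont i j x.
have /cvgrPdist_lt/(_ _ e20) := cont j i x.
move=> /nbhs_ballP[d1 /= d10 B1] /nbhs_ballP[d2 /= d20 B2].
pose C := `|unitv R i : T| + `|unitv R j : T| + 1.
have C0 : 0 < C by rewrite ltr_pwDr// addr_ge0.
(* The factor 2 keeps both intermediate points strictly inside the balls on which the mixed partials
   vary by less than [e / 2]. *)
pose h := Num.min d1 d2 / (2 * C).
have h0 : 0 < h by rewrite divr_gt0 ?mulr_gt0// lt_min d10.
have inball (a b : R) : 0 <= a <= h -> 0 <= b <= h ->
    `|a *: unitv R i + b *: unitv R j : T| < Num.min d1 d2.
  move=> /andP[a0 ah] /andP[b0 bh].
  apply: le_lt_trans (ler_normD _ _) _; rewrite !normrZ !ger0_norm//.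
  apply: le_lt_trans (_ : _ <= h * C) _.
    rewrite /C -addrA mulrDr lerD ?ler_wpM2r// mulrDr mulr1.
    by apply: ler_wpDr; rewrite ?ler_wpM2r// ltW.
  rewrite /h -mulrA invfM -mulrA mulVf ?gt_eqF// mulr1.
  by rewrite gtr_pMr ?lt_min ?d10// invf_lt1// ltr1n.
have [a [b [aI bI E1]]] := mixed i j h h0.
have [a' [b' [aI' bI' E2]]] := mixed j i h h0.
have E : pd j (pd i u) (b *: unitv R j + (a *: unitv R i + x)) =
         pd i (pd j u) (b' *: unitv R i + (a' *: unitv R j + x)).
  apply: (@mulIf _ h); first by rewrite gt_eqF.
  apply: (@mulIf _ h); first by rewrite gt_eqF.
  have sw (p q r t : R) : p - q - (r - t) = p - r - (q - t) by ring.
  apply: (etrans (esym E1)); apply: (etrans _ E2).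
  by rewrite sw (addrCA (h *: unitv R i) (h *: unitv R j)).
have P1 : `|pd j (pd i u) x - pd j (pd i u) (b *: unitv R j + (a *: unitv R i + x))| < e / 2.
  apply: B1; rewrite -ball_normE /= addrA opprD addrCA subrr addr0 normrN addrC.
  by apply: lt_le_trans (inball _ _ aI bI) _; rewrite ge_min lexx.
have P2 : `|pd i (pd j u) x - pd i (pd j u) (b' *: unitv R i + (a' *: unitv R j + x))| < e / 2.
  apply: B2; rewrite -ball_normE /= addrA opprD addrCA subrr addr0 normrN.
  by apply: lt_le_trans (inball _ _ bI' aI') _; rewrite ge_min lexx orbT.
rewrite E in P1.
exact: tri P1 P2.
Qed.

Definition seminorm_le N (M : R) u := forall js x, (size js <= N)%N ->
  (1 + `|x|) ^+ N * `|dpart js u x| <= M.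

Lemma ge1_1Dnorm x : 1 <= 1 + `|x|. Proof. by rewrite lerDl. Qed.
Lemma gt0_1Dnorm x : 0 < 1 + `|x|. Proof. exact: lt_le_trans (ge1_1Dnorm x). Qed.

(** Turns one bound per derivative into a common bound for all derivatives of order at most [N]:
    there are finitely many such lists, and the sum of the moduli of the chosen constants dominates
    each of them. *)
Lemma finite_bound N (Q : seq 'I_n -> R -> Prop) :
  (forall js C C', C <= C' -> Q js C -> Q js C') ->
  (forall js, exists C, Q js C) ->
  exists2 C : R, 0 <= C & forall js, (size js <= N)%N -> Q js C.
Proof.
move=> mono /choice[Mf MfP].
pose S k := \sum_(t : k.-tuple 'I_n) `|Mf t|.
exists (\sum_(k < N.+1) S k).
  by rewrite sumr_ge0// => k _; rewrite sumr_ge0.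
move=> js sjs; apply: mono (MfP js); apply: le_trans (_ : S (size js) <= _).
  rewrite /S (bigD1 (in_tuple js))//=; apply: ler_wpDr; last exact: ler_norm.
  by rewrite sumr_ge0.
have sN : (size js < N.+1)%N by [].
rewrite (bigD1 (Ordinal sN))//= lerDl sumr_ge0// => k _.
by rewrite sumr_ge0.
Qed.

(** * Families of functions whose derivatives are bounded uniformly in a parameter *)

Section Families.
Variables (I : Type) (ok : I -> Prop) (om : I -> R).
Hypothesis om0 : forall i, ok i -> 0 <= om i.
Implicit Types f g : I -> T -> R.

Definition fam_rapid f := forall k : nat, exists M : R, forall i x, ok i ->
  om i * (1 + `|x|) ^+ k * `|f i x| <= M.

(** Combinations of atoms whose coefficients may depend on the index but stay bounded. Once every
    atom has its partial derivatives in the span, all iterated derivatives remain there and inherit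
    rapid decay with weight [om i], uniformly in the index. *)
Inductive fam_span (At : (I -> T -> R) -> Prop) : (I -> T -> R) -> Prop :=
| fam_atom f : At f -> fam_span At f
| fam_add f g : fam_span At f -> fam_span At g -> fam_span At (fun i x => f i x + g i x)
| fam_scale (c : I -> R) (C : R) f : (forall i, ok i -> `|c i| <= C) -> fam_span At f ->
    fam_span At (fun i x => c i * f i x)
| fam_ext f g : (forall i x, ok i -> f i x = g i x) -> fam_span At f -> fam_span At g.

Definition fam_diff (At : (I -> T -> R) -> Prop) f :=
  [/\ fam_rapid f, forall i, ok i -> continuous (f i) &
    forall j, exists2 f', fam_span At f' &
      forall i x, ok i -> is_derive x (unitv R j) (f i) (f' i x)].

Lemma fam_span_diff At : (forall f, At f -> fam_diff At f) ->
  forall f, fam_span At f -> fam_diff At f.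
Proof.
move=> AtP f; elim=> {f} [f /AtP//|f g _ [rf cf df] _ [rg cg dg]|c C f cC _ [rf cf df]|f g fg _ [rf cf df]].
- split=> [k|i oi x|j].
  + have [M MP] := rf k; have [M' M'P] := rg k; exists (M + M') => i x oi.
    apply: le_trans (lerD (MP i x oi) (M'P i x oi)); rewrite -mulrDr ler_wpM2l ?ler_normD//.
    by rewrite mulr_ge0 ?om0// exprn_ge0// ltW// gt0_1Dnorm.
  + exact: (continuousD (cf i oi x) (cg i oi x)).
  + have [f' sf f'P] := df j; have [g' sg g'P] := dg j.
    exists (fun i x => f' i x + g' i x); first exact: fam_add.
    by move=> i x oi; apply: is_deriveD; [exact: f'P | exact: g'P].
- split=> [k|i oi x|j].
  + have [M MP] := rf k; exists (`|C| * `|M|) => i x oi.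
    rewrite normrM mulrCA; apply: ler_pM => //.
    * by rewrite !mulr_ge0 ?om0// exprn_ge0// ltW// gt0_1Dnorm.
    * exact: le_trans (cC _ oi) (ler_norm _).
    * exact: le_trans (MP _ _ oi) (ler_norm _).
  + exact: (continuousM (@cst_continuous _ _ (c i) x) (cf i oi x)).
  + have [f' sf f'P] := df j; exists (fun i x => c i * f' i x); first exact: fam_scale cC sf.
    by move=> i x oi; apply: is_deriveZ; exact: f'P.
- have E i : ok i -> g i = f i by move=> oi; apply/funext => x; rewrite fg.
  split=> [k|i oi|j].
  + by have [M MP] := rf k; exists M => i x oi; rewrite -fg//; exact: MP.
  + by rewrite E//; exact: cf.
  + by have [f' sf f'P] := df j; exists f' => // i x oi; rewrite E//; exact: f'P.
Qed.

Lemma fam_span_dpart At : (forall f, At f -> fam_diff At f) ->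
  forall js f, fam_span At f ->
  exists2 f', fam_span At f' & forall i, ok i -> dpart js (f i) = f' i.
Proof.
move=> AtP js f sf; elim: js => [|j js [g sg gP]]; first by exists f.
have [_ _ /(_ j)[g' sg' g'P]] := fam_span_diff AtP sg.
exists g' => // i oi; apply/funext => x /=; rewrite gP//.
by have [_ ->] := g'P i x oi.
Qed.

Lemma fam_span_smooth At : (forall f, At f -> fam_diff At f) ->
  forall f, fam_span At f -> forall i, ok i -> smoothR (f i).
Proof.
move=> AtP f sf i oi js; have [g sg gP] := fam_span_dpart AtP js sf.
have [_ cg dg] := fam_span_diff AtP sg.
rewrite gP//; split=> [|j x]; first exact: cg.
by have [g' _ /(_ i x oi)[]] := dg j.
Qed.

Lemma fam_span_seminorm At : (forall f, At f -> fam_diff At f) ->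
  forall f, fam_span At f -> forall N, exists2 M : R, 0 <= M &
    forall i js x, ok i -> (size js <= N)%N ->
      om i * ((1 + `|x|) ^+ N * `|dpart js (f i) x|) <= M.
Proof.
move=> AtP f sf N.
have [js C C' CC h i x oi|js|M M0 MP] := @finite_bound N (fun js C => forall i x, ok i ->
    om i * ((1 + `|x|) ^+ N * `|dpart js (f i) x|) <= C).
- exact: le_trans (h i x oi) CC.
- have [g sg gP] := fam_span_dpart AtP js sf.
  have [/(_ N)[M MP] _ _] := fam_span_diff AtP sg.
  by exists M => i x oi; rewrite gP// mulrA; exact: MP.
by exists M => // i js x oi sjs; exact: MP.
Qed.

End Families.
End Calculus.

Section RealSchwartz.
Variables (R : realType) (n : nat).
Notation T := 'rV[R]_n.
Implicit Types (u v : T -> R) (x y : T) (j : 'I_n) (js : seq 'I_n).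

Definition rschwartz u := smoothR u /\ forall js (k : nat), exists M : R, forall x,
  (1 + `|x|) ^+ k * `|dpart js u x| <= M.

Lemma rschwartz_dpart js u : rschwartz u -> rschwartz (dpart js u).
Proof.
move=> [su ru]; split; first exact: smoothR_dpart.
move=> js' k; have [M MP] := ru (js' ++ js) k; exists M => x.
suff -> : dpart js' (dpart js u) = dpart (js' ++ js) u by exact: MP.
by elim: js' {MP} => [//|i js' ih]; rewrite /= ih.
Qed.

Lemma rschwartz_pd j u : rschwartz u -> rschwartz (pd j u).
Proof. exact: (@rschwartz_dpart [:: j]). Qed.

Lemma rschwartz_rapid u (k : nat) : rschwartz u ->
  exists2 M : R, 0 <= M & forall x, (1 + `|x|) ^+ k * `|u x| <= M.
Proof.
move=> [_ /(_ [::] k)[M MP]]; exists M; last exact: MP.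
by apply: le_trans (MP 0); apply: mulr_ge0 => //; apply: exprn_ge0.
Qed.

Lemma fam_span_rschwartz (I : Type) (ok : I -> Prop) (om : I -> R)
    (At : (I -> T -> R) -> Prop) (om0 : forall i, ok i -> 0 < om i) :
  (forall f, At f -> fam_diff ok om At f) ->
  forall f, fam_span ok At f -> forall i, ok i -> rschwartz (f i).
Proof.
move=> AtP f sf i oi; have om0' i' : ok i' -> 0 <= om i' by move=> /om0/ltW.
split; first exact: (fam_span_smooth om0' AtP sf).
move=> js k; have [g sg gP] := fam_span_dpart om0' AtP js sf.
have [/(_ k)[M MP] _ _] := fam_span_diff om0' AtP sg.
exists (M / om i) => x; rewrite ler_pdivlMr ?om0// gP// mulrC mulrA.
exact: MP.
Qed.

Lemma dpart_lin js (a : R) u v : smoothR u -> smoothR v ->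
  dpart js (fun x => a * u x + v x) = fun x => a * dpart js u x + dpart js v x.
Proof.
move=> su sv; elim: js => [//|j js ih]; rewrite !dpart_cons ih; apply/funext => x.
have du := smoothR_derive x j (smoothR_dpart js su).
have dv := smoothR_derive x j (smoothR_dpart js sv).
by have [_ E] := is_deriveD (is_deriveZ a du) dv; exact: E.
Qed.

Lemma rschwartz_lin (a : R) u v : rschwartz u -> rschwartz v ->
  rschwartz (fun x => a * u x + v x).
Proof.
move=> [su ru] [sv rv]; split=> [js|js k]; rewrite dpart_lin//.
  have cu := smoothR_continuous (smoothR_dpart js su).
  have cv := smoothR_continuous (smoothR_dpart js sv).
  split=> [x|j x]; first exact: (continuousD (continuousM (@cst_continuous _ _ a x) (cu x)) (cv x)).
  have du := smoothR_derive x j (smoothR_dpart js su).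
  have dv := smoothR_derive x j (smoothR_dpart js sv).
  by have [] := is_deriveD (is_deriveZ a du) dv.
have [M MP] := ru js k; have [M' M'P] := rv js k; exists (`|a| * M + M') => x.
apply: le_trans (lerD (ler_wpM2l (normr_ge0 a) (MP x)) (M'P x)).
by rewrite mulrCA -normrM -mulrDr ler_wpM2l ?ler_normD// exprn_ge0.
Qed.

Lemma rschwartz_scale (a : R) u : rschwartz u -> rschwartz (fun x => a * u x).
Proof.
move=> ru; have := rschwartz_lin (a - 1) ru ru.
congr rschwartz; apply/funext => x; ring.
Qed.

Lemma rschwartzD u v : rschwartz u -> rschwartz v -> rschwartz (fun x => u x + v x).
Proof.
move=> ru rv; have := rschwartz_lin 1 ru rv.
by congr rschwartz; apply/funext => x; rewrite mul1r.
Qed.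

Lemma rschwartzB u v : rschwartz u -> rschwartz v -> rschwartz (fun x => u x - v x).
Proof.
move=> ru rv; have := rschwartz_lin (-1) rv ru.
by congr rschwartz; apply/funext => x; rewrite mulN1r addrC.
Qed.

Definition moderate (m : T -> R) := smoothR m /\ forall js, exists (k : nat) (M : R),
  forall x, `|dpart js m x| <= M * (1 + `|x|) ^+ k.

Lemma moderate_pd j m : moderate m -> moderate (pd j m).
Proof.
move=> [sm bm]; split; first exact: smoothR_pd.
by move=> js; rewrite -dpart_rcons; exact: bm.
Qed.

(** Coinduction: a class that contains partial derivatives of its members contains all iterated
    ones, so it is enough to bound a general member once. *)
Lemma moderate_coind (P : (T -> R) -> Prop) :
  (forall m, P m -> [/\ continuous m, exists (k : nat) (M : R), forall x,
     `|m x| <= M * (1 + `|x|) ^+ k & forall j, exists2 m', P m' &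
       forall x, is_derive x (unitv R j) m (m' x)]) ->
  forall m, P m -> moderate m.
Proof.
move=> PP m Pm.
have Pd js : P (dpart js m).
  elim: js => [//|j js ih]; have [_ _ /(_ j)[m' Pm' m'P]] := PP _ ih.
  rewrite dpart_cons; have -> // : pd j (dpart js m) = m'.
  by apply/funext => x; have [_ ] := m'P x.
split=> [js|js]; have [cm bm dm] := PP _ (Pd js); last exact: bm.
by split=> // j x; have [m' _ /(_ x)[]] := dm j.
Qed.

Lemma rschwartz_mul (m u : T -> R) : moderate m -> rschwartz u -> rschwartz (fun x => m x * u x).
Proof.
move=> mm ru.
(* Sums of products of a moderate and a Schwartz function are closed under differentiation; the
   index set is a point, as only this closure is wanted. *)
pose At (f : unit -> T -> R) := exists m u, [/\ moderate m, rschwartz u & f = fun=> fun x => m x * u x].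
suff AtP f : At f -> fam_diff (fun=> True) (fun=> 1) At f.
  have := fam_span_rschwartz (fun _ _ => ltr01) AtP; move=> h.
  by apply: (h (fun=> fun x => m x * u x) _ tt) => //; apply: fam_atom; exists m, u.
move=> [{mm ru}m [{}u [mm ru ->]]]; split=> [k|_ _ x|j].
- have [_ /(_ [::])[k' [M MP]]] := mm; have [M' M'0 M'P] := rschwartz_rapid (k' + k) ru.
  exists (`|M| * M') => _ x _; rewrite mul1r normrM.
  have h0 : 0 <= (1 + `|x|) ^+ k * `|u x|.
    by rewrite mulr_ge0// exprn_ge0.
  apply: le_trans (_ : `|M| * (1 + `|x|) ^+ k' * ((1 + `|x|) ^+ k * `|u x|) <= _).
    rewrite mulrCA ler_wpM2r//; apply: le_trans (MP x) _.
    by rewrite ler_wpM2r ?ler_norm// exprn_ge0.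
  by rewrite -!mulrA (mulrA (_ ^+ k')) -exprD ler_wpM2l.
- have cm := smoothR_continuous (proj1 mm); have cu := smoothR_continuous (proj1 ru).
  exact: (continuousM (cm x) (cu x)).
- exists (fun=> fun x => m x * pd j u x + pd j m x * u x).
    apply: (@fam_add _ _ _ _ _ (fun=> fun x => m x * pd j u x) (fun=> fun x => pd j m x * u x)).
      by apply: fam_atom; exists m, (pd j u); split=> //; exact: rschwartz_pd.
    by apply: fam_atom; exists (pd j m), u; split=> //; exact: moderate_pd.
  move=> _ x _; rewrite (mulrC (pd j m x)).
  have dm := smoothR_derive x j (proj1 mm); have du := smoothR_derive x j (proj1 ru).
  exact: (is_deriveM dm du).
Qed.

Lemma shift_derive u x y (e : T) l : is_derive (x + y) e u l ->
  is_derive x e (fun z => u (z + y)) l.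
Proof.
move=> /is_derive_line h; apply/is_derive_line.
by have -> : (fun h : R => u (h *: e + x + y)) = (fun h => u (h *: e + (x + y)))
  by apply/funext => k; rewrite addrA.
Qed.

Lemma dpart_shift js u y : smoothR u ->
  dpart js (fun x => u (x + y)) = fun x => dpart js u (x + y).
Proof.
move=> su; elim: js => [//|j js ih]; rewrite !dpart_cons ih; apply/funext => x.
by have [_] := shift_derive (smoothR_derive (x + y) j (smoothR_dpart js su)).
Qed.

Lemma rschwartz_shift u y : rschwartz u -> rschwartz (fun x => u (x + y)).
Proof.
move=> [su ru]; split=> [js|js k]; rewrite dpart_shift//.
  have cu := smoothR_continuous (smoothR_dpart js su).
  split=> [x|j x].
    apply: (@continuous_comp _ _ _ (fun x : T => x + y) (dpart js u) x); last exact: cu.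
    by apply: continuousD; [apply: cvg_id|exact: cst_continuous].
  by have [] := shift_derive (smoothR_derive (x + y) j (smoothR_dpart js su)).
have [M MP] := ru js k; exists ((1 + `|y|) ^+ k * M) => x.
apply: le_trans (ler_wpM2l _ (MP (x + y))); last by rewrite exprn_ge0.
rewrite mulrA -exprMn ler_wpM2r//.
have h : `|x| <= `|x + y| + `|y| by rewrite -{1}[x](addrK y); exact: ler_normB.
have key : 1 + `|x| <= (1 + `|y|) * (1 + `|x + y|).
  rewrite mulrDr mulrDl mul1r mulr1.
  by have := mulr_ge0 (normr_ge0 y) (normr_ge0 (x + y)); lra.
by apply: lerXn2r key; rewrite nnegrE ?mulr_ge0 ?addr_ge0.
Qed.

End RealSchwartz.

Section RowVectors.
Variable R : realType.

Lemma rnorm_coord n (x : 'rV[R]_n) j : `|x ord0 j| <= `|x|.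
Proof.
rewrite [leRHS]/Num.Def.normr /= mx_normrE.
exact: (le_bigmax_cond _ (j := (ord0, j)) (fun ij => `|x ij.1 ij.2|)).
Qed.

Lemma rnorm_le n (x : 'rV[R]_n) (c : R) : 0 <= c -> (forall j, `|x ord0 j| <= c) -> `|x| <= c.
Proof.
move=> c0 xc; rewrite [leLHS]/Num.Def.normr /= mx_normrE; apply: bigmax_le => // -[i j] _.
by rewrite ord1.
Qed.

Lemma lipschitz_continuous m n (h : 'rV[R]_m -> 'rV[R]_n) (C : R) :
  (forall x y, `|h x - h y| <= C * `|x - y|) -> continuous h.
Proof.
move=> hC x; apply/(@cvgrPdist_lt _ _ _ (nbhs x) _ h (h x)) => e e0.
have C0 : 0 < `|C| + 1 by rewrite ltr_pwDr.
apply/nbhs_ballP; exists (e / (`|C| + 1)); first by rewrite /= divr_gt0.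
move=> y; rewrite -ball_normE /= => xy; apply: le_lt_trans (hC x y) _.
apply: le_lt_trans (_ : (`|C| + 1) * `|x - y| < _); last by rewrite mulrC -ltr_pdivlMr.
by rewrite ler_wpM2r// (le_trans (ler_norm C))// lerDl.
Qed.

(** The identification of R x R^n with R^(n+1) along which [intRd] iterates. *)
Definition consv n (t : R) (y : 'rV[R]_n) : 'rV[R]_n.+1 := row_mx (t%:M : 'rV[R]_1) y.
Definition tailv n (y : 'rV[R]_n.+1) : 'rV[R]_n := \row_j y ord0 (lift ord0 j).

Lemma consv0 n t (y : 'rV[R]_n) : consv t y ord0 ord0 = t.
Proof.
have := row_mxEl (t%:M : 'rV[R]_1) y ord0 ord0; rewrite [RHS]mxE eqxx mulr1n => E.
by apply: etrans E; congr (consv t y _ _); exact: val_inj.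
Qed.

Lemma consvS n t (y : 'rV[R]_n) j : consv t y ord0 (lift ord0 j) = y ord0 j.
Proof.
apply: etrans (row_mxEr (t%:M : 'rV[R]_1) y ord0 j).
by congr (consv t y _ _); exact: val_inj.
Qed.

Lemma rowP_cons n (x y : 'rV[R]_n.+1) : x ord0 ord0 = y ord0 ord0 -> tailv x = tailv y -> x = y.
Proof.
move=> h0 /rowP h; apply/rowP => j; case: (unliftP ord0 j) => [k|] ->//.
by have := h k; rewrite !mxE.
Qed.

Lemma tail_consv n t (y : 'rV[R]_n) : tailv (consv t y) = y.
Proof. by apply/rowP => j; rewrite mxE consvS. Qed.

Lemma cons_tailv n (y : 'rV[R]_n.+1) : consv (y ord0 ord0) (tailv y) = y.
Proof. by apply: rowP_cons; rewrite ?consv0 ?tail_consv. Qed.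

Lemma tailv_lin n (h : R) (x y : 'rV[R]_n.+1) : tailv (h *: x + y) = h *: tailv x + tailv y.
Proof. by apply/rowP => j; rewrite !mxE. Qed.

Lemma tailv_unitv0 n : tailv (unitv R (ord0 : 'I_n.+1)) = 0.
Proof. by apply/rowP => j; rewrite !mxE. Qed.

Lemma tailv_unitvS n (j : 'I_n) : tailv (unitv R (lift ord0 j)) = unitv R j.
Proof.
by apply/rowP => k; rewrite !mxE (inj_eq lift_inj).
Qed.

Lemma line0_head n (h : R) (y : 'rV[R]_n.+1) : (h *: unitv R ord0 + y) ord0 ord0 = h + y ord0 ord0.
Proof. by rewrite !mxE !eqxx mulr1. Qed.

Lemma line0_tail n (h : R) (y : 'rV[R]_n.+1) : tailv (h *: unitv R ord0 + y) = tailv y.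
Proof. by rewrite tailv_lin tailv_unitv0 scaler0 add0r. Qed.

Lemma lineS_head n (h : R) j (y : 'rV[R]_n.+1) :
  (h *: unitv R (lift ord0 j) + y) ord0 ord0 = y ord0 ord0.
Proof. by rewrite !mxE mulr0 add0r. Qed.

Lemma lineS_tail n (h : R) j (y : 'rV[R]_n.+1) :
  tailv (h *: unitv R (lift ord0 j) + y) = h *: unitv R j + tailv y.
Proof. by rewrite tailv_lin tailv_unitvS. Qed.

Lemma consv_line0 n (h t : R) (y : 'rV[R]_n) : h *: unitv R ord0 + consv t y = consv (h + t) y.
Proof. by apply: rowP_cons; rewrite ?line0_head ?line0_tail ?consv0 ?tail_consv. Qed.

Lemma consv_lineS n (h t : R) j (y : 'rV[R]_n) :
  h *: unitv R (lift ord0 j) + consv t y = consv t (h *: unitv R j + y).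
Proof. by apply: rowP_cons; rewrite ?lineS_head ?lineS_tail ?consv0 ?tail_consv. Qed.

Lemma rnorm_tailv n (y : 'rV[R]_n.+1) : `|tailv y| <= `|y|.
Proof. by apply: rnorm_le => // j; rewrite mxE rnorm_coord. Qed.

(** The product on the right lets a polynomial weight on R^(n+1) split into weights in the two
    variables. *)
Lemma rnorm_cons_le n (y : 'rV[R]_n.+1) :
  1 + `|y| <= (1 + `|y ord0 ord0|) * (1 + `|tailv y|).
Proof.
have y0 := normr_ge0 (y ord0 ord0); have y1 := normr_ge0 (tailv y).
have h : `|y| <= `|y ord0 ord0| + `|tailv y|.
  apply: rnorm_le => [|j]; first exact: addr_ge0.
  case: (unliftP ord0 j) => [k|] ->; last by rewrite lerDl.
  by have := rnorm_coord (tailv y) k; rewrite mxE; lra.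
by have := mulr_ge0 y0 y1; lra.
Qed.

Lemma continuous_tailv n : continuous (@tailv n).
Proof.
apply: (@lipschitz_continuous _ _ _ 1) => x y; rewrite mul1r.
have -> : tailv x - tailv y = tailv (x - y) by apply/rowP => j; rewrite !mxE.
exact: rnorm_tailv.
Qed.

Lemma continuous_consv n (t : R) : continuous (@consv n t).
Proof.
apply: (@lipschitz_continuous _ _ _ 1) => x y; rewrite mul1r.
apply: rnorm_le => // j; rewrite mxE [in X in _ + X]mxE.
case: (unliftP ord0 j) => [k|] ->; last by rewrite !consv0 subrr normr0.
by rewrite !consvS; have := rnorm_coord (x - y) k; rewrite !mxE.
Qed.

End RowVectors.

(** * Gaussian times polynomials, and tensor products with them *)

Section GaussPoly.
Variable R : realType.
Implicit Types p : {poly R}.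

(** [gp 1] is the Gaussian G. Polynomial factors are carried along to make the class closed under
    differentiation and under multiplication by the variable. *)
Definition gp p (x : R) : R := p.[x] * expR (- (x ^+ 2 / 2)).
Definition dgp p : {poly R} := p^`() - 'X * p.

Lemma gp_derive p (x : R) : is_derive x (1 : R) (gp p) (gp (dgp p) x).
Proof.
have d1 := is_derive_poly p x.
have d2 : is_derive x 1 (fun x : R => - (x ^+ 2 / 2)) (- x).
  have := is_deriveN (is_deriveM (is_deriveX 2 (@is_derive_id R R x 1)) (@is_derive_cst R R R (2^-1 : R) x 1)).
  by move=> h; apply: is_derive_eq; rewrite /= /GRing.scale /=; lra.
have d3 : is_derive x 1 (fun x : R => expR (- (x ^+ 2 / 2))) (expR (- (x ^+ 2 / 2)) * - x).
  exact: (is_derive1_comp (is_derive_expR _) d2).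
apply: (is_derive_eq (is_deriveM d1 d3)).
rewrite /gp /dgp !hornerE /GRing.scale /=; ring.
Qed.

Lemma gp_continuous p : continuous (gp p).
Proof.
move=> x; apply: differentiable_continuous; apply/derivable1_diffP.
by have [] := gp_derive p x.
Qed.

Lemma horner_moderate p : exists (k : nat) (M : R), 0 <= M /\
  forall x, `|p.[x]| <= M * (1 + `|x|) ^+ k.
Proof.
elim/poly_ind: p => [|p c [k [M [M0 MP]]]].
  by exists 0%N, 0; split=> // x; rewrite horner0 normr0 mul0r.
exists k.+1, (M + `|c|); split; first by rewrite addr_ge0.
move=> x; rewrite !hornerE; apply: le_trans (ler_normD _ _) _.
have h1 : 1 <= 1 + `|x| by rewrite lerDl.
rewrite mulrDl; apply: lerD; last by rewrite ler_peMr// exprn_ege1.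
rewrite normrM exprSr mulrA; apply: ler_pM => //.
by rewrite lerDr.
Qed.

(** The term of index [m + 1] in the exponential series of [a^2 / 2] controls [a^(2m+2)], and hence
    [(1 + a)^m], which is at most [2^m] for [a <= 1] and at most [(2a)^m] beyond. *)
Lemma gauss_rapid (m : nat) : exists2 M : R, 0 <= M &
  forall x : R, (1 + `|x|) ^+ m * expR (- (x ^+ 2 / 2)) <= M.
Proof.
pose F : R := (m.+1)`!%:R; have F0 : 0 <= F by rewrite ler0n.
exists (2 ^+ m * (1 + 2 ^+ m.+1 * F)).
  by apply: mulr_ge0; [exact: exprn_ge0|apply: addr_ge0 => //; apply: mulr_ge0 => //; exact: exprn_ge0].
move=> x; set a := `|x|; have a0 : 0 <= a by exact: normr_ge0.
have -> : x ^+ 2 = a ^+ 2 by rewrite real_normK// num_real.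
rewrite expRN ler_pdivrMr ?expR_gt0//.
pose E := expR (a ^+ 2 / 2).
have b0 : 0 <= a ^+ 2 / 2 by rewrite divr_ge0// exprn_ge0.
have E1 : 1 <= E by rewrite -[leLHS]expR0 ler_expR.
have Eb : (a ^+ 2 / 2) ^+ m.+1 <= F * E.
  have := expR_ge1Dxn m b0; rewrite -/F -/E => h.
  have Fp : 0 < F by rewrite ltr0n fact_gt0.
  by rewrite -ler_pdivrMl// mulrC; lra.
have h1 : (1 + a) ^+ m <= 2 ^+ m * (1 + (a ^+ 2) ^+ m.+1).
  have [a1|a1] := leP a 1.
    apply: le_trans (_ : 2 ^+ m <= _).
      by apply: lerXn2r; rewrite ?nnegrE; lra.
    by rewrite ler_peMr ?exprn_ge0// lerDl !exprn_ge0.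
  apply: le_trans (_ : (2 * a) ^+ m <= _).
    by apply: lerXn2r; rewrite ?nnegrE; lra.
  rewrite exprMn ler_wpM2l ?exprn_ge0// -exprM.
  apply: le_trans (_ : a ^+ (2 * m.+1) <= _); last by rewrite lerDr.
  by rewrite ler_eXn2l// mul2n -addnn (leq_trans (leqnSn m))// leq_addr.
have h2 : (a ^+ 2) ^+ m.+1 = 2 ^+ m.+1 * (a ^+ 2 / 2) ^+ m.+1.
  by rewrite -exprMn; congr (_ ^+ _); lra.
apply: le_trans h1 _; rewrite -/E -mulrA ler_wpM2l ?exprn_ge0// mulrDl mul1r lerD//.
by rewrite h2 -(mulrA _ F E); apply: ler_wpM2l Eb; exact: exprn_ge0.
Qed.

Lemma gp_rapid p (k : nat) : exists2 M : R, 0 <= M & forall x, (1 + `|x|) ^+ k * `|gp p x| <= M.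
Proof.
have [m [M [M0 MP]]] := horner_moderate p.
have [M' M'0 M'P] := gauss_rapid (k + m).
exists (M * M'); first exact: mulr_ge0.
move=> x; rewrite /gp normrM (ger0_norm (expR_ge0 _)).
apply: le_trans (_ : (1 + `|x|) ^+ k * (M * (1 + `|x|) ^+ m * expR (- (x ^+ 2 / 2))) <= _).
  by rewrite ler_wpM2l ?exprn_ge0// ler_wpM2r ?expR_ge0.
have -> : (1 + `|x|) ^+ k * (M * (1 + `|x|) ^+ m * expR (- (x ^+ 2 / 2))) =
  M * ((1 + `|x|) ^+ (k + m) * expR (- (x ^+ 2 / 2))) by rewrite exprD; ring.
by rewrite ler_wpM2l.
Qed.

Lemma is_derive_affine (g : R -> R) (c a l : R) : is_derive a 1 g l ->
  is_derive (0 : R) 1 (fun h => g (h * c + a)) (c * l).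
Proof.
move=> gl; rewrite mulrC; apply: (@is_derive1_comp _ g (fun h => h * c + a)).
  by rewrite mul0r add0r.
have := is_deriveD (is_deriveM (@is_derive_id R R 0 1) (@is_derive_cst R R R c 0 1))
  (@is_derive_cst R R R a 0 1).
by move=> h; apply: is_derive_eq; rewrite /= /GRing.scale /=; lra.
Qed.

End GaussPoly.

Section Tensor.
Variables (R : realType) (n : nat).
Implicit Types (f : 'rV[R]_n -> R) (u : 'rV[R]_n.+1 -> R) (y : 'rV[R]_n.+1) (p : {poly R}).

Definition tens p f : 'rV[R]_n.+1 -> R := fun y => gp p (y ord0 ord0) * f (tailv y).

Lemma tens_derive0 p f y : is_derive y (unitv R ord0) (tens p f) (tens (dgp p) f y).
Proof.
apply/is_derive_line.
have -> : (fun h : R => tens p f (h *: unitv R ord0 + y)) =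
    (fun h : R => f (tailv y) * gp p (h * 1 + y ord0 ord0)).
  by apply/funext => h; rewrite /tens line0_head line0_tail mulr1 mulrC.
apply: (is_derive_eq (is_deriveZ (f (tailv y)) (is_derive_affine 1 (gp_derive p (y ord0 ord0))))).
by rewrite /tens mul1r mulrC.
Qed.

Lemma tens_deriveS p f y j : smoothR f ->
  is_derive y (unitv R (lift ord0 j)) (tens p f) (tens p (pd j f) y).
Proof.
move=> sf; apply/is_derive_line.
have -> : (fun h : R => tens p f (h *: unitv R (lift ord0 j) + y)) =
    (fun h : R => gp p (y ord0 ord0) * f (h *: unitv R j + tailv y)).
  by apply/funext => h; rewrite /tens lineS_head lineS_tail.
have /is_derive_line D := smoothR_derive (tailv y) j sf.
exact: is_deriveZ.
Qed.

Lemma tens_continuous p f : continuous f -> continuous (tens p f).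
Proof.
move=> cf y; apply: (@continuousM _ _ (fun y => gp p (y ord0 ord0)) (fun y => f (tailv y))).
  apply: (@continuous_comp _ _ _ (fun y : 'rV[R]_n.+1 => y ord0 ord0) (gp p)).
    exact: coord_continuous.
  exact: gp_continuous.
apply: (@continuous_comp _ _ _ (@tailv R n) f); last exact: cf.
exact: continuous_tailv.
Qed.

(** A derivative of a tensor is again a single tensor: [dgp] absorbs both summands of the product
    rule in the first variable, and only derivatives along the tail reach [f]. *)
Lemma dpart_tens js p : exists p' js', (size js' <= size js)%N /\
  forall f, smoothR f -> dpart js (tens p f) = tens p' (dpart js' f).
Proof.
elim: js => [|j js [p' [js' [sjs jsP]]]]; first by exists p, [::].
case: (unliftP ord0 j) => [k|] ->.
  exists p', (k :: js'); split=> // f sf; rewrite dpart_cons jsP//; apply/funext => y.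
  by have [_] := tens_deriveS p' y k (smoothR_dpart js' sf).
exists (dgp p'), js'; split; first exact: (leq_trans sjs).
move=> f sf; rewrite dpart_cons jsP//; apply/funext => y.
by have [_] := tens_derive0 p' (dpart js' f) y.
Qed.

Lemma tens_bound p (k : nat) : exists2 C : R, 0 <= C & forall f y,
  (1 + `|y|) ^+ k * `|tens p f y| <= C * ((1 + `|tailv y|) ^+ k * `|f (tailv y)|).
Proof.
have [C C0 CP] := gp_rapid p k; exists C => // f y.
apply: le_trans (_ : ((1 + `|y ord0 ord0|) * (1 + `|tailv y|)) ^+ k * `|tens p f y| <= _).
  apply: ler_wpM2r => //; apply: lerXn2r (rnorm_cons_le y).
    by rewrite nnegrE addr_ge0.
  by rewrite nnegrE mulr_ge0// addr_ge0.
rewrite /tens normrM exprMn mulrACA; apply: ler_wpM2r; last exact: CP.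
by rewrite mulr_ge0// exprn_ge0// addr_ge0.
Qed.

Lemma tens_smooth p f : smoothR f -> smoothR (tens p f).
Proof.
move=> sf js; have [p' [js' [_ E]]] := dpart_tens js p; rewrite E//.
have sf' := smoothR_dpart js' sf.
split; first by apply: tens_continuous; exact: smoothR_continuous.
move=> j y; case: (unliftP ord0 j) => [k|] ->.
  by have [] := tens_deriveS p' y k sf'.
by have [] := tens_derive0 p' (dpart js' f) y.
Qed.

Lemma tens_rschwartz p f : rschwartz f -> rschwartz (tens p f).
Proof.
move=> [sf rf]; split; first exact: tens_smooth.
move=> js k; have [p' [js' [_ E]]] := dpart_tens js p; rewrite E//.
have [C C0 CP] := tens_bound p' k; have [M MP] := rf js' k.
by exists (C * M) => y; apply: le_trans (CP _ _) _; exact: ler_wpM2l.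
Qed.

Lemma tens_seminorm p N : exists2 C : R, 0 <= C & forall f M, smoothR f ->
  seminorm_le N M f -> seminorm_le N (C * M) (tens p f).
Proof.
have [|js|C C0 CP] := @finite_bound R n.+1 N (fun js C => (size js <= N)%N ->
    0 <= C /\ forall f M, smoothR f -> seminorm_le N M f -> forall y,
    (1 + `|y|) ^+ N * `|dpart js (tens p f) y| <= C * M).
- move=> js C C' CC' h sjs; have [C0 CP] := h sjs; split; first exact: le_trans CC'.
  move=> f M sf fM y; apply: le_trans (CP f M sf fM y) _; apply: ler_wpM2r => //.
  by apply: le_trans (fM [::] 0 isT); rewrite mulr_ge0// exprn_ge0// addr_ge0.
- have [p' [js' [sjs E]]] := dpart_tens js p; have [C C0 CP] := tens_bound p' N.
  exists C => sN; split=> // f M sf fM y; rewrite E//.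
  apply: le_trans (CP _ _) _; apply: ler_wpM2l => //; apply: fM.
  exact: leq_trans sN.
exists C => // f M sf fM js y sjs.
have [_ h] := CP js sjs sjs; exact: h.
Qed.

Definition restr u (t : R) : 'rV[R]_n -> R := fun z => u (consv t z).

Lemma restr_derive u t z j : smoothR u ->
  is_derive z (unitv R j) (restr u t) (restr (pd (lift ord0 j) u) t z).
Proof.
move=> su; apply/is_derive_line.
have /is_derive_line D := smoothR_derive (consv t z) (lift ord0 j) su.
have -> // : (fun h : R => restr u t (h *: unitv R j + z)) =
  (fun h : R => u (h *: unitv R (lift ord0 j) + consv t z)).
by apply/funext => h; rewrite consv_lineS.
Qed.

Lemma dpart_restr js u t : smoothR u ->
  dpart js (restr u t) = restr (dpart (map (lift ord0) js) u) t.
Proof.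
move=> su; elim: js => [//|j js ih]; rewrite map_cons !dpart_cons ih; apply/funext => z.
by have [_] := restr_derive t z j (smoothR_dpart (map (lift ord0) js) su).
Qed.

Lemma rschwartz_restr u t : rschwartz u -> rschwartz (restr u t).
Proof.
move=> [su ru]; split=> [js|js k]; rewrite dpart_restr//.
  have su' := smoothR_dpart (map (lift ord0) js) su.
  split=> [z|j z]; last by have [] := restr_derive t z j su'.
  apply: (@continuous_comp _ _ _ (@consv R n t) _ z); first exact: continuous_consv.
  exact: smoothR_continuous.
have [M MP] := ru (map (lift ord0) js) k; exists M => z.
apply: le_trans (MP (consv t z)); apply: ler_wpM2r => //; apply: lerXn2r.
- by rewrite nnegrE addr_ge0.
- by rewrite nnegrE addr_ge0.
- by rewrite lerD2l -{1}(tail_consv t z) rnorm_tailv.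
Qed.

End Tensor.

Section Multipliers.
Variables (R : realType) (n : nat).
Implicit Types (x xi : 'rV[R]_n).

Lemma dotR_line (h : R) j x xi : dotR (h *: unitv R j + x) xi = h * xi ord0 j + dotR x xi.
Proof.
rewrite /dotR [in RHS](_ : h * xi ord0 j = \sum_(i < n) h * (i == j)%:R * xi ord0 i).
  rewrite -big_split/=; apply: eq_bigr => i _.
  by rewrite !mxE eqxx/= mulrDl.
rewrite (bigD1 j)//= eqxx mulr1 big1 ?addr0// => i /negbTE ->.
by rewrite mulr0 mul0r.
Qed.

Lemma continuous_dotR xi : continuous (fun x => dotR x xi).
Proof.

apply: continuous_big => [|j _]; first exact: add_continuous.
move=> x; apply: (@continuousM _ _ (fun x : 'rV[R]_n => x ord0 j) (fun=> xi ord0 j)).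
  exact: coord_continuous.
exact: cst_continuous.
Qed.

Lemma moderate_trig xi (a b : R) :
  moderate (fun x => a * cos (dotR x xi) + b * sin (dotR x xi)).
Proof.
apply: (@moderate_coind _ _ (fun m => exists a b : R,
  m = fun x => a * cos (dotR x xi) + b * sin (dotR x xi))); last by exists a, b.
move=> {a b} _ [a [b ->]]; split=> [x||j].
- have cd := @continuous_dotR xi x.
  apply: (@continuousD _ _ _ (fun x => a * cos (dotR x xi)) (fun x => b * sin (dotR x xi))).
    apply: (@continuousM _ _ (fun=> a) (fun x : 'rV[R]_n => cos (dotR x xi))); first exact: cst_continuous.
    exact: (continuous_comp cd (@continuous_cos _ _)).
  apply: (@continuousM _ _ (fun=> b) (fun x : 'rV[R]_n => sin (dotR x xi))); first exact: cst_continuous.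
  exact: (continuous_comp cd (@continuous_sin _ _)).
- exists 0%N, (`|a| + `|b|) => x; rewrite expr0 mulr1.
  apply: le_trans (ler_normD _ _) _; rewrite !normrM.
  have h1 : `|cos (dotR x xi)| <= 1 by rewrite ler_norml cos_geN1 cos_le1.
  have h2 : `|sin (dotR x xi)| <= 1 by rewrite ler_norml sin_geN1 sin_le1.
  by apply: lerD; rewrite ler_piMr.
- exists (fun x => (xi ord0 j * b) * cos (dotR x xi) + (- (xi ord0 j * a)) * sin (dotR x xi)).
    by exists (xi ord0 j * b), (- (xi ord0 j * a)).
  move=> x; apply/is_derive_line.
  have -> : (fun h : R => a * cos (dotR (h *: unitv R j + x) xi) + b * sin (dotR (h *: unitv R j + x) xi))
      = (fun h : R => a * cos (h * xi ord0 j + dotR x xi) + b * sin (h * xi ord0 j + dotR x xi)).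
    by apply/funext => h; rewrite dotR_line.
  apply: (is_derive_eq (is_deriveD
    (is_deriveZ a (is_derive_affine (xi ord0 j) (is_derive_cos (dotR x xi))))
    (is_deriveZ b (is_derive_affine (xi ord0 j) (is_derive_sin (dotR x xi)))))).
  by rewrite /GRing.scale /=; ring.
Qed.

Lemma moderate_cos xi : moderate (fun x : 'rV[R]_n => cos (dotR x xi)).
Proof.
by have := moderate_trig xi 1 0; congr moderate; apply/funext => x; rewrite mul1r mul0r addr0.
Qed.

Lemma moderate_sin xi : moderate (fun x : 'rV[R]_n => sin (dotR x xi)).
Proof.
by have := moderate_trig xi 0 1; congr moderate; apply/funext => x; rewrite mul1r mul0r add0r.
Qed.

Lemma moderate_coord (j : 'I_n) : moderate (fun x => x ord0 j).
Proof.
suff : moderate (fun x => 1 * x ord0 j + 0).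
  by congr moderate; apply/funext => x; rewrite mul1r addr0.
apply: (@moderate_coind _ _ (fun m => exists a b : R, m = fun x => a * x ord0 j + b)).
  move=> _ [a [b ->]]; split=> [x||i].
  - apply: (@continuousD _ _ _ (fun x => a * x ord0 j) (fun=> b)); last exact: cst_continuous.
    apply: (@continuousM _ _ (fun=> a) (fun x => x ord0 j)); first exact: cst_continuous.
    exact: coord_continuous.
  - exists 1%N, (`|a| + `|b|) => x; rewrite expr1; apply: le_trans (ler_normD _ _) _.
    have h := rnorm_coord x j; have h0 := normr_ge0 (x : 'rV[R]_n).
    rewrite normrM mulrDl; apply: lerD; last by rewrite ler_peMr// lerDl.
    by rewrite ler_wpM2l//; lra.
  - exists (fun=> 0 * (0 : 'rV[R]_n) ord0 j + a * (j == i)%:R).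
      by exists 0, (a * (j == i)%:R); apply/funext => x; rewrite !mul0r.
    move=> x; apply/is_derive_line.
    have -> : (fun h : R => a * (h *: unitv R i + x) ord0 j + b) =
        (fun h : R => id (h * (a * (j == i)%:R) + (a * x ord0 j + b))).
      by apply/funext => h; rewrite !mxE eqxx /=; ring.
    apply: (is_derive_eq (is_derive_affine (a * (j == i)%:R) (@is_derive_id R R (a * x ord0 j + b) 1))).
    by rewrite mulr1 mul0r add0r.
by exists 1, 0.
Qed.

End Multipliers.

(** * Invariant forms on Schwartz functions *)

Section MeanValue.
Variable R : realType.

Lemma mean_value (f f' : R -> R) (a b : R) : (forall x, is_derive x (1 : R) f (f' x)) ->
  exists c, `|c - a| <= `|b - a| /\ f b - f a = f' c * (b - a).
Proof.
move=> df.
have cf (i : interval R) : {within [set` i], continuous f}.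
  by apply: derivable_within_continuous => x _; have [] := df x.
have [ab|ba|->] := ltgtP a b; last first.
- by exists b; rewrite !subrr mulr0.
- have [c] := MVT ba (fun x _ => df x) (cf _); rewrite in_itv/= => /andP[c1 c2] E.
  exists c; split; last by rewrite -opprB E -mulrN opprB.
  by rewrite distrC (distrC b) !gtr0_norm ?subr_gt0//; lra.
- have [c] := MVT ab (fun x _ => df x) (cf _); rewrite in_itv/= => /andP[c1 c2] E.
  by exists c; split=> //; rewrite !gtr0_norm ?subr_gt0//; lra.
Qed.

End MeanValue.

(** * Sheared functions and their difference quotients in slope and offset *)

Section ShearFamily.
Variables (R : realType) (n : nat).
Notation T := 'rV[R]_n.+1.
Implicit Types (W : R -> T -> R) (y : T).

Definition dsig W : R -> T -> R := fun s y => 'D_(1 : R) (fun s => W s y) s.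
Definition dvar j W : R -> T -> R := fun s y => pd j (W s) y.
Definition mul0 W : R -> T -> R := fun s y => y ord0 ord0 * W s y.
Definition sheared W (s t : R) : T -> R := fun y => W (t + s * y ord0 ord0) y.

(* What the shear argument uses of a Schwartz function W on R x R^(n+1); the
   derivative along the line (c, e_0) is required separately because partial
   derivatives alone do not give it. *)
Record shear_class (C : (R -> T -> R) -> Prop) := ShearClass {
  sc_dsig : forall W, C W -> C (dsig W);
  sc_dvar : forall j W, C W -> C (dvar j W);
  sc_mul0 : forall W, C W -> C (mul0 W);
  sc_comm : forall j W, C W -> dsig (dvar j W) = dvar j (dsig W);
  sc_derive : forall W s y, C W -> is_derive s (1 : R) (fun s => W s y) (dsig W s y);
  sc_derive0 : forall W s y (c : R), C W ->
    is_derive (0 : R) 1 (fun h : R => W (h * c + s) (h *: unitv R ord0 + y))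
      (c * dsig W s y + dvar ord0 W s y);
  sc_deriveS : forall W s y j, C W ->
    is_derive y (unitv R (lift ord0 j)) (W s) (dvar (lift ord0 j) W s y);
  sc_rapid : forall W (k : nat), C W -> exists2 M : R, 0 <= M &
    forall s y, ((1 + `|s|) * (1 + `|y|)) ^+ k * `|W s y| <= M;
  sc_cont : forall W s t, C W -> continuous (sheared W s t) }.

Variables (C : (R -> T -> R) -> Prop) (HC : shear_class C).

Lemma sheared_derive0 W s t y : C W ->
  is_derive y (unitv R ord0) (sheared W s t)
    (s * sheared (dsig W) s t y + sheared (dvar ord0 W) s t y).
Proof.
move=> CW; apply/is_derive_line.
have -> : (fun h : R => sheared W s t (h *: unitv R ord0 + y)) =
    (fun h : R => W (h * s + (t + s * y ord0 ord0)) (h *: unitv R ord0 + y)).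
  by apply/funext => h; rewrite /sheared line0_head; congr (W _ _); ring.
exact: (sc_derive0 HC).
Qed.

Lemma sheared_deriveS W s t y j : C W ->
  is_derive y (unitv R (lift ord0 j)) (sheared W s t) (sheared (dvar (lift ord0 j) W) s t y).
Proof.
move=> CW; apply/is_derive_line.
have -> : (fun h : R => sheared W s t (h *: unitv R (lift ord0 j) + y)) =
    (fun h : R => W (t + s * y ord0 ord0) (h *: unitv R (lift ord0 j) + y)).
  by apply/funext => h; rewrite /sheared lineS_head.
by apply/is_derive_line; exact: (sc_deriveS HC).
Qed.

(** The form will be integrated over the offset [t], so a factor [(1 + |t|)^2] is bought with two
    extra powers of the decay of [W] in both variables. By [near_offset], the condition on [s] holds
    at all points that the perturbations meet. *)
Lemma sheared_weight W (k : nat) : C W -> exists2 M : R, 0 <= M &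
  forall t s y, `|s - t| <= 2 * (1 + `|y|) ->
    (1 + `|t|) ^+ 2 * (1 + `|y|) ^+ k * `|W s y| <= M.
Proof.
move=> CW; have [M M0 MP] := sc_rapid HC (k + 2) CW; exists (9 * M); first exact: mulr_ge0.
move=> t s y st; have y0 := normr_ge0 y; have s0 := normr_ge0 s; have t0 := normr_ge0 t.
set X := (1 + `|s|) * (1 + `|y|).
have ts : 1 + `|t| <= 3 * X.
  have h : `|t| <= `|s| + `|s - t|.
    by rewrite -{1}(subKr s t); exact: ler_normB.
  by rewrite /X; have := mulr_ge0 s0 y0; lra.
have yX : 1 + `|y| <= X by rewrite /X ler_peMl ?lerDl// addr_ge0.
have X0 : 0 <= X by rewrite mulr_ge0// addr_ge0.
have h1 : (1 + `|t|) ^+ 2 <= (3 * X) ^+ 2.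
  by apply: lerXn2r ts; rewrite nnegrE ?mulr_ge0// addr_ge0.
have h2 : (1 + `|y|) ^+ k <= X ^+ k by apply: lerXn2r yX; rewrite nnegrE// addr_ge0.
apply: le_trans (_ : (3 * X) ^+ 2 * X ^+ k * `|W s y| <= _).
  by apply: ler_wpM2r => //; apply: ler_pM => //; apply: exprn_ge0; rewrite addr_ge0.
have -> : (3 * X) ^+ 2 * X ^+ k * `|W s y| = 9 * (X ^+ (k + 2) * `|W s y|).
  by rewrite exprD; ring.
by rewrite ler_wpM2l//; exact: MP.
Qed.

Section Perturbation.
(* (eta, zeta) = (1, 0) moves the offset t, (0, 1) moves the slope s. *)
Variables eta zeta : R.
Hypothesis heta : `|eta| <= 1.
Hypothesis hzeta : `|zeta| <= 1.

Let I : Type := (R * R * R)%type.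
(** An index [((s, t), h)] consists of a slope, an offset and an increment. The increment is nonzero
    for the sake of the quotients, and the slopes before and after it stay in [-1, 1], which keeps
    the bounds uniform. *)
Definition pert_ok (i : I) : Prop :=
  [/\ `|i.1.1| <= 1, `|i.1.1 + i.2 * zeta| <= 1, i.2 != 0 & `|i.2| <= 1].
Definition pert_om (i : I) : R := (1 + `|i.1.2|) ^+ 2.
Definition speed y : R := eta + zeta * y ord0 ord0.
Definition pert0 W (i : I) y : R := sheared W i.1.1 i.1.2 y.
Definition pert1 W (i : I) y : R := sheared W (i.1.1 + i.2 * zeta) (i.1.2 + i.2 * eta) y.
Definition quot1 W (i : I) y : R := (pert1 W i y - pert0 W i y) / i.2.
(** What is left of the first difference quotient after subtracting its limit, divided once more by
    the increment: its boundedness makes the error in [sform_expand] quadratic. *)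
Definition quot2 W (i : I) y : R := (quot1 W i y - speed y * pert0 (dsig W) i y) / i.2.

Let At (f : I -> T -> R) := exists2 W, C W &
  [\/ f = pert0 W, f = pert1 W, f = quot1 W | f = quot2 W].

Let At0 W : C W -> At (pert0 W). Proof. by exists W => //; exact: Or41. Qed.
Let At1 W : C W -> At (pert1 W). Proof. by exists W => //; exact: Or42. Qed.
Let At2 W : C W -> At (quot1 W). Proof. by exists W => //; exact: Or43. Qed.
Let At3 W : C W -> At (quot2 W). Proof. by exists W => //; exact: Or44. Qed.

Lemma pert1E W i y : pert1 W i y = W (i.1.2 + i.1.1 * y ord0 ord0 + i.2 * speed y) y.
Proof. by rewrite /pert1 /sheared /speed; congr (W _ _); ring. Qed.

Lemma speed_le y : `|speed y| <= 1 + `|y|.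
Proof.
apply: le_trans (ler_normD _ _) _; apply: lerD => //.
rewrite normrM; apply: le_trans (_ : 1 * `|y| <= _); last by rewrite mul1r.
by apply: ler_pM => //; exact: rnorm_coord.
Qed.

Lemma near_offset i y (s : R) : pert_ok i ->
  `|s - (i.1.2 + i.1.1 * y ord0 ord0)| <= `|i.2 * speed y| -> `|s - i.1.2| <= 2 * (1 + `|y|).
Proof.
move=> [h1 _ _ h2] hs; have y0 := normr_ge0 y.
have e1 : `|i.2 * speed y| <= 1 + `|y|.
  rewrite normrM; apply: le_trans (_ : 1 * (1 + `|y|) <= _); last by rewrite mul1r.
  by apply: ler_pM => //; exact: speed_le.
have e2 : `|i.1.1 * y ord0 ord0| <= `|y|.
  rewrite normrM; apply: le_trans (_ : 1 * `|y| <= _); last by rewrite mul1r.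
  by apply: ler_pM => //; exact: rnorm_coord.
have -> : s - i.1.2 = (s - (i.1.2 + i.1.1 * y ord0 ord0)) + i.1.1 * y ord0 ord0 by ring.
by apply: le_trans (ler_normD _ _) _; lra.
Qed.

Lemma quot1_bound W i y : C W -> pert_ok i -> exists2 s : R,
  `|s - (i.1.2 + i.1.1 * y ord0 ord0)| <= `|i.2 * speed y| &
  `|quot1 W i y| <= (1 + `|y|) * `|dsig W s y|.
Proof.
move=> CW [_ _ h0 h1]; set s0 := i.1.2 + i.1.1 * y ord0 ord0.
have [s [s1 s2]] := mean_value s0 (s0 + i.2 * speed y) (fun s => sc_derive HC s y CW).
rewrite addrAC subrr add0r in s1 s2; exists s => //.
have -> : quot1 W i y = dsig W s y * speed y.
  by rewrite /quot1 pert1E /pert0 /sheared -/s0 s2; field.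
by rewrite normrM mulrC; apply: ler_wpM2r => //; exact: speed_le.
Qed.

(** The mean value theorem is used twice, for [W] and then for [dsig W] on the shorter interval; the
    increment cancels, and two factors of the speed, each at most [1 + |y|], remain. *)
Lemma quot2_bound W i y : C W -> pert_ok i -> exists2 s : R,
  `|s - (i.1.2 + i.1.1 * y ord0 ord0)| <= `|i.2 * speed y| &
  `|quot2 W i y| <= (1 + `|y|) ^+ 2 * `|dsig (dsig W) s y|.
Proof.
move=> CW [_ _ h0 h1]; set s0 := i.1.2 + i.1.1 * y ord0 ord0.
have [s [s1 s2]] := mean_value s0 (s0 + i.2 * speed y) (fun s => sc_derive HC s y CW).
rewrite addrAC subrr add0r in s1 s2.
have [s' [s1' s2']] := mean_value s0 s (fun s => sc_derive HC s y (sc_dsig HC CW)).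
exists s'; first exact: le_trans s1' s1.
have -> : quot2 W i y = dsig (dsig W) s' y * (s - s0) * speed y / i.2.
  by rewrite -s2' /quot2 /quot1 pert1E /pert0 /sheared -/s0 s2; field.
have hs : `|(s - s0) / i.2| <= `|speed y|.
  by rewrite normrM normfV ler_pdivrMr ?normr_gt0// -normrM mulrC.
rewrite !normrM in hs *.
have -> : `|dsig (dsig W) s' y| * `|s - s0| * `|speed y| * `|i.2^-1| =
  (`|s - s0| * `|i.2^-1|) * `|speed y| * `|dsig (dsig W) s' y| by ring.
apply: ler_wpM2r => //; rewrite expr2; have sp := speed_le y.
apply: ler_pM => //.
exact: le_trans hs sp.
Qed.

Lemma pert_om_gt0 i : pert_ok i -> 0 < pert_om i.
Proof. by move=> _; rewrite /pert_om exprn_gt0// ltr_pwDl. Qed.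

Let span := fam_span pert_ok At.

Let span0 W : C W -> span (pert0 W). Proof. by move=> /At0; exact: fam_atom. Qed.
Let span1 W : C W -> span (pert1 W). Proof. by move=> /At1; exact: fam_atom. Qed.
Let span2 W : C W -> span (quot1 W). Proof. by move=> /At2; exact: fam_atom. Qed.
Let span3 W : C W -> span (quot2 W). Proof. by move=> /At3; exact: fam_atom. Qed.

Let slope (i : I) := i.1.1.
Let slope1 (i : I) := i.1.1 + i.2 * zeta.
Let slopeP i : pert_ok i -> `|slope i| <= 1. Proof. by case. Qed.
Let slope1P i : pert_ok i -> `|slope1 i| <= 1. Proof. by case. Qed.
Let zetaP i : pert_ok i -> `|zeta| <= 1. Proof. by []. Qed.

Lemma pert_rapid f : At f -> fam_rapid pert_ok pert_om f.
Proof.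
move=> [W CW fE] k; rewrite /pert_om.
have weak i y (s v : R) W' k' M : pert_ok i ->
    `|s - (i.1.2 + i.1.1 * y ord0 ord0)| <= `|i.2 * speed y| ->
    v <= (1 + `|y|) ^+ k' * `|W' s y| ->
    (forall t s y, `|s - t| <= 2 * (1 + `|y|) ->
      (1 + `|t|) ^+ 2 * (1 + `|y|) ^+ (k + k') * `|W' s y| <= M) ->
    (1 + `|i.1.2|) ^+ 2 * (1 + `|y|) ^+ k * v <= M.
  move=> oi hs hv MP; apply: le_trans (MP _ _ _ (near_offset oi hs)).
  have -> : (1 + `|i.1.2|) ^+ 2 * (1 + `|y|) ^+ (k + k') * `|W' s y| =
    (1 + `|i.1.2|) ^+ 2 * (1 + `|y|) ^+ k * ((1 + `|y|) ^+ k' * `|W' s y|) by rewrite exprD; ring.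
  apply: ler_wpM2l hv.
  by rewrite mulr_ge0// exprn_ge0// addr_ge0.
case: fE => ->.
- have [M _ MP] := sheared_weight (k + 0) CW; exists M => i y oi.
  apply: (weak i y (i.1.2 + i.1.1 * y ord0 ord0) _ W 0%N M oi _ _ MP).
    by rewrite subrr normr0.
  by rewrite expr0 mul1r.
- have [M _ MP] := sheared_weight (k + 0) CW; exists M => i y oi.
  apply: (weak i y (i.1.2 + i.1.1 * y ord0 ord0 + i.2 * speed y) _ W 0%N M oi _ _ MP).
    by rewrite addrAC subrr add0r.
  by rewrite expr0 mul1r pert1E.
- have [M _ MP] := sheared_weight (k + 1) (sc_dsig HC CW); exists M => i y oi.
  have [s s1 s2] := quot1_bound y CW oi.
  by apply: (weak i y s _ _ 1%N M oi s1 _ MP); rewrite expr1.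
- have [M _ MP] := sheared_weight (k + 2) (sc_dsig HC (sc_dsig HC CW)); exists M => i y oi.
  have [s s1 s2] := quot2_bound y CW oi.
  exact: (weak i y s _ _ 2%N M oi s1 s2 MP).
Qed.

Lemma speed_continuous : continuous speed.
Proof.
move=> y; apply: (@continuousD _ _ _ (fun=> eta) (fun y : T => zeta * y ord0 ord0)).
  exact: cst_continuous.
apply: (@continuousM _ _ (fun=> zeta) (fun y : T => y ord0 ord0)); first exact: cst_continuous.
exact: coord_continuous.
Qed.

Lemma pert_continuous f i : At f -> continuous (f i).
Proof.
move=> [W CW fE] y.
have c0 : {for y, continuous (pert0 W i)} by exact: (sc_cont HC).
have c1 : {for y, continuous (pert1 W i)} by exact: (sc_cont HC).
have c0' : {for y, continuous (pert0 (dsig W) i)} by apply: (sc_cont HC); exact: (sc_dsig HC).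
have cq : {for y, continuous (quot1 W i)}.
  exact: (continuousM (continuousB c1 c0) (@cst_continuous _ _ (i.2^-1) y)).
case: fE => ->//.
exact: (continuousM (continuousB cq (continuousM (@speed_continuous y) c0'))
  (@cst_continuous _ _ (i.2^-1) y)).
Qed.

Lemma pert0_derive0 W i y : C W -> is_derive y (unitv R ord0) (pert0 W i)
  (slope i * pert0 (dsig W) i y + pert0 (dvar ord0 W) i y).
Proof. exact: sheared_derive0. Qed.

Lemma pert1_derive0 W i y : C W -> is_derive y (unitv R ord0) (pert1 W i)
  (slope1 i * pert1 (dsig W) i y + pert1 (dvar ord0 W) i y).
Proof. exact: sheared_derive0. Qed.

Lemma quot1_derive0 W i y : C W -> pert_ok i -> is_derive y (unitv R ord0) (quot1 W i)
  (slope i * quot1 (dsig W) i y + (zeta * pert1 (dsig W) i y + quot1 (dvar ord0 W) i y)).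
Proof.
move=> CW [_ _ h0 _].
have D := is_deriveM (is_deriveB (pert1_derive0 i y CW) (pert0_derive0 i y CW))
  (@is_derive_cst R T R (i.2^-1) y (unitv R ord0)).
apply: (is_derive_eq D); rewrite /quot1 /GRing.scale /= /slope /slope1.
by field.
Qed.

Lemma speed_derive0 y : is_derive y (unitv R ord0) speed zeta.
Proof.
apply/is_derive_line.
have -> : (fun h : R => speed (h *: unitv R ord0 + y)) = (fun h => id (h * zeta + speed y)).
  by apply/funext => h; rewrite /speed line0_head /=; ring.
by apply: (is_derive_eq (is_derive_affine zeta (@is_derive_id R R (speed y) 1))); rewrite mulr1.
Qed.

Lemma speed_deriveS y j : is_derive y (unitv R (lift ord0 j)) speed 0.
Proof.
apply/is_derive_line.
have -> : (fun h : R => speed (h *: unitv R (lift ord0 j) + y)) = (fun h => cst (speed y) h).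
  by apply/funext => h; rewrite /speed lineS_head.
exact: is_derive_cst.
Qed.

Lemma quot2_derive0 W i y : C W -> pert_ok i -> is_derive y (unitv R ord0) (quot2 W i)
  (slope i * quot2 (dsig W) i y + (zeta * quot1 (dsig W) i y + quot2 (dvar ord0 W) i y)).
Proof.
move=> CW oi; have [_ _ h0 _] := oi.
have D := is_deriveM (is_deriveB (quot1_derive0 y CW oi)
   (is_deriveM (speed_derive0 y) (pert0_derive0 i y (sc_dsig HC CW))))
  (@is_derive_cst R T R (i.2^-1) y (unitv R ord0)).
apply: (is_derive_eq D); rewrite /quot2 /GRing.scale /= /slope (sc_comm HC ord0 CW).
have -> : zeta * quot1 (dsig W) i y = zeta * ((pert1 (dsig W) i y - pert0 (dsig W) i y) / i.2) by [].
by field.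
Qed.

Lemma pert_deriveS W i y j : C W ->
  [/\ is_derive y (unitv R (lift ord0 j)) (pert0 W i) (pert0 (dvar (lift ord0 j) W) i y),
      is_derive y (unitv R (lift ord0 j)) (pert1 W i) (pert1 (dvar (lift ord0 j) W) i y),
      is_derive y (unitv R (lift ord0 j)) (quot1 W i) (quot1 (dvar (lift ord0 j) W) i y) &
      is_derive y (unitv R (lift ord0 j)) (quot2 W i) (quot2 (dvar (lift ord0 j) W) i y)].
Proof.
move=> CW.
have d0 W' : C W' ->
    is_derive y (unitv R (lift ord0 j)) (pert0 W' i) (pert0 (dvar (lift ord0 j) W') i y).
  exact: sheared_deriveS.
have d1 : is_derive y (unitv R (lift ord0 j)) (pert1 W i) (pert1 (dvar (lift ord0 j) W) i y).
  exact: sheared_deriveS.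
have dc := @is_derive_cst R T R (i.2^-1) y (unitv R (lift ord0 j)).
have dq : is_derive y (unitv R (lift ord0 j)) (quot1 W i) (quot1 (dvar (lift ord0 j) W) i y).
  apply: (is_derive_eq (is_deriveM (is_deriveB d1 (d0 W CW)) dc)).
  by rewrite /quot1 /GRing.scale /= mulr0 add0r mulrC.
split=> //; first exact: d0.
apply: (is_derive_eq (is_deriveM (is_deriveB dq
   (is_deriveM (speed_deriveS y j) (d0 _ (sc_dsig HC CW)))) dc)).
rewrite /quot2 /GRing.scale /= (sc_comm HC (lift ord0 j) CW) !mulr0 add0r addr0.
by rewrite mulrC.
Qed.

(** Derivatives of the four kinds of atoms are combinations of atoms with the bounded coefficients
    [slope], [slope1], [zeta] and 1. Perturbing the slope adds a quotient of one order less, so no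
    negative power of the increment ever appears outside a quotient. *)
Lemma pert_fam_diff f : At f -> fam_diff pert_ok pert_om At f.
Proof.
move=> Af; split=> [|i _|j]; [exact: pert_rapid|exact: pert_continuous|].
have [W CW fE] := Af; have CW' := sc_dsig HC CW; have CWj := sc_dvar HC j CW.
case: (unliftP ord0 j) => [k jE|jE]; last first.
  rewrite jE in CWj *; case: fE => ->.
  - exists (fun i y => slope i * pert0 (dsig W) i y + pert0 (dvar ord0 W) i y).
      apply: fam_add; last exact: span0.
      exact: (fam_scale slopeP (span0 CW')).
    by move=> i y _; exact: pert0_derive0.
  - exists (fun i y => slope1 i * pert1 (dsig W) i y + pert1 (dvar ord0 W) i y).
      apply: fam_add; last exact: span1.
      exact: (fam_scale slope1P (span1 CW')).
    by move=> i y _; exact: pert1_derive0.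
  - exists (fun i y => slope i * quot1 (dsig W) i y +
        (zeta * pert1 (dsig W) i y + quot1 (dvar ord0 W) i y)).
      apply: (fam_add (fam_scale slopeP (span2 CW'))).
      apply: fam_add; last exact: span2.
      exact: (fam_scale zetaP (span1 CW')).
    by move=> i y oi; exact: quot1_derive0.
  - exists (fun i y => slope i * quot2 (dsig W) i y +
        (zeta * quot1 (dsig W) i y + quot2 (dvar ord0 W) i y)).
      apply: (fam_add (fam_scale slopeP (span3 CW'))).
      apply: fam_add; last exact: span3.
      exact: (fam_scale zetaP (span2 CW')).
    by move=> i y oi; exact: quot2_derive0.
rewrite jE in CWj *; have D i y := pert_deriveS i y k CW.
case: fE => ->.
- by exists (pert0 (dvar (lift ord0 k) W)); [exact: span0|move=> i y _; case: (D i y)].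
- by exists (pert1 (dvar (lift ord0 k) W)); [exact: span1|move=> i y _; case: (D i y)].
- by exists (quot1 (dvar (lift ord0 k) W)); [exact: span2|move=> i y _; case: (D i y)].
- by exists (quot2 (dvar (lift ord0 k) W)); [exact: span3|move=> i y _; case: (D i y)].
Qed.

Lemma pert_rschwartz W i : C W -> pert_ok i ->
  [/\ rschwartz (pert0 W i), rschwartz (pert1 W i), rschwartz (quot1 W i) & rschwartz (quot2 W i)].
Proof.
move=> CW oi; have h := fam_span_rschwartz pert_om_gt0 pert_fam_diff.
split; apply: h => //; [exact: span0|exact: span1|exact: span2|exact: span3].
Qed.

Lemma pert_seminorm W N : C W -> exists2 M : R, 0 <= M & forall i, pert_ok i ->
  [/\ seminorm_le N (M / pert_om i) (pert0 W i), seminorm_le N (M / pert_om i) (pert1 W i),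
      seminorm_le N (M / pert_om i) (quot1 W i) & seminorm_le N (M / pert_om i) (quot2 W i)].
Proof.
move=> CW.
have h f : span f -> exists2 M : R, 0 <= M & forall i, pert_ok i ->
    seminorm_le N (M / pert_om i) (f i).
  move=> sf; have om0 i : pert_ok i -> 0 <= pert_om i by move=> /pert_om_gt0/ltW.
  have [M M0 MP] := fam_span_seminorm om0 pert_fam_diff sf N.
  exists M => // i oi js x sjs; rewrite ler_pdivlMr ?pert_om_gt0// mulrC.
  exact: MP.
have [M0 M00 P0] := h _ (span0 CW); have [M1 M10 P1] := h _ (span1 CW).
have [M2 M20 P2] := h _ (span2 CW); have [M3 M30 P3] := h _ (span3 CW).
exists (M0 + M1 + M2 + M3); first by rewrite !addr_ge0.
have w f (M M' : R) i : pert_ok i -> M <= M' -> seminorm_le N (M / pert_om i) (f i) ->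
    seminorm_le N (M' / pert_om i) ((f : I -> T -> R) i).
  move=> oi MM' sM js x sj; apply: le_trans (sM js x sj) _.
  by apply: ler_wpM2r => //; rewrite invr_ge0 ltW// pert_om_gt0.
by move=> i oi; split; [apply: (w _ M0)|apply: (w _ M1)|apply: (w _ M2)|apply: (w _ M3)] => //;
  [lra|exact: P0|lra|exact: P1|lra|exact: P2|lra|exact: P3].
Qed.

End Perturbation.
End ShearFamily.

(** * Modulations near frequency zero, uniformly in the frequency *)

Section TrigFamily.
Variables (R : realType) (n : nat) (j : 'I_n).
Implicit Types (t z : R) (u : 'rV[R]_n -> R).

Lemma cos_sub1_le (x : R) : `|cos x - 1| <= `|x|.
Proof.
have [c [_ E]] := mean_value 0 x (fun x => is_derive_cos x).
rewrite cos0 subr0 in E; rewrite E normrM ler_piMl//.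
by rewrite normrN ler_norml sin_geN1 sin_le1.
Qed.

Lemma sin_subx_le (x : R) : `|sin x - x| <= `|x| ^+ 2.
Proof.
have [c [cx E]] := mean_value 0 x (fun x => is_deriveB (is_derive_sin x) (@is_derive_id R R x 1)).
rewrite !fctE sin0 !subr0 in E cx; rewrite E normrM expr2; apply: ler_pM => //.
exact: le_trans (cos_sub1_le c) cx.
Qed.

(* cos(tz), sin(tz) and the first-order remainders needed to differentiate the
   modulation group at t = 0; the family is closed under d/dz. *)
Definition trigf (k : nat) t z : R := match k with
  | 0 => cos (t * z) | 1 => sin (t * z)
  | 2 => (cos (t * z) - 1) / t | _ => (sin (t * z) / t - z) / t end.
Definition trigc (k : nat) t : R := match k with 0 => - t | 1 => t | 2 => -1 | _ => 1 end.
Definition trign (k : nat) : nat := match k with 0 => 1 | 1 => 0 | 2 => 1 | _ => 2 end.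

Definition trig_ok t : Prop := t != 0 /\ `|t| <= 1.

Lemma trigf_derive k t z : t != 0 -> is_derive z (1 : R) (trigf k t) (trigc k t * trigf (trign k) t z).
Proof.
move=> t0.
have lin : is_derive z (1 : R) (fun z => t * z) t.
  by apply: (is_derive_eq (is_deriveZ t (@is_derive_id R R z 1))); rewrite /GRing.scale /= mulr1.
have dc := is_derive1_comp (is_derive_cos (t * z)) lin.
have ds := is_derive1_comp (is_derive_sin (t * z)) lin.
have cc (a : R) := @is_derive_cst R R R a z 1.
case: k => [|[|[|k]]] /=.
- by apply: (is_derive_eq dc); ring.
- by apply: (is_derive_eq ds); ring.
- apply: (is_derive_eq (is_deriveM (is_deriveB dc (cc 1)) (cc t^-1))).
  by rewrite /GRing.scale /=; field.
- apply: (is_derive_eq (is_deriveM (is_deriveB (is_deriveM ds (cc t^-1)) (@is_derive_id R R z 1)) (cc t^-1))).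
  by rewrite /GRing.scale /=; field.
Qed.

Lemma trigf_bound k t z : trig_ok t -> `|trigf k t z| <= (1 + `|z|) ^+ 2.
Proof.
move=> [t0 t1]; have z0 := normr_ge0 z.
have one : 1 <= (1 + `|z|) ^+ 2 by apply: exprn_ege1; rewrite lerDl.
have tp : 0 < `|t| by rewrite normr_gt0.
case: k => [|[|[|k]]] /=.
- by apply: le_trans one; rewrite ler_norml cos_geN1 cos_le1.
- by apply: le_trans one; rewrite ler_norml sin_geN1 sin_le1.
- rewrite normrM normfV ler_pdivrMr//; apply: le_trans (cos_sub1_le _) _.
  rewrite normrM mulrC; apply: ler_wpM2r => //.
  by rewrite expr2; have := mulr_ge0 z0 z0; lra.
- have -> : (sin (t * z) / t - z) / t = (sin (t * z) - t * z) / t ^+ 2 by field.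
  rewrite normrM normfV ler_pdivrMr ?normr_gt0 ?sqrf_eq0//.
  apply: le_trans (sin_subx_le _) _; rewrite normrM normrX exprMn mulrC.
  apply: ler_wpM2r; first exact: exprn_ge0.
  by rewrite !expr2; have := mulr_ge0 z0 z0; lra.
Qed.

Definition trig_mul k u t : 'rV[R]_n -> R := fun x => trigf k t (x ord0 j) * u x.

Let At (f : R -> 'rV[R]_n -> R) := exists k u, rschwartz u /\ f = trig_mul k u.

Lemma trig_fam_diff f : At f -> fam_diff trig_ok (fun=> 1) At f.
Proof.
move=> [k [u [ru ->]]]; split=> [m|t [t0 _] x|i].
- have [M M0 MP] := rschwartz_rapid (m + 2) ru; exists M => t x ot; rewrite mul1r.
  apply: le_trans (MP x); rewrite /trig_mul normrM exprD -mulrA.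
  apply: ler_wpM2l; first by rewrite exprn_ge0// addr_ge0.
  apply: ler_wpM2r => //; apply: le_trans (trigf_bound k (x ord0 j) ot) _.
  by apply: lerXn2r; rewrite ?nnegrE ?addr_ge0// lerD2l rnorm_coord.
- have cu := smoothR_continuous (proj1 ru).
  apply: (continuousM _ (cu x)).
  apply: (@continuous_comp _ _ _ (fun x : 'rV[R]_n => x ord0 j) (trigf k t)).
    exact: coord_continuous.
  apply: differentiable_continuous; apply/derivable1_diffP.
  by have [] := trigf_derive k (x ord0 j) t0.
- exists (fun t x => (j == i)%:R * trigc k t * trig_mul (trign k) u t x + trig_mul k (pd i u) t x).
    apply: fam_add; last first.
      by apply: fam_atom; exists k, (pd i u); split=> //; exact: rschwartz_pd.
    apply: (@fam_scale _ _ _ _ _ (fun t => (j == i)%:R * trigc k t) 1); last first.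
      by apply: fam_atom; exists (trign k), u.
    move=> t [_ t1]; rewrite normrM; apply: mulr_ile1 => //.
      by case: (j == i); rewrite ?normr1 ?normr0.
    by case: k => [|[|[|k]]] /=; rewrite ?normrN ?normr1.
  move=> t x [t0 _]; apply/is_derive_line.
  have -> : (fun h : R => trig_mul k u t (h *: unitv R i + x)) =
      (fun h : R => trigf k t (h * (j == i)%:R + x ord0 j)) * (fun h => u (h *: unitv R i + x)).
    by apply/funext => h; rewrite /trig_mul !mxE eqxx.
  have /is_derive_line du := smoothR_derive x i (proj1 ru).
  apply: (is_derive_eq (is_deriveM (is_derive_affine (j == i)%:R (trigf_derive k (x ord0 j) t0)) du)).
  by rewrite /= scale0r mul0r !add0r /trig_mul -![_ *: _]/(_ * _); ring.
Qed.

Lemma trig_rschwartz k u t : rschwartz u -> trig_ok t -> rschwartz (trig_mul k u t).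
Proof.
move=> ru ot; apply: (fam_span_rschwartz (fun _ _ => ltr01) trig_fam_diff) => //.
by apply: fam_atom; exists k, u.
Qed.

Lemma trig_seminorm k u N : rschwartz u -> exists2 M : R, 0 <= M &
  forall t, trig_ok t -> seminorm_le N M (trig_mul k u t).
Proof.
move=> ru; have Au : fam_span trig_ok At (trig_mul k u) by apply: fam_atom; exists k, u.
have [M M0 MP] := fam_span_seminorm (fun _ _ => ler01) trig_fam_diff Au N.
by exists M => // t ot js x sjs; have := MP t js x ot sjs; rewrite mul1r.
Qed.

End TrigFamily.

(** * Invariant bilinear forms and their derivatives along shears *)

Section SchwartzForms.
Variable R : realType.

(** [sf_mod] is what modulation invariance of a sesquilinear form leaves on real functions, which
    modulations do not preserve: the values at the frequencies [t] and [- t] agree, and their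
    difference is this identity. *)
Record schwartz_form n (b : ('rV[R]_n -> R) -> ('rV[R]_n -> R) -> R) := SchwartzForm {
  sf_linl : forall a u u' v, rschwartz u -> rschwartz u' -> rschwartz v ->
    b (fun x => a * u x + u' x) v = a * b u v + b u' v;
  sf_linr : forall a u v v', rschwartz u -> rschwartz v -> rschwartz v' ->
    b u (fun x => a * v x + v' x) = a * b u v + b u v';
  sf_bound : exists N (K : R), 0 <= K /\ forall u v M M', rschwartz u -> rschwartz v ->
    seminorm_le N M u -> seminorm_le N M' v -> `|b u v| <= K * (M * M');
  sf_shift : forall x u v, rschwartz u -> rschwartz v ->
    b (fun z => u (z + x)) (fun z => v (z + x)) = b u v;
  sf_mod : forall j (t : R) u v, rschwartz u -> rschwartz v ->
    b (fun x => cos (t * x ord0 j) * u x) (fun x => sin (t * x ord0 j) * v x) =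
    b (fun x => sin (t * x ord0 j) * u x) (fun x => cos (t * x ord0 j) * v x) }.

Lemma eq0_of_small (D K : R) : (forall t, 0 < t <= 1 -> `|D| <= t * K) -> D = 0.
Proof.
move=> h; apply/eqP; rewrite -normr_eq0 eq_le normr_ge0 andbT.
apply/ler_addgt0Pr => e e0; rewrite add0r.
have K0 : 0 < `|K| + 1 by rewrite ltr_pwDr.
pose t := Num.min 1 (e / (`|K| + 1)).
have t0 : 0 < t by rewrite lt_min ltr01 divr_gt0.
have tK : t * (`|K| + 1) <= e by rewrite -ler_pdivlMr// ge_min lexx orbT.
have t1 : t <= 1 by rewrite ge_min lexx.
apply: le_trans (h t _) _; first by rewrite t0.
apply: le_trans tK; apply: ler_wpM2l; first exact: ltW.
by apply: le_trans (ler_norm K) _; rewrite lerDl.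
Qed.

Lemma rschwartz_seminorm n (u : 'rV[R]_n -> R) N : rschwartz u ->
  exists2 M : R, 0 <= M & seminorm_le N M u.
Proof.
move=> [_ ru].
have [|js|M M0 MP] := @finite_bound R n N (fun js M => forall x,
   (1 + `|x|) ^+ N * `|dpart js u x| <= M).
- by move=> js M M' MM' h x; exact: le_trans MM'.
- exact: ru.
by exists M => // js x sjs; exact: MP.
Qed.

Section OneForm.
Variables (n : nat) (b : ('rV[R]_n -> R) -> ('rV[R]_n -> R) -> R).
Hypothesis Hb : schwartz_form b.

(** The derivative of [sf_mod] at [t = 0], with remainders: [cos (t x_j) u = u + t A] and
    [sin (t x_j) u = t x_j u + t^2 B], where each seminorm of [A] and [B] is bounded for
    [0 < |t| <= 1]. After division by [t] the two sides differ by [t] times a bounded quantity. *)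
Lemma sf_coord j u v : rschwartz u -> rschwartz v ->
  b (fun x => x ord0 j * u x) v = b u (fun x => x ord0 j * v x).
Proof.
move=> ru rv; apply/eqP; rewrite -subr_eq0; apply/eqP.
set xu := fun x : 'rV[R]_n => x ord0 j * u x; set xv := fun x : 'rV[R]_n => x ord0 j * v x.
have rxu : rschwartz xu by apply: rschwartz_mul => //; exact: moderate_coord.
have rxv : rschwartz xv by apply: rschwartz_mul => //; exact: moderate_coord.
have [N [K [K0 KP]]] := sf_bound Hb.
have [M1 _ P1] := rschwartz_seminorm N ru; have [M2 _ P2] := rschwartz_seminorm N rv.
have [M3 _ P3] := rschwartz_seminorm N rxu; have [M4 _ P4] := rschwartz_seminorm N rxv.
have [A1 _ Q1] := trig_seminorm j 2 N ru; have [A2 _ Q2] := trig_seminorm j 2 N rv.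
have [B1 _ S1] := trig_seminorm j 3 N ru; have [B2 _ S2] := trig_seminorm j 3 N rv.
apply: (@eq0_of_small _ (K * (M1 * B2) + K * (A1 * M4) + K * (A1 * B2)
  + K * (M3 * A2) + K * (B1 * M2) + K * (B1 * A2))) => t /andP[t0 t1].
have ot : trig_ok t by split; [rewrite gt_eqF|rewrite gtr0_norm].
have tn0 : t != 0 by rewrite gt_eqF.
pose Au := trig_mul j 2 u t; pose Av := trig_mul j 2 v t.
pose Bu := trig_mul j 3 u t; pose Bv := trig_mul j 3 v t.
have rAu : rschwartz Au by exact: trig_rschwartz.
have rAv : rschwartz Av by exact: trig_rschwartz.
have rBu : rschwartz Bu by exact: trig_rschwartz.
have rBv : rschwartz Bv by exact: trig_rschwartz.
have cE w : (fun x : 'rV[R]_n => cos (t * x ord0 j) * w x) = (fun x => t * trig_mul j 2 w t x + w x).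
  by apply/funext => x; rewrite /trig_mul /=; field.
have sE w : (fun x : 'rV[R]_n => sin (t * x ord0 j) * w x) =
    (fun x => (t ^+ 2) * trig_mul j 3 w t x + t * (x ord0 j * w x)).
  by apply/funext => x; rewrite /trig_mul /=; field.
have := sf_mod Hb j t ru rv; rewrite !cE !sE.
have scl a (w w' : 'rV[R]_n -> R) : rschwartz w -> rschwartz w' -> b (fun x => a * w x) w' = a * b w w'.
  move=> rw rw'; have := sf_linl Hb (a - 1) rw rw rw'.
  have -> : (fun x => (a - 1) * w x + w x) = (fun x => a * w x) by apply/funext => x; ring.
  by move=> ->; ring.
have scr a (w w' : 'rV[R]_n -> R) : rschwartz w -> rschwartz w' -> b w (fun x => a * w' x) = a * b w w'.
  move=> rw rw'; have := sf_linr Hb (a - 1) rw rw' rw'.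
  have -> : (fun x => (a - 1) * w' x + w' x) = (fun x => a * w' x) by apply/funext => x; ring.
  by move=> ->; ring.
rewrite -/Au -/Av -/Bu -/Bv -/xu -/xv.
have rtxu : rschwartz (fun x => t * xu x) by exact: rschwartz_scale.
have rtxv : rschwartz (fun x => t * xv x) by exact: rschwartz_scale.
have rsv : rschwartz (fun x => t ^+ 2 * Bv x + t * xv x) by exact: rschwartz_lin.
have rcv : rschwartz (fun x => t * Av x + v x) by exact: rschwartz_lin.
rewrite (sf_linl Hb _ rAu ru rsv) (sf_linl Hb _ rBu rtxu rcv).
rewrite (sf_linr Hb _ rAu rBv rtxv) (sf_linr Hb _ ru rBv rtxv) (sf_linr Hb _ rBu rAv rv).
rewrite (sf_linr Hb _ rtxu rAv rv) !(scr t) ?(scl t)// => E.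
have D : b xu v - b u xv = t * (b u Bv + b Au xv + t * b Au Bv - b xu Av - b Bu v - t * b Bu Av).
  by apply: (@mulfI _ t) => //; lra.
have {}Q1 := Q1 t ot; have {}Q2 := Q2 t ot; have {}S1 := S1 t ot; have {}S2 := S2 t ot.
have b1 := KP u Bv M1 B2 ru rBv P1 S2; have b2 := KP Au xv A1 M4 rAu rxv Q1 P4.
have b3 := KP Au Bv A1 B2 rAu rBv Q1 S2; have b4 := KP xu Av M3 A2 rxu rAv P3 Q2.
have b5 := KP Bu v B1 M2 rBu rv S1 P2; have b6 := KP Bu Av B1 A2 rBu rAv S1 Q2.
rewrite D normrM (gtr0_norm t0); apply: ler_wpM2l; first exact: ltW.
move: b1 b2 b3 b4 b5 b6; clear -t0 t1; move: (b u Bv) (b Au xv) (b Au Bv) (b xu Av) (b Bu v) (b Bu Av).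
move=> y1 y2 y3 y4 y5 y6 h1 h2 h3 h4 h5 h6.
have st y : `|t * y| <= `|y| by rewrite normrM ler_piMl// gtr0_norm.
have g1 := ler_normB (y1 + y2 + t * y3 - y4 - y5) (t * y6).
have g2 := ler_normB (y1 + y2 + t * y3 - y4) y5.
have g3 := ler_normB (y1 + y2 + t * y3) y4.
have g4 := ler_normD (y1 + y2) (t * y3); have g5 := ler_normD y1 y2.
have s3 := st y3; have s6 := st y6.
move: g1 g2 g3 g4 g5 s3 s6 h1 h2 h3 h4 h5 h6; clear; lra.
Qed.

End OneForm.

Section ShearForm.
Variables (n : nat) (b : ('rV[R]_n.+1 -> R) -> ('rV[R]_n.+1 -> R) -> R).
Hypothesis Hb : schwartz_form b.
Variables (C : (R -> 'rV[R]_n.+1 -> R) -> Prop) (HC : shear_class C).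
Implicit Types U V : R -> 'rV[R]_n.+1 -> R.

Definition sform U V (s t : R) := b (sheared U s t) (sheared V s t).

Lemma sheared_rschwartz U s t : C U -> `|s| <= 1 -> rschwartz (sheared U s t).
Proof.
move=> CU s1.
have n0 : `|0 : R| <= 1 by rewrite normr0.
have oi : pert_ok 0 (s, t, 1) by split=> //=; rewrite ?mulr0 ?addr0 ?oner_eq0 ?normr1.
by have [] := pert_rschwartz HC n0 n0 CU oi.
Qed.

Lemma sform_bound U V : C U -> C V -> exists2 K : R, 0 <= K &
  forall s t, `|s| <= 1 -> `|sform U V s t| <= K / (1 + `|t|) ^+ 2.
Proof.
move=> CU CV; have [N [K [K0 KP]]] := sf_bound Hb.
have n0 : `|0 : R| <= 1 by rewrite normr0.
have [M M0 MP] := pert_seminorm HC n0 n0 N CU.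
have [M' M'0 M'P] := pert_seminorm HC n0 n0 N CV.
exists (K * (M * M')); first by rewrite !mulr_ge0.
move=> s t s1.
have oi : pert_ok 0 (s, t, 1) by split=> //=; rewrite ?mulr0 ?addr0 ?oner_eq0 ?normr1.
have [P1 _ _ _] := MP _ oi; have [P2 _ _ _] := M'P _ oi.
have := KP _ _ _ _ (sheared_rschwartz t CU s1) (sheared_rschwartz t CV s1) P1 P2.
move=> /le_trans; apply; rewrite /pert_om /=.
have t1 : 1 <= (1 + `|t|) ^+ 2 by apply: exprn_ege1; rewrite lerDl.
set w := (1 + `|t|) ^+ 2 in t1 *; have w0 : 0 < w by exact: lt_le_trans t1.
have -> : K * (M / w * (M' / w)) = K * (M * M') / w * w^-1 by field; rewrite gt_eqF.
by rewrite ler_piMr ?invf_le1//; apply: divr_ge0; [rewrite !mulr_ge0|exact: ltW].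
Qed.

(** With [X] the exact derivative, [pert1 = pert0 + h quot1] and [quot1 = X + h quot2]. Expanding
    [b] leaves [h^2] times three values of [b] on uniformly bounded functions, whence the 3 in the
    constant. *)
Lemma sform_expand (eta zeta : R) U V : `|eta| <= 1 -> `|zeta| <= 1 -> C U -> C V ->
  exists2 K : R, 0 <= K & forall s t h, pert_ok zeta (s, t, h) ->
  `|sform U V (s + h * zeta) (t + h * eta) - sform U V s t
    - h * (b (fun y => speed eta zeta y * sheared (dsig U) s t y) (sheared V s t)
         + b (sheared U s t) (fun y => speed eta zeta y * sheared (dsig V) s t y))|
  <= K * h ^+ 2 / (1 + `|t|) ^+ 2.
Proof.
move=> e1 z1 CU CV; have [N [K [K0 KP]]] := sf_bound Hb.
have [M M0 MP] := pert_seminorm HC e1 z1 N CU.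
have [M' M'0 M'P] := pert_seminorm HC e1 z1 N CV.
exists (3 * (K * (M * M'))); first by rewrite !mulr_ge0.
move=> s t h oi; pose i := (s, t, h); have [_ _ h0 _] := oi; rewrite /= in h0.
have [rP0 rP1 rA1 rA2] := pert_rschwartz HC e1 z1 CU oi.
have [rQ0 rQ1 rB1 rB2] := pert_rschwartz HC e1 z1 CV oi.
have [sP0 sP1 sA1 sA2] := MP _ oi; have [sQ0 sQ1 sB1 sB2] := M'P _ oi.
pose X (W : R -> 'rV[R]_n.+1 -> R) y := speed eta zeta y * sheared (dsig W) s t y.
have XE (W : R -> 'rV[R]_n.+1 -> R) : X W = (fun y => - h * quot2 eta zeta W i y + quot1 eta zeta W i y).
  by apply/funext => y; rewrite /quot2 /pert0 /X /=; field.
have rX : rschwartz (X U) by rewrite XE; exact: rschwartz_lin.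
have rY : rschwartz (X V) by rewrite XE; exact: rschwartz_lin.
have q1E (W : R -> 'rV[R]_n.+1 -> R) : quot1 eta zeta W i = (fun y => h * quot2 eta zeta W i y + X W y).
  by apply/funext => y; rewrite /quot2 /pert0 /X /=; field.
have p1E (W : R -> 'rV[R]_n.+1 -> R) : pert1 eta zeta W i = (fun y => h * quot1 eta zeta W i y + pert0 W i y).
  by apply/funext => y; rewrite /quot1 /=; field.
have b1 := KP _ _ _ _ rA1 rB1 sA1 sB1; have b2 := KP _ _ _ _ rA2 rQ0 sA2 sQ0.
have b3 := KP _ _ _ _ rP0 rB2 sP0 sB2.
have E : b (pert1 eta zeta U i) (pert1 eta zeta V i) - b (pert0 U i) (pert0 V i)
   - h * (b (X U) (pert0 V i) + b (pert0 U i) (X V)) =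
   h ^+ 2 * (b (quot1 eta zeta U i) (quot1 eta zeta V i) + b (quot2 eta zeta U i) (pert0 V i)
     + b (pert0 U i) (quot2 eta zeta V i)).
  have F1 : b (pert1 eta zeta U i) (pert1 eta zeta V i) =
      h * b (quot1 eta zeta U i) (pert1 eta zeta V i) + b (pert0 U i) (pert1 eta zeta V i).
    by rewrite {1}(p1E U) (sf_linl Hb).
  have F2 : b (pert0 U i) (pert1 eta zeta V i) =
      h * b (pert0 U i) (quot1 eta zeta V i) + b (pert0 U i) (pert0 V i).
    by rewrite {1}(p1E V) (sf_linr Hb).
  have F3 : b (quot1 eta zeta U i) (pert1 eta zeta V i) =
      h * b (quot1 eta zeta U i) (quot1 eta zeta V i) + b (quot1 eta zeta U i) (pert0 V i).
    by rewrite {1}(p1E V) (sf_linr Hb).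
  have F4 : b (quot1 eta zeta U i) (pert0 V i) =
      h * b (quot2 eta zeta U i) (pert0 V i) + b (X U) (pert0 V i).
    by rewrite {1}(q1E U) (sf_linl Hb).
  have F5 : b (pert0 U i) (quot1 eta zeta V i) =
      h * b (pert0 U i) (quot2 eta zeta V i) + b (pert0 U i) (X V).
    by rewrite {1}(q1E V) (sf_linr Hb).
  by rewrite F1 F2 F3 F4 F5; ring.
rewrite -[X in X <= _]/(`|b (pert1 eta zeta U i) (pert1 eta zeta V i) - b (pert0 U i) (pert0 V i)
   - h * (b (X U) (pert0 V i) + b (pert0 U i) (X V))|) E.
have t1 : 1 <= (1 + `|t|) ^+ 2 by apply: exprn_ege1; rewrite lerDl.
move: b1 b2 b3; rewrite /pert_om /=; set w := (1 + `|t|) ^+ 2 in t1 *.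
have w0 : 0 < w by exact: lt_le_trans t1.
have wE : K * (M / w * (M' / w)) <= K * (M * M') / w.
  have -> : K * (M / w * (M' / w)) = K * (M * M') / w * w^-1 by field; rewrite gt_eqF.
  by rewrite ler_piMr ?invf_le1//; apply: divr_ge0; [rewrite !mulr_ge0|exact: ltW].
move: wE; clear; set k := K * _; set k' := K * (M * M') / w.
move: (b _ _) (b _ _) (b _ _) => y3 y2 y1 kk h1 h2 h3.
rewrite normrM (ger0_norm (sqr_ge0 h)).
have -> : 3 * (K * (M * M')) * h ^+ 2 / w = h ^+ 2 * (3 * k') by rewrite /k'; ring.
apply: ler_wpM2l; first exact: sqr_ge0.
have g1 := ler_normD (y1 + y2) y3; have g2 := ler_normD y1 y2.
move: kk h1 h2 h3 g1 g2; clear; move: k k' => k k'; lra.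
Qed.

Lemma is_derive_quadratic (f : R -> R) (x l K : R) :
  (forall h, h != 0 -> `|h| <= 1 -> `|f (x + h) - f x - h * l| <= K * h ^+ 2) ->
  is_derive x (1 : R) f l.
Proof.
move=> fK; suff E : h^-1 *: ((f \o shift x) (h *: 1) - f x) @[h --> 0^'] --> l.
  by split; [apply/cvg_ex; exists l|exact: cvg_lim].
apply/cvgrPdist_le => e e0.
have K0 : 0 < `|K| + 1 by rewrite ltr_pwDr.
near=> h; have h0 : h != 0 by near: h; exact: nbhs_dnbhs_neq.
rewrite /= [h *: 1]mulr1 (addrC h).
have h1 : `|h| <= 1 by near: h; apply: dnbhs0_le.
have he : `|h| <= e / (`|K| + 1) by near: h; apply: dnbhs0_le; rewrite divr_gt0.
have -> : l - h^-1 *: (f (x + h) - f x) = - (h^-1 * (f (x + h) - f x - h * l)).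
  by rewrite /GRing.scale /=; field.
rewrite normrN normrM normfV mulrC ler_pdivrMr ?normr_gt0//.
apply: le_trans (fK h h0 h1) _.
rewrite -[h ^+ 2]real_normK ?num_real// expr2 mulrA; apply: ler_wpM2r => //.
apply: le_trans (_ : (`|K| + 1) * `|h| <= _); last by rewrite mulrC -ler_pdivlMr.
by apply: ler_wpM2r => //; apply: le_trans (ler_norm K) _; rewrite lerDl.
Unshelve. all: by end_near. Qed.

Lemma sform_derive U V s t : C U -> C V -> `|s| <= 1 ->
  is_derive t (1 : R) (sform U V s) (sform (dsig U) V s t + sform U (dsig V) s t).
Proof.
move=> CU CV s1.
have n0 : `|0 : R| <= 1 by rewrite normr0.
have n1 : `|1 : R| <= 1 by rewrite normr1.
have [K K0 KP] := sform_expand n1 n0 CU CV.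
apply: (@is_derive_quadratic _ _ _ K) => h h0 h1.
have oi : pert_ok 0 (s, t, h) by split=> //=; rewrite mulr0 addr0.
have := KP s t h oi; rewrite mulr0 addr0 mulr1.
have sE (W : R -> 'rV[R]_n.+1 -> R) : (fun y => speed 1 0 y * sheared (dsig W) s t y) = sheared (dsig W) s t.
  by apply/funext => y; rewrite /speed mul0r addr0 mul1r.
rewrite !sE => /le_trans; apply.
have t1 : 1 <= (1 + `|t|) ^+ 2 by apply: exprn_ege1; rewrite lerDl.
apply: ler_piMr; first by apply: mulr_ge0 => //; exact: sqr_ge0.
by rewrite invf_le1//; exact: lt_le_trans t1.
Qed.

Lemma dsig_mul0 V : C V -> dsig (mul0 V) = mul0 (dsig V).
Proof.
move=> CV; apply/funext => s; apply/funext => y.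
by have [_] := is_deriveZ (y ord0 ord0) (sc_derive HC s y CV).
Qed.

Lemma sform_slope U V : C U -> C V -> exists2 K : R, 0 <= K & forall s t h,
  `|s| <= 1 -> `|s + h| <= 1 -> h != 0 -> `|h| <= 1 ->
  `|sform U V (s + h) t - sform U V s t
    - h * (sform (dsig U) (mul0 V) s t + sform U (dsig (mul0 V)) s t)|
  <= K * h ^+ 2 / (1 + `|t|) ^+ 2.
Proof.
move=> CU CV.
have n0 : `|0 : R| <= 1 by rewrite normr0.
have n1 : `|1 : R| <= 1 by rewrite normr1.
have [K K0 KP] := sform_expand n0 n1 CU CV.
exists K => // s t h s1 sh h0 h1.
have oi : pert_ok 1 (s, t, h) by split=> //=; rewrite mulr1.
have := KP s t h oi; rewrite mulr0 addr0 mulr1.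
have sE (W : R -> 'rV[R]_n.+1 -> R) : (fun y => speed 0 1 y * sheared (dsig W) s t y) =
    (fun y => y ord0 ord0 * sheared (dsig W) s t y).
  by apply/funext => y; rewrite /speed mul1r add0r.
(* Modulation invariance enters here: the factor [y_0] produced by the slope passes from [U] to [V],
   where it becomes part of [mul0 V]. *)
rewrite !sE (sf_coord Hb); first last.
- exact: sheared_rschwartz.
- by apply: sheared_rschwartz => //; exact: (sc_dsig HC).
by rewrite dsig_mul0.
Qed.

End ShearForm.
End SchwartzForms.

(** * Integrals over the line of functions with quadratic decay *)

Section DecayIntegrals.
Variable R : realType.
Let mu := @lebesgue_measure R.
Implicit Types (f g : R -> R).

Definition decays f (K : R) := forall t, `|f t| <= K / (1 + `|t|) ^+ 2.

Lemma integrable_oneDsqrV : mu.-integrable setT (fun t => ((oneDsqr t)^-1)%:E).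
Proof.
have c := @continuous_oneDsqrV R.
have m : measurable_fun [set: R] (fun t : R => (oneDsqr t)^-1) by exact: continuous_measurable_fun.
apply/integrableP; split; first exact/measurable_EFinP.
under eq_integral => t _ do rewrite /= ger0_norm ?invr_ge0//.
rewrite ge0_symfun_integralT; last 3 first.
- by move=> t; rewrite invr_ge0.
- exact: c.
- by move=> t /=; rewrite /oneDsqr sqrrN.
rewrite (_ : [set x | _] = `[0, +oo[%classic); last first.
  by apply/seteqP; split => x/=; rewrite in_itv/= andbT.
by rewrite integral0y_oneDsqr -EFinM ltry.
Qed.

Lemma decay_weight (t : R) : ((1 + `|t|) ^+ 2)^-1 <= (oneDsqr t)^-1.
Proof.
have h : oneDsqr t <= (1 + `|t|) ^+ 2.
  rewrite /oneDsqr sqrrD expr1n mul1r real_normK ?num_real//.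
  by have := normr_ge0 t; rewrite mulr2n; lra.
rewrite lef_pV2// posrE; first exact: lt_le_trans h.
exact: lt_le_trans (oneDsqr_ge1 t).
Qed.

Lemma integrable_decay f K : continuous f -> decays f K -> mu.-integrable setT (EFin \o f).
Proof.
move=> cf fK; have mf : measurable_fun [set: R] f by exact: continuous_measurable_fun.
apply: (@le_integrable _ _ _ mu _ measurableT _ (fun t => (`|K|)%:E * ((oneDsqr t)^-1)%:E)%E).
- exact/measurable_EFinP.
- move=> t _ /=; rewrite lee_fin; apply: le_trans (fK t) _.
  rewrite (@ger0_norm _ (`|K| * (oneDsqr t)^-1)); last by rewrite mulr_ge0// invr_ge0.
  apply: le_trans (_ : `|K| * ((1 + `|t|) ^+ 2)^-1 <= _).
    by apply: ler_wpM2r; [rewrite invr_ge0 exprn_ge0// addr_ge0|exact: ler_norm].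
  by apply: ler_wpM2l => //; exact: decay_weight.
- by apply: integrableZl => //; exact: integrable_oneDsqrV.
Qed.

Lemma Rintegral_decay_le : exists2 A : R, 0 <= A & forall f K, continuous f -> 0 <= K ->
  decays f K -> `|\int[mu]_t f t| <= A * K.
Proof.
exists (\int[mu]_t (oneDsqr t)^-1)%R.
  by apply: Rintegral_ge0 => t _; rewrite invr_ge0.
move=> f K cf K0 fK; have fi := integrable_decay cf fK.
have wi := integrable_oneDsqrV.
apply: le_trans (le_normr_Rintegral _ _) _ => //.
rewrite mulrC -(RintegralZl K measurableT wi).
apply: le_Rintegral => //.
- exact: (integrable_abse fi).
- exact: (integrableZl measurableT K wi).
- move=> t _; apply: le_trans (fK t) _.
  by apply: ler_wpM2l => //; exact: decay_weight.
Qed.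

(** The fundamental theorem on [[-(m+1), m+1]] and dominated convergence; the boundary values vanish
    in the limit by the decay of [g]. *)
Lemma Rintegral_derivative0 (g g' : R -> R) (K : R) :
  (forall t, is_derive t (1 : R) g (g' t)) -> continuous g' -> decays g K -> decays g' K ->
  (\int[mu]_t g' t)%R = 0.
Proof.
move=> dg cg' gK g'K.
have mg' : measurable_fun [set: R] g' by exact: continuous_measurable_fun.
have cg : continuous g.
  move=> t; apply: differentiable_continuous; apply/derivable1_diffP.
  by have [] := dg t.
pose J (m : nat) : set R := [set` `[- m.+1%:R : R, m.+1%:R]].
pose f_ (m : nat) := (EFin \o g') \_ (J m).
have [||||| _ _ cvgI] := @dominated_convergence _ _ _ mu setT measurableT f_ (EFin \o g')
  (fun t => (`|K|)%:E * ((oneDsqr t)^-1)%:E)%E.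
- move=> m.
  have mJ : measurable_fun (J m) (EFin \o g').
    by apply: measurable_funTS; exact/measurable_EFinP.
  have mJm : measurable (J m) by exact: measurable_itv.
  exact: (measurable_restrictT (EFin \o g') mJm).1 mJ.
- exact/measurable_EFinP.
- apply: aeW => t _; apply: cvg_near_cst.
  near=> m; rewrite /f_ patchE mem_set// /J/= in_itv/= -ler_norml.
  near: m; exists (Num.truncn `|t|) => // m /= tm.
  by apply: le_trans (ltW (truncnS_gt _)) _; rewrite ler_nat ltnS.
- by apply: integrableZl => //; exact: integrable_oneDsqrV.
- apply: aeW => t m _; rewrite /f_ patchE.
  have w0 : 0 <= `|K| * (oneDsqr t)^-1 by rewrite mulr_ge0// invr_ge0.
  case: ifP => _; last by rewrite abse0 -EFinM lee_fin.
  rewrite /= -EFinM lee_fin; apply: le_trans (g'K t) _.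
  apply: le_trans (_ : `|K| * ((1 + `|t|) ^+ 2)^-1 <= _).
    by apply: ler_wpM2r; [rewrite invr_ge0 exprn_ge0// addr_ge0|exact: ler_norm].
  by apply: ler_wpM2l => //; exact: decay_weight.
rewrite /Rintegral; suff -> : (\int[mu]_t (g' t)%:E)%E = 0%E by [].
apply: (cvg_unique _ cvgI) => //.
have E m : (\int[mu]_t f_ m t)%E = (g m.+1%:R - g (- m.+1%:R))%:E.
  rewrite /f_ -integral_mkcond.
  rewrite (@continuous_FTC2 _ g' g).
  - by [].
  - by rewrite -subr_gt0 opprK addr_gt0.
  - exact: continuous_subspaceT.
  - split=> [t _||]; first by have [] := dg t.
    + by apply: cvg_at_right_filter; exact: cg.
    + by apply: cvg_at_left_filter; exact: cg.
  - by move=> t _; rewrite derive1E; have [_] := dg t.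
have -> : (fun m => \int[mu]_t f_ m t)%E = (fun m => (g m.+1%:R - g (- m.+1%:R))%:E).
  by apply/funext => m; exact: E.
apply: cvg_EFin; first by near=> m.
apply/cvgrPdist_le => e e0; near=> m; rewrite sub0r normrN.
apply: le_trans (ler_normB _ _) _.
have h (x : R) : `|x| = m.+1%:R -> `|g x| <= e / 2.
  move=> xm; apply: le_trans (gK x) _; rewrite xm.
  have m1 : 1 <= 1 + m.+1%:R :> R by rewrite lerDl.
  rewrite ler_pdivrMr; last by apply: exprn_gt0; exact: lt_le_trans m1.
  have Km : K <= e / 2 * (1 + m.+1%:R).
    near: m; exists (Num.truncn (K / (e / 2))) => // m /= Km.
    rewrite mulrC -ler_pdivrMr ?divr_gt0//.
    apply: le_trans (ltW (truncnS_gt _)) _.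
    by rewrite -natr1 addrC lerD2l ler_nat (leq_trans Km).
  apply: le_trans Km _; apply: ler_wpM2l; first by rewrite divr_ge0// ltW.
  by apply: ler_eXnr.
have := h m.+1%:R (ger0_norm (ler0n _ _)).
have := h (- m.+1%:R); rewrite normrN (ger0_norm (ler0n _ _)) => /(_ erefl).
lra.
Unshelve. all: by end_near. Qed.

(** Cut into [m + 1] equal steps, the increment from 0 to [s] is at most
    [(m + 1) K (s / (m + 1))^2], which tends to 0. *)
Lemma quadratic_constant (f : R -> R) (K : R) :
  (forall s h, `|s| <= 1 -> `|s + h| <= 1 -> h != 0 -> `|h| <= 1 ->
    `|f (s + h) - f s| <= K * h ^+ 2) ->
  forall s, `|s| <= 1 -> f s = f 0.
Proof.
move=> fK s s1; apply/eqP; rewrite -subr_eq0; apply/eqP.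
have [->|s0] := eqVneq s 0; first by rewrite subrr.
have K0 : 0 <= K.
  have n1 : `|s + - s| <= 1 by rewrite subrr normr0.
  have := fK s (- s) s1 n1; rewrite oppr_eq0 normrN => /(_ s0 s1) h.
  rewrite -(@pmulr_lge0 _ ((- s) ^+ 2)); last by rewrite sqrrN exprn_even_gt0.
  by apply: le_trans h.
apply: (@eq0_of_small _ _ (K * 2)) => t /andP[t0 t1].
pose m := Num.truncn t^-1; pose h := s / m.+1%:R.
have m0 : 0 < m.+1%:R :> R by rewrite ltr0n.
have tm : m.+1%:R^-1 <= t.
  by rewrite -[leRHS]invrK lef_pV2 ?posrE ?invr_gt0// ltW// truncnS_gt.
have h0 : h != 0 by rewrite mulf_neq0// invr_eq0 gt_eqF.
have pt (k : nat) : (k <= m.+1)%N -> `|k%:R * h| <= 1.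
  move=> km; rewrite /h mulrCA normrM; apply: mulr_ile1 => //.
  by rewrite normrM normfV !(ger0_norm (ler0n _ _)) ler_pdivrMr// mul1r ler_nat.
have h1 : `|h| <= 1 by have := pt 1%N isT; rewrite mul1r.
have tel (k : nat) : (k <= m.+1)%N -> `|f (k%:R * h) - f 0| <= k%:R * (K * h ^+ 2).
  elim: k => [|k ih] km; first by rewrite !mul0r subrr normr0.
  have -> : k.+1%:R * h = k%:R * h + h by rewrite -natr1 mulrDl mul1r.
  have kh : `|k%:R * h + h| <= 1 by have := pt _ km; rewrite -natr1 mulrDl mul1r.
  have := fK _ _ (pt k (ltnW km)) kh h0 h1; have := ih (ltnW km).
  rewrite -natr1 mulrDl mul1r.
  set a := f (k%:R * h); set a' := f (k%:R * h + h) => i1 i2.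
  have -> : a' - f 0 = (a' - a) + (a - f 0) by ring.
  by apply: le_trans (ler_normD _ _) _; rewrite addrC lerD.
have := tel m.+1 (leqnn _); rewrite /h mulrCA divff ?gt_eqF// mulr1 => /le_trans; apply.
have -> : m.+1%:R * (K * (s / m.+1%:R) ^+ 2) = (K * s ^+ 2) * m.+1%:R^-1.
  by field; rewrite nat1r gt_eqF.
rewrite [t * _]mulrC; apply: ler_pM => //.
- by rewrite mulr_ge0// sqr_ge0.
- apply: ler_wpM2l => //; rewrite -[s ^+ 2]real_normK ?num_real//.
  by apply: le_trans (_ : 1 <= _); [exact: exprn_ile1|rewrite ler1n].
Qed.

End DecayIntegrals.

Section ShearIntegral.
Variables (R : realType) (n : nat) (b : ('rV[R]_n.+1 -> R) -> ('rV[R]_n.+1 -> R) -> R).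
Hypothesis Hb : schwartz_form b.
Variables (C : (R -> 'rV[R]_n.+1 -> R) -> Prop) (HC : shear_class C).
Let mu := @lebesgue_measure R.

Lemma sform_continuous U V s : C U -> C V -> `|s| <= 1 -> continuous (sform b U V s).
Proof.
move=> CU CV s1 t; apply: differentiable_continuous; apply/derivable1_diffP.
by have [] := sform_derive Hb HC t CU CV s1.
Qed.

(* d/ds of the integrand is the t-derivative of sform U (mul0 V), because
   moving the factor y_0 across b costs nothing. *)
Lemma shear_invariance U V s : C U -> C V -> `|s| <= 1 ->
  (\int[mu]_t sform b U V s t = \int[mu]_t sform b U V 0 t)%R.
Proof.
move=> CU CV s1.
have [A A0 AP] := @Rintegral_decay_le R.
have [K K0 KP] := sform_slope Hb HC CU CV.
have CU' := sc_dsig HC CU; have CV0 := sc_mul0 HC CV; have CV0' := sc_dsig HC CV0.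
have [B _ BP] := sform_bound Hb HC CU CV.
have [B1 B10 B1P] := sform_bound Hb HC CU' CV0.
have [B2 B20 B2P] := sform_bound Hb HC CU CV0'.
have [B3 B30 B3P] := sform_bound Hb HC CU CV0.
apply: (@quadratic_constant _ (fun s => \int[mu]_t sform b U V s t)%R (A * K)) => // {s1}s h s1 sh h0 h1.
pose g' t := sform b (dsig U) (mul0 V) s t + sform b U (dsig (mul0 V)) s t.
have cg' : continuous g'.
  by move=> t; apply: continuousD; exact: sform_continuous.
have wt (t : R) : 0 <= ((1 + `|t|) ^+ 2)^-1 by rewrite invr_ge0 exprn_ge0// addr_ge0.
have g'K : decays g' (B1 + B2 + B3).
  move=> t; apply: le_trans (ler_normD _ _) _.
  apply: le_trans (lerD (B1P s t s1) (B2P s t s1)) _.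
  by rewrite -mulrDl; apply: ler_wpM2r => //; rewrite lerDl.
have gK : decays (sform b U (mul0 V) s) (B1 + B2 + B3).
  move=> t; apply: le_trans (B3P s t s1) _; apply: ler_wpM2r => //.
  by rewrite lerDr addr_ge0.
have int0 : (\int[mu]_t g' t)%R = 0.
  by apply: (Rintegral_derivative0 _ cg' gK g'K) => t; exact: (sform_derive Hb HC).
have ci s' : `|s'| <= 1 -> continuous (sform b U V s') by exact: sform_continuous.
have ii s' : `|s'| <= 1 -> mu.-integrable setT (EFin \o sform b U V s').
  by move=> s1'; apply: (integrable_decay (ci _ s1') (K := B)) => t; exact: BP.
have ig' := integrable_decay cg' g'K.
pose F t := sform b U V (s + h) t - sform b U V s t - h * g' t.
have cF : continuous F.
  move=> t; exact: (continuousB (continuousB (ci _ sh t) (ci _ s1 t))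
    (continuousM (@cst_continuous _ _ h t) (cg' t))).
have FK : decays F (K * h ^+ 2) by move=> t; exact: KP.
have := AP F _ cF _ FK; rewrite mulr_ge0 ?sqr_ge0// => /(_ isT).
rewrite mulrA; congr (`|_| <= _).
have e1 := RintegralB measurableT (ii _ sh) (ii _ s1).
have i1 : mu.-integrable setT (EFin \o (fun t => sform b U V (s + h) t - sform b U V s t)).
  exact: (integrableB measurableT (ii _ sh) (ii _ s1)).
have i2 : mu.-integrable setT (EFin \o (fun t => h * g' t)).
  exact: (integrableZl measurableT h ig').
have e2 := RintegralB measurableT i1 i2.
rewrite [LHS]e2 e1 (RintegralZl _ measurableT ig') int0 mulr0 subr0.
by [].
Qed.

End ShearIntegral.

Section ShearClasses.
Variables (R : realType) (n : nat).
Notation T := 'rV[R]_n.+1.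
Implicit Types (u : T -> R) (p : {poly R}).

Definition outer p u : R -> T -> R := fun s y => gp p s * u y.
Definition inner p u : R -> T -> R := fun s y => gp p (y ord0 ord0) * u (consv s (tailv y)).

Definition outer_class W := exists p u, rschwartz u /\ W = outer p u.
Definition inner_class W := exists p u, rschwartz u /\ W = inner p u.

Lemma outer_derive p u s y : is_derive s (1 : R) (fun s => outer p u s y) (outer (dgp p) u s y).
Proof.
have -> : (fun s => outer p u s y) = (fun s => u y * gp p s).
  by apply/funext => t; rewrite /outer mulrC.
by apply: (is_derive_eq (is_deriveZ (u y) (gp_derive p s))); rewrite /outer mulrC.
Qed.

Lemma dsig_outer p u : dsig (outer p u) = outer (dgp p) u.
Proof. by apply/funext => s; apply/funext => y; have [_] := outer_derive p u s y. Qed.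

Lemma outer_pd p u j s y : smoothR u ->
  is_derive y (unitv R j) (outer p u s) (outer p (pd j u) s y).
Proof. by move=> su; exact: (is_deriveZ (gp p s) (smoothR_derive y j su)). Qed.

Lemma dvar_outer j p u : smoothR u -> dvar j (outer p u) = outer p (pd j u).
Proof.
by move=> su; apply/funext => s; apply/funext => y; have [_] := outer_pd p j s y su.
Qed.

Lemma continuous_affine0 (s t : R) : continuous (fun y : T => t + s * y ord0 ord0).
Proof.
move=> y; apply: (continuousD (@cst_continuous _ _ t y)).
by apply: (continuousM (@cst_continuous _ _ s y)); exact: coord_continuous.
Qed.

Lemma outer_shear_class : shear_class outer_class.
Proof.
split.
- by move=> _ [p [u [ru ->]]]; rewrite dsig_outer; exists (dgp p), u.
- move=> j _ [p [u [ru ->]]]; rewrite dvar_outer; last exact: (proj1 ru).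
  by exists p, (pd j u); split=> //; exact: rschwartz_pd.
- move=> _ [p [u [ru ->]]]; exists p, (fun y : T => y ord0 ord0 * u y); split.
    by apply: rschwartz_mul => //; exact: moderate_coord.
  by apply/funext => s; apply/funext => y; rewrite /mul0 /outer mulrCA.
- move=> j _ [p [u [ru ->]]]; have su := proj1 ru.
  by rewrite (dvar_outer j p su) !dsig_outer (dvar_outer j (dgp p) su).
- by move=> _ s y [p [u [ru ->]]]; rewrite dsig_outer; exact: outer_derive.
- move=> _ s y c [p [u [ru ->]]]; have su := proj1 ru.
  rewrite dsig_outer (dvar_outer ord0 p su).
  have /is_derive_line du := smoothR_derive y ord0 su.
  apply: (is_derive_eq (is_deriveM (is_derive_affine c (gp_derive p s)) du)).
  by rewrite /= scale0r mul0r !add0r /outer -![_ *: _]/(_ * _); ring.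
- move=> _ s y j [p [u [ru ->]]]; have su := proj1 ru.
  by rewrite (dvar_outer (lift ord0 j) p su); exact: outer_pd.
- move=> _ k [p [u [ru ->]]].
  have [M M0 MP] := gp_rapid p k; have [M' M'0 M'P] := rschwartz_rapid k ru.
  exists (M * M'); first exact: mulr_ge0.
  move=> s y; rewrite /outer normrM exprMn mulrACA.
  apply: ler_pM; [| |exact: MP|exact: M'P].
  + by rewrite mulr_ge0// exprn_ge0.
  + by rewrite mulr_ge0// exprn_ge0.
- move=> _ s t [p [u [ru ->]]] y; have cu := smoothR_continuous (proj1 ru).
  apply: (continuousM _ (cu y)).
  apply: (@continuous_comp _ _ _ (fun y : T => t + s * y ord0 ord0) (gp p)).
    exact: continuous_affine0.
  exact: gp_continuous.
Qed.

Lemma inner_derive p u s y : smoothR u ->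
  is_derive s (1 : R) (fun s => inner p u s y) (inner p (pd ord0 u) s y).
Proof.
move=> su; have /is_derive_line du := smoothR_derive (consv s (tailv y)) ord0 su.
apply: (is_deriveZ (gp p (y ord0 ord0))).
have -> : (fun s => u (consv s (tailv y))) =
    (fun k : R => u (k *: unitv R ord0 + consv s (tailv y))) \o (fun k => k - s).
  by apply/funext => k /=; rewrite consv_line0 subrK.
rewrite -[X in is_derive _ _ _ X]mulr1.
apply: is_derive1_comp; first by rewrite subrr.
by apply: (is_derive_eq (is_deriveB (@is_derive_id R R s 1) (@is_derive_cst R R R s s 1))); rewrite subr0.
Qed.

Lemma dsig_inner p u : smoothR u -> dsig (inner p u) = inner p (pd ord0 u).
Proof.
by move=> su; apply/funext => s; apply/funext => y; have [_] := inner_derive p s y su.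
Qed.

Lemma inner_pd0 p u s y : is_derive y (unitv R ord0) (inner p u s) (inner (dgp p) u s y).
Proof. exact: (tens_derive0 p (restr u s) y). Qed.

Lemma dvar_inner0 p u : dvar ord0 (inner p u) = inner (dgp p) u.
Proof. by apply/funext => s; apply/funext => y; have [_] := inner_pd0 p u s y. Qed.

Lemma inner_pdS p u s y j : smoothR u ->
  is_derive y (unitv R (lift ord0 j)) (inner p u s) (inner p (pd (lift ord0 j) u) s y).
Proof.
move=> su; apply/is_derive_line.
have -> : (fun h : R => inner p u s (h *: unitv R (lift ord0 j) + y)) =
    (fun h : R => gp p (y ord0 ord0) * u (h *: unitv R (lift ord0 j) + consv s (tailv y))).
  by apply/funext => h; rewrite /inner lineS_head lineS_tail consv_lineS.
have /is_derive_line du := smoothR_derive (consv s (tailv y)) (lift ord0 j) su.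
exact: is_deriveZ.
Qed.

Lemma dvar_innerS p u j : smoothR u ->
  dvar (lift ord0 j) (inner p u) = inner p (pd (lift ord0 j) u).
Proof.
by move=> su; apply/funext => s; apply/funext => y; have [_] := inner_pdS p s y j su.
Qed.

Lemma inner_shear_class : shear_class inner_class.
Proof.
split.
- move=> _ [p [u [ru ->]]]; rewrite dsig_inner; last exact: (proj1 ru).
  by exists p, (pd ord0 u); split=> //; exact: rschwartz_pd.
- move=> j _ [p [u [ru ->]]]; case: (unliftP ord0 j) => [k|] ->.
    rewrite dvar_innerS; last exact: (proj1 ru).
    by exists p, (pd (lift ord0 k) u); split=> //; exact: rschwartz_pd.
  by rewrite dvar_inner0; exists (dgp p), u.
- move=> _ [p [u [ru ->]]]; exists ('X * p), u; split=> //.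
  apply/funext => s; apply/funext => y.
  by rewrite /mul0 /inner /gp hornerM hornerX !mulrA.
- move=> j _ [p [u [ru ->]]]; have su := proj1 ru.
  case: (unliftP ord0 j) => [k|] ->.
    (* For [inner] the derivative [dsig] is a partial derivative of [u] itself, and [sc_comm]
       becomes the symmetry of mixed partials. *)
    have su' := smoothR_pd (lift ord0 k) su; have su0 := smoothR_pd ord0 su.
    by rewrite (dvar_innerS p k su) (dsig_inner p su') (dsig_inner p su) (dvar_innerS p k su0) (pdC ord0 (lift ord0 k) su).
  by rewrite dvar_inner0 (dsig_inner (dgp p) su) (dsig_inner p su) dvar_inner0.
- by move=> _ s y [p [u [ru ->]]]; rewrite dsig_inner; [apply: inner_derive|]; exact: (proj1 ru).
- move=> _ s y c [p [u [ru ->]]]; have su := proj1 ru.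
  rewrite (dsig_inner p su) dvar_inner0.
  have /is_derive_line du := smoothR_derive (consv s (tailv y)) ord0 su.
  have -> : (fun h : R => inner p u (h * c + s) (h *: unitv R ord0 + y)) =
      (fun h : R => gp p (h * 1 + y ord0 ord0)) *
      (fun h : R => u ((h * c + 0) *: unitv R ord0 + consv s (tailv y))).
    apply/funext => h; rewrite /inner line0_head line0_tail.
    rewrite -[RHS]/(gp p (h * 1 + y ord0 ord0) *
      u ((h * c + 0) *: unitv R ord0 + consv s (tailv y))).
    by rewrite consv_line0 addr0 mulr1.
  apply: (is_derive_eq (is_deriveM (is_derive_affine 1 (gp_derive p (y ord0 ord0)))
    (is_derive_affine c du))).
  by rewrite /= !mul0r !add0r scale0r add0r /inner -![_ *: _]/(_ * _); ring.
- by move=> _ s y j [p [u [ru ->]]]; rewrite dvar_innerS; [apply: inner_pdS|]; exact: (proj1 ru).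
- move=> _ k [p [u [ru ->]]].
  have [M M0 MP] := gp_rapid p k; have [M' M'0 M'P] := rschwartz_rapid (k + k) ru.
  exists (M * M'); first exact: mulr_ge0.
  move=> s y; set z := consv s (tailv y).
  have z0 := normr_ge0 z; have y0 := normr_ge0 (y ord0 ord0).
  have h1 : 1 + `|s| <= 1 + `|z|.
    by rewrite lerD2l -{1}(consv0 s (tailv y)); exact: rnorm_coord.
  have h2 : 1 + `|tailv y| <= 1 + `|z|.
    by rewrite lerD2l -{1}(tail_consv s (tailv y)); exact: rnorm_tailv.
  (* The weight of the point [z] occurs squared, whence the exponent [k + k] asked of [u]. *)
  have h3 : (1 + `|s|) * (1 + `|y|) <= (1 + `|y ord0 ord0|) * ((1 + `|z|) * (1 + `|z|)).
    rewrite mulrCA; apply: ler_pM => //.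
    by apply: le_trans (rnorm_cons_le y) _; apply: ler_wpM2l => //; exact: addr_ge0.
  apply: le_trans (_ : ((1 + `|y ord0 ord0|) * ((1 + `|z|) * (1 + `|z|))) ^+ k * `|inner p u s y| <= _).
    apply: ler_wpM2r => //; apply: lerXn2r h3; rewrite nnegrE.
      by rewrite mulr_ge0// addr_ge0.
    by rewrite !mulr_ge0// addr_ge0.
  rewrite /inner -/z normrM exprMn mulrACA; apply: ler_pM; [| |exact: MP|].
  + by rewrite mulr_ge0// exprn_ge0.
  + by rewrite mulr_ge0// exprn_ge0// mulr_ge0.
  + by rewrite exprMn -exprD; exact: M'P.
- move=> _ s t [p [u [ru ->]]] y; have cu := smoothR_continuous (proj1 ru).
  apply: (@continuousM _ _ (fun y : T => gp p (y ord0 ord0))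
    (fun y => u (consv (t + s * y ord0 ord0) (tailv y)))).
    apply: (@continuous_comp _ _ _ (fun y : T => y ord0 ord0) (gp p)).
      exact: coord_continuous.
    exact: gp_continuous.
  apply: (@continuous_comp _ _ _ (fun y : T => consv (t + s * y ord0 ord0) (tailv y)) u); last exact: cu.
  apply: (@lipschitz_continuous _ _ _ _ (1 + `|s|)) => x z.
  apply: rnorm_le => [|j]; first by rewrite mulr_ge0// addr_ge0.
  rewrite mxE [in X in _ + X]mxE.
  have h0 := normr_ge0 (x - z).
  case: (unliftP ord0 j) => [k|] ->.
    rewrite !consvS; have := rnorm_coord (x - z) (lift ord0 k); rewrite !mxE => /le_trans; apply.
    by rewrite ler_peMl// lerDl.
  rewrite !consv0.
  have -> : t + s * x ord0 ord0 - (t + s * z ord0 ord0) = s * (x - z) ord0 ord0.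
    by rewrite !mxE; ring.
  rewrite normrM; apply: ler_pM => //; first by rewrite lerDr.
  exact: rnorm_coord.
Qed.

End ShearClasses.

(** * Classification of the invariant forms by induction on the dimension *)

Section FormsAreL2.
Variable R : realType.
Let mu := @lebesgue_measure R.

Lemma gp1E (t : R) : gp 1 t ^+ 2 = gauss_fun t.
Proof.
rewrite /gp hornerC mul1r /gauss_fun expr2 -expRD; congr expR; lra.
Qed.

Lemma form_localization n (b : ('rV[R]_n.+1 -> R) -> ('rV[R]_n.+1 -> R) -> R) u v :
  schwartz_form b -> rschwartz u -> rschwartz v ->
  [/\ (\int[mu]_t b (tens 1 (restr u t)) (tens 1 (restr v t)) = Num.sqrt pi * b u v)%R &
    mu.-integrable setT (fun t => (b (tens 1 (restr u t)) (tens 1 (restr v t)))%:E)].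
Proof.
move=> Hb ru rv.
have OU : outer_class (outer 1 u) by exists 1, u.
have OV : outer_class (outer 1 v) by exists 1, v.
have IU : inner_class (inner 1 u) by exists 1, u.
have IV : inner_class (inner 1 v) by exists 1, v.
have m1 : `|- 1 : R| <= 1 by rewrite normrN normr1.
have p1 : `|1 : R| <= 1 by rewrite normr1.
have z1 : `|0 : R| <= 1 by rewrite normr0.
have J := shear_invariance Hb (@outer_shear_class R n) OU OV m1.
have I := shear_invariance Hb (@inner_shear_class R n) IU IV p1.
have scl a (w w' : 'rV[R]_n.+1 -> R) : rschwartz w -> rschwartz w' -> b (fun x => a * w x) w' = a * b w w'.
  move=> rw rw'; have := sf_linl Hb (a - 1) rw rw rw'.
  have -> : (fun x => (a - 1) * w x + w x) = (fun x => a * w x) by apply/funext => x; ring.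
  by move=> ->; ring.
have scr a (w w' : 'rV[R]_n.+1 -> R) : rschwartz w -> rschwartz w' -> b w (fun x => a * w' x) = a * b w w'.
  move=> rw rw'; have := sf_linr Hb (a - 1) rw rw' rw'.
  have -> : (fun x => (a - 1) * w' x + w' x) = (fun x => a * w' x) by apply/funext => x; ring.
  by move=> ->; ring.
have J0 : sform b (outer 1 u) (outer 1 v) 0 = (fun t => b u v * gauss_fun t).
  apply/funext => t; rewrite /sform /sheared /outer.
  have E (w : 'rV[R]_n.+1 -> R) : (fun y : 'rV[R]_n.+1 => gp 1 (t + 0 * y ord0 ord0) * w y) = (fun y => gp 1 t * w y).
    by apply/funext => y; rewrite mul0r addr0.
  rewrite !E scl ?scr//; last exact: rschwartz_scale.
  by rewrite mulrA -expr2 gp1E mulrC.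
(* Translation by [t] in the first coordinate turns [u(x)] into [u(x_0 + t, x')] and the factor
   [G(t - x_0)] into [G(- x_0)], which is [G(x_0)] because G is even. *)
have JI : sform b (outer 1 u) (outer 1 v) (-1) = sform b (inner 1 u) (inner 1 v) 1.
  apply/funext => t; rewrite /sform.
  rewrite -(sf_shift Hb (t *: unitv R ord0)); first last.
  - exact: (sheared_rschwartz (@outer_shear_class R n)).
  - exact: (sheared_rschwartz (@outer_shear_class R n)).
  have E (w : 'rV[R]_n.+1 -> R) :
      (fun z => sheared (outer 1 w) (-1) t (z + t *: unitv R ord0)) = sheared (inner 1 w) 1 t.
    apply/funext => z; rewrite /sheared /outer /inner (addrC z) line0_head mul1r; congr (_ * _).
      have -> : t + -1 * (t + z ord0 ord0) = - z ord0 ord0 by ring.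
      by rewrite /gp !hornerC sqrrN.
    by rewrite -consv_line0 cons_tailv.
  by rewrite !E.
have I0 : sform b (inner 1 u) (inner 1 v) 0 = (fun t => b (tens 1 (restr u t)) (tens 1 (restr v t))).
  apply/funext => t; rewrite /sform.
  have E (w : 'rV[R]_n.+1 -> R) : sheared (inner 1 w) 0 t = tens 1 (restr w t).
    by apply/funext => y; rewrite /sheared mul0r addr0.
  by rewrite !E.
split.
  rewrite JI I J0 I0 in J; rewrite J (RintegralZl _ measurableT); last exact: integrableT_gauss.
  by rewrite mulrC /Rintegral integralT_gauss.
rewrite -[X in _.-integrable _ X]/(EFin \o (fun t => b (tens 1 (restr u t)) (tens 1 (restr v t)))) -I0.
have [B _ BP] := sform_bound Hb (@inner_shear_class R n) IU IV.
apply: (@integrable_decay _ _ B); last by move=> t; exact: BP.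
exact: (sform_continuous Hb (@inner_shear_class R n)).
Qed.

Lemma schwartz_form_tens n (b : ('rV[R]_n.+1 -> R) -> ('rV[R]_n.+1 -> R) -> R) :
  schwartz_form b -> schwartz_form (fun f g => b (tens 1 f) (tens 1 g)).
Proof.
move=> Hb; have rt (f : 'rV[R]_n -> R) : rschwartz f -> rschwartz (tens 1 f) by exact: tens_rschwartz.
have lin a (f f' : 'rV[R]_n -> R) :
    tens 1 (fun x => a * f x + f' x) = (fun y => a * tens 1 f y + tens 1 f' y).
  by apply/funext => y; rewrite /tens; ring.
split.
- by move=> a u u' v ru ru' rv; rewrite lin (sf_linl Hb); [| exact: rt..].
- by move=> a u v v' ru rv rv'; rewrite lin (sf_linr Hb); [| exact: rt..].
- have [N [K [K0 KP]]] := sf_bound Hb; have [C C0 CP] := @tens_seminorm R n 1 N.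
  exists N, (K * (C * C)); split; first by rewrite !mulr_ge0.
  move=> u v M M' ru rv uM vM'.
  have := KP _ _ _ _ (rt _ ru) (rt _ rv) (CP _ _ (proj1 ru) uM) (CP _ _ (proj1 rv) vM').
  by have -> : K * (C * M * (C * M')) = K * (C * C) * (M * M') by ring.
- move=> x u v ru rv; rewrite -(sf_shift Hb (consv 0 x) (rt _ ru) (rt _ rv)).
  have E (w : 'rV[R]_n -> R) : tens 1 (fun z => w (z + x)) = (fun z => tens 1 w (z + consv 0 x)).
    apply/funext => y; rewrite /tens; congr (gp _ _ * w _).
      by rewrite mxE consv0 addr0.
    by apply/rowP => j; rewrite mxE [tailv y _ _]mxE [RHS]mxE [RHS]mxE consvS.
  by rewrite !E.
- move=> j t u v ru rv; have := sf_mod Hb (lift ord0 j) t (rt _ ru) (rt _ rv).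
  have E (g : R -> R) (w : 'rV[R]_n -> R) : tens 1 (fun x : 'rV[R]_n => g (t * x ord0 j) * w x) =
      (fun y : 'rV[R]_n.+1 => g (t * y ord0 (lift ord0 j)) * tens 1 w y).
    by apply/funext => y; rewrite /tens mxE mulrCA.
  by rewrite !E.
Qed.

Lemma rschwartz_rV0 (u : 'rV[R]_0 -> R) : rschwartz u.
Proof.
have x0 (x : 'rV[R]_0) : x = 0 by apply/rowP => -[].
have js0 (js : seq 'I_0) : js = [::] by case: js => // -[].
split=> [js|js k]; rewrite (js0 js).
  split=> [x|[]//]; have -> : dpart [::] u = cst (u 0) by apply/funext => y; rewrite (x0 y).
  exact: cst_continuous.
by exists ((1 + `|0 : 'rV[R]_0|) ^+ k * `|dpart [::] u 0|) => x; rewrite (x0 x).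
Qed.

(** The equality holds in the extended reals and presupposes no integrability of [u v]: for nonzero
    [c] it contains the finiteness of the integral. In dimension 0 a function is a single value and
    [intRd] is evaluation. *)
Theorem form_is_L2 n (b : ('rV[R]_n -> R) -> ('rV[R]_n -> R) -> R) :
  schwartz_form b -> exists c : R, forall u v, rschwartz u -> rschwartz v ->
  (b u v)%:E = (c%:E * intRd (fun x => (u x * v x)%:E))%E.
Proof.
elim: n b => [|n ih] b Hb.
  exists (b (fun=> 1) (fun=> 1)) => u v _ _.
  have x0 (x : 'rV[R]_0) : x = 0 by apply/rowP => -[].
  have r1 := @rschwartz_rV0.
  have uE (w : 'rV[R]_0 -> R) : w = (fun x => w 0 * (fun=> 1) x + (fun=> 0) x).
    by apply/funext => x; rewrite (x0 x) mulr1 addr0.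
  have b0l w : b (fun=> 0) w = 0.
    have := sf_linl Hb (-1) (r1 (fun=> 0)) (r1 (fun=> 0)) (r1 w).
    have -> : (fun x => -1 * (fun=> 0 : R) x + (fun=> 0) x) = (fun=> 0 : R).
      by move=> T; apply/funext => x; rewrite mulr0 addr0.
    by lra.
  have b0r w : b w (fun=> 0) = 0.
    have := sf_linr Hb (-1) (r1 w) (r1 (fun=> 0)) (r1 (fun=> 0)).
    have -> : (fun x => -1 * (fun=> 0 : R) x + (fun=> 0) x) = (fun=> 0 : R).
      by move=> T; apply/funext => x; rewrite mulr0 addr0.
    by lra.
  rewrite {1}(uE u) {1}(uE v) (sf_linl Hb) ?(sf_linr Hb) ?b0l ?b0r; try exact: r1.
  by rewrite !addr0 /= -EFinM; congr EFin; ring.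
have [c cP] := ih _ (schwartz_form_tens Hb).
have pi0 : 0 < Num.sqrt pi :> R by rewrite sqrtr_gt0 pi_gt0.
exists (c / Num.sqrt pi) => u v ru rv.
have [E Iint] := form_localization Hb ru rv.
have cP' t := cP _ _ (rschwartz_restr t ru) (rschwartz_restr t rv).
have bE : (b u v)%:E = (((Num.sqrt pi)^-1)%:E *
    \int[mu]_t (b (tens 1 (restr u t)) (tens 1 (restr v t)))%:E)%E.
  rewrite -(fineK (integrable_fin_num measurableT Iint)) -EFinM; congr EFin.
  by apply: (@mulfI _ (Num.sqrt pi)); rewrite ?gt_eqF// mulrA divff ?gt_eqF// mul1r.
rewrite bE -[intRd _]/(\int[mu]_t intRd (fun y => (restr u t y * restr v t y)%:E))%E.
(* For [c = 0] the slices say nothing about the inner integrals, but 0 times any extended real is 0.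
   For nonzero [c] the slice identity can be inverted, which makes the inner integral an integrable
   function of [t]. *)
have [c0|c0] := eqVneq c 0.
  rewrite c0 mul0r mul0e (eq_integral (fun=> 0%E)); last first.
    by move=> t _; rewrite cP' c0 mul0e.
  by rewrite integral0 mule0.
have h t : intRd (fun y => (restr u t y * restr v t y)%:E) =
    ((c^-1)%:E * (b (tens 1 (restr u t)) (tens 1 (restr v t)))%:E)%E.
  by rewrite cP' muleA -EFinM mulVf// mul1e.
under [in RHS]eq_integral => t _ do rewrite h.
rewrite (integralZl measurableT Iint) muleA -EFinM.
by rewrite (_ : c / Num.sqrt pi * c^-1 = (Num.sqrt pi)^-1)//; field; rewrite gt_eqF// c0.
Qed.

End FormsAreL2.

(** * Lebesgue measure on row vectors and real L2 functions *)

Section TransportMeasure.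
Context (d1 d2 : measure_display) (X : measurableType d1) (Y : measurableType d2) (R : realType).
Variables (m : {measure set X -> \bar R}) (c : X -> Y) (ci : Y -> X).
Hypothesis sfm : sigma_finite setT m.
Hypothesis mc : measurable_fun [set: X] c.
Hypothesis mci : measurable_fun [set: Y] ci.
Hypothesis cK : cancel c ci.

Lemma transport_sigma_finite : sigma_finite setT (pushforward m c).
Proof.
have [F FE FP] := sfm.
exists (fun i => ci @^-1` F i); first by rewrite -preimage_bigcup -FE.
move=> i; have [mF Foo] := FP i; split.
  by rewrite -[X in measurable X]setTI; exact: mci.
rewrite /pushforward -comp_preimage (_ : ci \o c = id) ?preimage_id//.
by apply/funext => x; exact: cK.
Qed.

(** The image measure under [c]; sigma-finiteness is carried over because the next product measure
    in [lebesgue_measureV] asks for it. *)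
Lemma transport_measure : exists mu : {sigma_finite_measure set Y -> \bar R},
  (forall f : Y -> \bar R, measurable_fun [set: Y] f -> (forall y, 0 <= f y)%E ->
    (\int[mu]_y f y = \int[m]_x f (c x))%E) /\
  (forall f : Y -> \bar R, mu.-integrable [set: Y] f ->
    m.-integrable [set: X] (f \o c) /\ (\int[mu]_y f y = \int[m]_x f (c x))%E).
Proof.
pose M : {measure set Y -> \bar R} :=
  measure_function_pushforward__canonical__measure_function_Measure m mc.
pose H := Measure_isSigmaFinite.Build _ _ _ (Measure.sort M) transport_sigma_finite.
pose mu := HB.pack_for (SigmaFiniteMeasure.type Y R) (Measure.sort M) H.
have ge0 f : measurable_fun [set: Y] f -> (forall y, 0 <= f y)%E ->
    (\int[mu]_y f y = \int[m]_x f (c x))%E.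
  by move=> mf f0; apply: etrans (ge0_integral_pushforward mc _ measurableT mf (fun y _ => f0 y)) _.
exists mu; split=> // f /integrableP[mf foo].
have If : m.-integrable [set: X] (f \o c).
  apply/integrableP; split; first exact: measurableT_comp.
  by rewrite -(ge0 (fun y => `|f y|)%E)//; exact: measurableT_comp.
split=> //.
exact: (etrans (@integral_pushforward _ _ _ _ _ c mc m setT f mf If measurableT)).
Qed.

End TransportMeasure.

Section BorelRow.
Variable R : realType.

(** Row vectors with the sigma-algebra in which [borel_measurable] is stated. *)
Definition borelV n := g_sigma_algebraType [set U : set 'rV[R]_n | open U].

Lemma open_borelV n (U : set 'rV[R]_n) : open U -> measurable (U : set (borelV n)).
Proof. by move=> oU; exact: sub_sigma_algebra. Qed.

Definition boxV n (q : 'rV[rat]_n) (k : nat) : set 'rV[R]_n :=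
  [set z | forall j, `|z ord0 j - ratr (q ord0 j)| < k.+1%:R^-1].

(** Countably many rational boxes form a base, which reduces measurability of a map into R^n to that
    of its coordinates. *)
Lemma open_bigcup_box n (U : set 'rV[R]_n) : open U ->
  U = \bigcup_(i in [set i : 'rV[rat]_n * nat | boxV i.1 i.2 `<=` U]) boxV i.1 i.2.
Proof.
move=> oU; apply/seteqP; split=> [x Ux|x [i iU xi]]; last exact: iU.
have /nbhs_ballP[e /= e0 eU] : nbhs x U by rewrite nbhsE; exists U.
pose k := Num.truncn (2 / e).
have k0 : 0 < k.+1%:R^-1 :> R by rewrite invr_gt0.
have ke : 2 * k.+1%:R^-1 < e :> R.
  by rewrite ltr_pdivrMr// mulrC -ltr_pdivrMr// truncnS_gt.
have /choice[q qP] : forall j, exists q : rat, `|x ord0 j - ratr q| < k.+1%:R^-1.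
  move=> j; have [|q] := @rat_in_itvoo R (x ord0 j - k.+1%:R^-1) (x ord0 j + k.+1%:R^-1).
    by rewrite ltrD2l; apply: lt_trans k0; rewrite oppr_lt0.
  by rewrite in_itv/= => qI; exists q; rewrite ltr_distlC.
exists (\row_j q j, k); last by move=> j; rewrite mxE; exact: qP.
move=> z zP; apply: eU; rewrite -ball_normE /=; apply: le_lt_trans ke.
apply: rnorm_le => [|j]; first by rewrite mulr_ge0// ltW.
have := zP j; rewrite mxE => z1; have := qP j => z2; rewrite !mxE.
have -> : x ord0 j - z ord0 j = (x ord0 j - ratr (q j)) - (z ord0 j - ratr (q j)) by ring.
apply: le_trans (ler_normB _ _) _; move: z1 z2; set a := k.+1%:R^-1; lra.
Qed.

Lemma measurable_to_borelV (d : measure_display) (X : measurableType d) n (h : X -> borelV n) :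
  (forall j, measurable_fun [set: X] (fun x => (h x : 'rV[R]_n) ord0 j)) ->
  measurable_fun [set: X] h.
Proof.
move=> mh; apply: (@measurability _ _ X (borelV n) setT h [set U : set 'rV[R]_n | open U] erefl).
move=> _ [U oU <-].
rewrite setTI (open_bigcup_box oU) preimage_bigcup.
have mbox i : measurable (h @^-1` boxV i.1 i.2).
  have -> : h @^-1` boxV i.1 i.2 = \bigcap_(j in [set: 'I_n])
      ((fun x => (h x : 'rV[R]_n) ord0 j) @^-1` [set z | `|z - ratr (i.1 ord0 j)| < i.2.+1%:R^-1]).
    by apply/seteqP; split=> x; [move=> hx j _; exact: hx|move=> hx j; exact: hx].
  apply: fin_bigcap_measurable => [|j _]; first exact: finite_finset.
  rewrite -[X in measurable X]setTI; apply: mh => //.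
  have -> : [set z | `|z - ratr (i.1 ord0 j)| < i.2.+1%:R^-1] = ball (ratr (i.1 ord0 j) : R) i.2.+1%:R^-1.
    by apply/seteqP; split=> z; rewrite -ball_normE /= distrC.
  by apply: open_measurable; exact: ball_open.
(* The union over a countable type of boxes becomes a union over the natural numbers, with the empty
   set at codes of no admissible box. *)
pose G (k : nat) : set X := if unpickle k is Some i then
   (if `[< boxV i.1 i.2 `<=` U >] then h @^-1` boxV i.1 i.2 else set0) else set0.
have -> : \bigcup_(i in [set i : 'rV[rat]_n * nat | boxV i.1 i.2 `<=` U]) (h @^-1` boxV i.1 i.2)
    = \bigcup_k G k.
  apply/seteqP; split=> [x [i iU xi]|x [k _]].
    by exists (pickle i) => //; rewrite /G pickleK; case: asboolP.
  by rewrite /G; case: unpickle => // i; case: asboolP => // iU xi; exists i.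
apply: bigcupT_measurable => k; rewrite /G; case: unpickle => // i.
by case: asboolP => // _; exact: mbox.
Qed.

Lemma continuous_borelV n (u : 'rV[R]_n -> R) : continuous u ->
  measurable_fun [set: borelV n] (u : borelV n -> R).
Proof.
move=> cu; apply: (measurability _ (RGenOpens.measurableE R)) => _ [_ [a [b ->] <-]].
rewrite setTI; apply: open_borelV; apply: open_comp; last exact: interval_open.
by move=> x _; exact: cu.
Qed.

Lemma borel_measurableE n (u : 'rV[R]_n -> R) :
  borel_measurable u <-> measurable_fun [set: borelV n] (u : borelV n -> R).
Proof.
split=> [mu|mu A oA].
  apply: (measurability _ (RGenOpens.measurableE R)) => _ [_ [a [b ->] <-]].
  by rewrite setTI; apply: mu; exact: interval_open.
by rewrite -[X in <<s _ >> X]setTI; apply: mu => //; exact: open_measurable.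
Qed.

Lemma measurable_consv n :
  measurable_fun setT (fun z : R * borelV n => consv z.1 z.2 : borelV n.+1).
Proof.
apply: measurable_to_borelV => j; case: (unliftP ord0 j) => [k|] ->.
  have -> : (fun x : R * borelV n => consv x.1 x.2 ord0 (lift ord0 k)) =
      (fun y : borelV n => (y : 'rV[R]_n) ord0 k) \o snd.
    by apply/funext => x; rewrite consvS.
  apply: measurableT_comp => //; apply: continuous_borelV; exact: coord_continuous.
have -> : (fun x : R * borelV n => consv x.1 x.2 ord0 ord0) = fst.
  by apply/funext => x; rewrite consv0.
exact: measurable_fst.
Qed.

Lemma measurable_unconsv n : measurable_fun [set: borelV n.+1]
  (fun y : borelV n.+1 => ((y : 'rV[R]_n.+1) ord0 ord0, tailv y) : R * borelV n).
Proof.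
apply/measurable_fun_pairP; split.
  by apply: continuous_borelV; exact: coord_continuous.
apply: measurable_to_borelV => j /=.
have -> : (fun x : borelV n.+1 => tailv x ord0 j) = (fun x : borelV n.+1 => (x : 'rV[R]_n.+1) ord0 (lift ord0 j)).
  by apply/funext => x; rewrite mxE.
by apply: continuous_borelV; exact: coord_continuous.
Qed.

(** The parameter space [X] is arbitrary because the induction moves the first coordinate of R^(n+1)
    into it. The integral over that coordinate is split into positive and negative parts, each
    measurable by Tonelli. *)
Lemma measurable_intRd n (d : measure_display) (X : measurableType d)
  (f : X * borelV n -> \bar R) : measurable_fun setT f ->
  measurable_fun setT (fun x => intRd (fun y : 'rV[R]_n => f (x, y))).
Proof.
elim: n d X f => [|n ih] d X f mf.
  by rewrite /=; apply: (measurableT_comp mf); exact: measurable_fun_pair.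
rewrite /=; pose F (z : (X * R) * borelV n) := f (z.1.1, consv z.1.2 z.2).
have m0 : measurable_fun setT (fun z : (X * R) * borelV n => z.1.1).
  exact: (measurableT_comp measurable_fst measurable_fst).
have m1 : measurable_fun setT (fun z : (X * R) * borelV n => z.1.2).
  exact: (measurableT_comp measurable_snd measurable_fst).
have m2 : measurable_fun setT (fun z : (X * R) * borelV n => (z.1.2, z.2)).
  exact: (measurable_fun_pair m1 measurable_snd).
have m3 := measurableT_comp (@measurable_consv n) m2.
have mF : measurable_fun setT F by exact: (measurableT_comp mf (measurable_fun_pair m0 m3)).
pose G (x : X * R) := intRd (fun y : 'rV[R]_n => F (x, y)).
have mG : measurable_fun setT G := ih _ _ F mF.
have -> : (fun x => \int[@lebesgue_measure R]_t intRd (fun y : 'rV[R]_n => f (x, row_mx t%:M y)))%E =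
    ((fun x => \int[@lebesgue_measure R]_t (G^\+ (x, t))) \-
     (fun x => \int[@lebesgue_measure R]_t (G^\- (x, t))))%E.
  apply/funext => x; rewrite [LHS]integralE.
  have Ep := funepos_comp G (fun t => (x, t)); have En := funeneg_comp G (fun t => (x, t)).
  congr (_ - _)%E; apply: eq_integral => t _; first exact: (congr1 (@^~ t) Ep).
  exact: (congr1 (@^~ t) En).
have mp : measurable_fun setT (G^\+)%E by exact: measurable_funepos.
have mn : measurable_fun setT (G^\-)%E by exact: measurable_funeneg.
have h (H : X * R -> \bar R) (mH : measurable_fun setT H) (H0 : forall z, (0 <= H z)%E) :
    measurable_fun setT (fun x => \int[@lebesgue_measure R]_t H (x, t))%E.
  exact: (@measurable_fun_fubini_tonelli_F _ _ X (measurableTypeR R) R lebesgue_measure H mH H0).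
by apply: emeasurable_funB; apply: h.
Qed.

(** Realises the iterated integral as integration against one measure, so that L^2 theory on measure
    spaces applies. The two clauses are Tonelli and Fubini. *)
Lemma lebesgue_measureV n : exists mu : {sigma_finite_measure set (borelV n) -> \bar R},
  (forall f : borelV n -> \bar R, measurable_fun setT f -> (forall x, 0 <= f x)%E ->
    intRd (f : 'rV[R]_n -> \bar R) = (\int[mu]_x f x)%E) /\
  (forall f : borelV n -> \bar R, mu.-integrable setT f ->
    intRd (f : 'rV[R]_n -> \bar R) = (\int[mu]_x f x)%E).
Proof.
elim: n => [|n [nu [nu0 nuI]]].
  exists (\d_ (0 : borelV 0)); split=> [f mf _|f /integrableP[mf _]].
    by rewrite integral_dirac// diracT mul1e.
  by rewrite integral_dirac// diracT mul1e.
pose leb : {sigma_finite_measure set (measurableTypeR R) -> \bar R} := @lebesgue_measure R.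
pose m : {measure set _ -> \bar R} := (leb \x nu)%E.
have sfm : sigma_finite setT m.
  have /sigma_finiteP[F [TF ndF Foo]] := sigma_finiteT leb.
  have /sigma_finiteP[G [TG ndG Goo]] := sigma_finiteT nu.
  exists (fun k => F k `*` G k) => [|k].
    apply/seteqP; split=> // -[x y] _.
    have [i _ Fx] : (\bigcup_k F k) x by rewrite -TF.
    have [j _ Gy] : (\bigcup_k G k) y by rewrite -TG.
    exists (maxn i j) => //; split=> /=.
      by have /subsetPset := ndF _ _ (leq_maxl i j); exact.
    by have /subsetPset := ndG _ _ (leq_maxr i j); exact.
  have [mF Fk] := Foo k; have [mG Gk] := Goo k; split; first exact: measurableX.
  have -> : m (F k `*` G k) = (leb (F k) * nu (G k))%E by exact: product_measure1E.
  by rewrite lte_mul_pinfty// ge0_fin_numE.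
pose cons (z : (measurableTypeR R * borelV n)%type) : borelV n.+1 := consv z.1 z.2.
have consK : cancel cons (fun y : borelV n.+1 => ((y : 'rV[R]_n.+1) ord0 ord0, tailv y)).
  by move=> [t y]; rewrite /cons /= consv0 tail_consv.
have [mu [mu0 muI]] := transport_measure sfm (@measurable_consv n) (@measurable_unconsv n) consK.
exists mu; split=> [f mf f0|f If].
  rewrite mu0//.
  have mfc : measurable_fun setT (f \o cons) by apply: measurableT_comp => //; exact: measurable_consv.
  have f0c z : (0 <= (f \o cons) z)%E by exact: f0.
  apply: etrans (esym (@fubini_tonelli1 _ _ _ _ _ leb nu (f \o cons) mfc f0c)).
  apply: eq_integral => t _; rewrite /fubini_F /=; apply: nu0 => //.
  exact: (measurableT_comp mfc (measurable_pair1 _)).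
have [Ifc ->] := muI f If.
have /measurable_int mfc := Ifc.
rewrite -[RHS]/(\int[m]_x (f \o cons) x)%E -(integral12_prod_meas1 Ifc).
(* Slices are integrable for almost every [t] only, so the two integrands are compared almost
   everywhere, and this asks for measurability of the iterated integral in [t]. *)
have mI : measurable_fun [set: measurableTypeR R]
    (fun t => intRd (fun y : 'rV[R]_n => (f \o cons) (t, y))).
  exact: (@measurable_intRd n _ (measurableTypeR R) (f \o cons)).
apply: (@ae_eq_integral _ _ _ leb setT _ _ measurableT mI (measurable_fubini_F Ifc)).
have := ae_integrable1 Ifc; apply: filterS => t It _.
by rewrite /fubini_F; exact: nuI.
Qed.

End BorelRow.

(** * Real L^2 over a measure space, up to completeness *)

Section RealL2.
Context (d : measure_display) (T : measurableType d) (R : realType).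
Variable mu : {measure set T -> \bar R}.
Implicit Types f g h : T -> R.

Definition l2 f := measurable_fun [set: T] f /\ (\int[mu]_x (f x ^+ 2)%:E < +oo)%E.

Definition l2ip f g : R := (\int[mu]_x (f x * g x))%R.

Lemma l2_sqr_integrable f : l2 f -> mu.-integrable [set: T] (fun x => (f x ^+ 2)%:E).
Proof.
move=> [mf foo]; apply/integrableP; split.
  by apply/measurable_EFinP; exact: measurable_funX.
apply: le_lt_trans foo; rewrite le_eqVlt; apply/orP; left; apply/eqP.
by apply: eq_integral => x _; rewrite gee0_abs// lee_fin sqr_ge0.
Qed.

Lemma l2_mul_integrable f g : l2 f -> l2 g -> mu.-integrable [set: T] (EFin \o (fun x => f x * g x)).
Proof.
move=> lf lg.
apply: (@le_integrable _ _ _ mu _ measurableT _ (fun x => (f x ^+ 2)%:E + (g x ^+ 2)%:E)%E).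
- by apply/measurable_EFinP; apply: measurable_funM; [case: lf|case: lg].
- move=> x _; rewrite -EFinD /= lee_fin normrM [leRHS]ger0_norm ?addr_ge0 ?sqr_ge0//.
  rewrite -(real_normK (num_real (f x))) -(real_normK (num_real (g x))).
  have := sqr_ge0 (`|f x| - `|g x|); rewrite sqrrB.
  have := mulr_ge0 (normr_ge0 (f x)) (normr_ge0 (g x)).
  set a := `|f x|; set b := `|g x|; lra.
- by apply: integrableD => //; exact: l2_sqr_integrable.
Qed.

Lemma l2_lin (a : R) f g : l2 f -> l2 g -> l2 (fun x => a * f x + g x).
Proof.
move=> lf lg; have [mf _] := lf; have [mg _] := lg; split.
  by apply: measurable_funD => //; apply: measurable_funM.
have lf2 := l2_sqr_integrable lf; have lg2 := l2_sqr_integrable lg.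
have lfg := l2_mul_integrable lf lg.
have /integrableP[_] : mu.-integrable [set: T] (fun x => ((a ^+ 2)%:E * (f x ^+ 2)%:E +
    (2 * a)%:E * (f x * g x)%:E + (g x ^+ 2)%:E)%E).
  apply: integrableD => //; apply: integrableD => //; first exact: integrableZl.
  exact: (integrableZl _ _ lfg).
apply: le_lt_trans; rewrite le_eqVlt; apply/orP; left; apply/eqP.
apply: eq_integral => x _; rewrite -!EFinM -!EFinD.
have -> : a ^+ 2 * f x ^+ 2 + 2 * a * (f x * g x) + g x ^+ 2 = (a * f x + g x) ^+ 2 by ring.
by rewrite gee0_abs// lee_fin sqr_ge0.
Qed.

Lemma l2_scale (a : R) f : l2 f -> l2 (fun x => a * f x).
Proof.
move=> lf; have := l2_lin (a - 1) lf lf.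
by congr l2; apply/funext => x; ring.
Qed.

Lemma l2B f g : l2 f -> l2 g -> l2 (fun x => f x - g x).
Proof.
move=> lf lg; have := l2_lin (-1) lg lf.
by congr l2; apply/funext => x; ring.
Qed.

Lemma l2ipC f g : l2ip f g = l2ip g f.
Proof. by apply: eq_Rintegral => x _; rewrite mulrC. Qed.

Lemma l2ip_linl (a : R) f g h : l2 f -> l2 g -> l2 h ->
  l2ip (fun x => a * f x + g x) h = a * l2ip f h + l2ip g h.
Proof.
move=> lf lg lh; have If := l2_mul_integrable lf lh; have Ig := l2_mul_integrable lg lh.
rewrite /l2ip -RintegralZl// -RintegralD//; first by apply: eq_Rintegral => x _; ring.
exact: (integrableZl _ a If).
Qed.

Lemma l2ip_scalel (a : R) f h : l2 f -> l2 h -> l2ip (fun x => a * f x) h = a * l2ip f h.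
Proof.
move=> lf lh; rewrite /l2ip -RintegralZl//; last exact: l2_mul_integrable.
by apply: eq_Rintegral => x _; rewrite mulrA.
Qed.

Lemma l2ipNl f h : l2 f -> l2 h -> l2ip (fun x => - f x) h = - l2ip f h.
Proof.
move=> lf lh; rewrite -mulN1r -l2ip_scalel//.
by congr l2ip; apply/funext => x; rewrite mulN1r.
Qed.

Lemma l2ip_linr (a : R) f g h : l2 f -> l2 g -> l2 h ->
  l2ip h (fun x => a * f x + g x) = a * l2ip h f + l2ip h g.
Proof. by move=> lf lg lh; rewrite !(l2ipC h); exact: l2ip_linl. Qed.

Lemma l2ip_ge0 f : 0 <= l2ip f f.
Proof. by apply: Rintegral_ge0 => x _; rewrite -expr2 sqr_ge0. Qed.

Lemma l2ip_sqr f : l2 f -> (\int[mu]_x (f x ^+ 2)%:E = (l2ip f f)%:E)%E.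
Proof.
move=> lf; rewrite /l2ip /Rintegral fineK; last first.
  by have := integral_fune_fin_num measurableT (l2_mul_integrable lf lf).
by apply: eq_integral => x _; rewrite expr2.
Qed.

(** Expand the nonnegative integrals of the squares of [g - c f] and [g + c f] and divide by [c].
    The free parameter spares norms and square roots. *)
Lemma l2ip_young (c : R) f g : 0 < c -> l2 f -> l2 g ->
  `|2 * l2ip f g| <= c * l2ip f f + c^-1 * l2ip g g.
Proof.
move=> c0 lf lg.
have key (s : R) : s ^+ 2 = 1 -> s * (2 * l2ip f g) <= c * l2ip f f + c^-1 * l2ip g g.
  move=> s2; have lx := l2_lin (- (s * c)) lf lg; have := l2ip_ge0 (fun x => - (s * c) * f x + g x).
  rewrite l2ip_linl// !l2ip_linr// (l2ipC g f) => h.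
  have ci : 0 <= c^-1 by rewrite invr_ge0 ltW.
  have := mulr_ge0 ci h; set A := l2ip f f; set B := l2ip f g; set D := l2ip g g.
  have -> : c^-1 * (- (s * c) * (- (s * c) * A + B) + (- (s * c) * B + D)) =
    s ^+ 2 * c * A - s * (2 * B) + c^-1 * D by field; rewrite gt_eqF.
  by rewrite s2 mul1r; set E := c^-1 * D; set F := s * _; lra.
have := key 1 (expr1n _ _); have := key (-1) (etrans (sqrrN 1) (expr1n _ _)).
by rewrite mul1r mulN1r ler_norml; set B := 2 * _ => h1 h2; apply/andP; split; lra.
Qed.

(** With [a_k] the k-th increment, the series of [2^k a_k^2] has integral at most 1, so its sum [S]
    is finite almost everywhere. There [a_k^2 <= S / 2^k], and the increments are dominated by a
    geometric series. *)
Lemma l2_subseq_cvg (f : nat -> T -> R) : (forall k, l2 (f k)) ->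
  (forall k, (\int[mu]_x ((f k.+1 x - f k x) ^+ 2)%:E <= ((2 ^ k)%:R * (2 ^ k.+1)%:R)^-1%:E)%E) ->
  {ae mu, forall x, cvgn (fun k => f k x)}.
Proof.
move=> lf fk; pose a k x := f k.+1 x - f k x.
have ma k : measurable_fun [set: T] (fun x => ((2 ^ k)%:R * a k x ^+ 2)%:E).
  apply/measurable_EFinP; apply: measurable_funM => //; apply: measurable_funX.
  by apply: measurable_funB; [case: (lf k.+1)|case: (lf k)].
pose S x := (\sum_(k <oo) ((2 ^ k)%:R * a k x ^+ 2)%:E)%E.
have a0 k x : (0 <= ((2 ^ k)%:R * a k x ^+ 2)%:E)%E by rewrite lee_fin mulr_ge0// sqr_ge0.
have mS : measurable_fun [set: T] S by apply: ge0_emeasurable_sum.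
have S0 x : (0 <= S x)%E by apply: nneseries_ge0.
have IS : mu.-integrable [set: T] S.
  apply/integrableP; split=> //.
  under eq_integral do rewrite gee0_abs//.
  rewrite integral_nneseries//; apply: le_lt_trans (ltry 1).
  apply: le_trans (epsilon_trick0 xpredT (ler01 : 0 <= 1 :> R)).
  apply: lee_nneseries => [k _ _|k _]; first exact: integral_ge0.
  under eq_integral do rewrite EFinM.
  rewrite ge0_integralZl//; last 2 first.
  - apply/measurable_EFinP; apply: measurable_funX.
    by apply: measurable_funB; [case: (lf k.+1)|case: (lf k)].
  - by move=> x _; rewrite lee_fin sqr_ge0.
  have := lee_wpmul2l (ltac:(by rewrite lee_fin) : (0 <= (2 ^ k)%:R%:E)%E) (fk k).
  by rewrite -EFinM invfM mulrA mulfV ?mul1r// pnatr_eq0 expn_eq0.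
have := integrable_ae measurableT IS; apply: filterS => x /(_ I) Sx.
have [s sE] : exists s : R, S x = s%:E by exists (fine (S x)); rewrite fineK.
have ak k : a k x ^+ 2 <= s / 2 ^+ k.
  rewrite ler_pdivlMr ?exprn_gt0// mulrC -natrX -lee_fin -sE.
  apply: le_trans (nneseries_lim_ge k.+1 (fun k _ _ => a0 k x)).
  by rewrite big_nat_recr//= leeDr// sume_ge0.
pose q : R := Num.sqrt 2^-1.
have q0 : 0 <= q by exact: sqrtr_ge0.
have q1 : `|q| < 1 by rewrite ger0_norm// -[ltRHS]sqrtr1 ltr_sqrt// invf_lt1// ltr1n.
have s0 : 0 <= s by rewrite -lee_fin -sE.
have ca : cvgn (series (telescope (fun k => f k x))).
  apply: normed_cvg; apply: (@series_le_cvg _ _ (geometric (Num.sqrt s) q)) => [k|k|k|].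
  - exact: normr_ge0.
  - by rewrite /geometric /= mulr_ge0 ?exprn_ge0 ?sqrtr_ge0.
  - rewrite /geometric /= -(@ler_pXn2r _ 2) ?nnegrE ?mulr_ge0 ?exprn_ge0 ?sqrtr_ge0//.
    rewrite real_normK ?num_real// exprMn sqr_sqrtr// exprAC sqr_sqrtr ?invr_ge0//.
    by rewrite exprVn; exact: ak.
  - exact: is_cvg_geometric_series.
move: ca; rewrite telescopeK => ca.
have -> : (fun k => f k x) = (fun k => (f k x - f 0%N x) + f 0%N x).
  by apply/funext => k; rewrite subrK.
by apply: is_cvgD => //; exact: is_cvg_cst.
Qed.

Lemma limn_einf_le (u : nat -> \bar R) (e : \bar R) (N : nat) :
  (forall k, (N <= k)%N -> (u k <= e)%E) -> (limn_einf u <= e)%E.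
Proof.
move=> ue; rewrite limn_einf_lim; apply: lime_le; first exact: is_cvg_einfs.
near=> k; apply: le_trans (ue k _); last by near: k; exact: nbhs_infty_ge.
by apply: ereal_inf_lbound; exists k => /=.
Unshelve. all: by end_near. Qed.

(** A fast subsequence converges almost everywhere, and Fatou's lemma along it bounds the distance
    of every late [f m] to the limit. *)
Lemma l2_complete (f : nat -> T -> R) : (forall n, l2 (f n)) ->
  (forall e : R, 0 < e -> exists N, forall m n, (N <= m)%N -> (N <= n)%N ->
    l2ip (fun x => f m x - f n x) (fun x => f m x - f n x) < e) ->
  exists2 g, l2 g & forall e : R, 0 < e -> exists N, forall n, (N <= n)%N ->
    l2ip (fun x => f n x - g x) (fun x => f n x - g x) <= e.
Proof.
move=> lf cf.
pose eps k : R := ((2 ^ k)%:R * (2 ^ k.+1)%:R)^-1.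
have eps0 k : 0 < eps k by rewrite invr_gt0 mulr_gt0// ltr0n expn_gt0.
have [N NP] := choice (fun k => cf _ (eps0 k)).
(* Summing the [N i] makes [n] nondecreasing with [N k <= n k], and the summand [k] makes it
   unbounded. *)
pose n k := (k + \sum_(i < k.+1) N i)%N.
have nN k : (N k <= n k)%N by rewrite /n big_ord_recr /= addnA leq_addl.
have nk k : (k <= n k)%N by rewrite /n leq_addr.
have nS k : (n k <= n k.+1)%N.
  by rewrite /n [X in (_ <= _ + X)%N]big_ord_recr /= addnA (leq_trans _ (leq_addr _ _))// leq_add2r.
pose h k := f (n k).
have hc : {ae mu, forall x, cvgn (fun k => h k x)}.
  apply: l2_subseq_cvg => [k|k]; first exact: lf.
  rewrite (l2ip_sqr (l2B (lf _) (lf _))) lee_fin ltW//.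
  by apply: NP => //; exact: leq_trans (nS k).
(* An upper limit is measurable on the whole space; off the set of convergence its value does not
   matter. *)
pose g x := fine (limn_esup (fun k => (h k x)%:E)).
have mh k : measurable_fun [set: T] (fun x => (h k x)%:E).
  by apply/measurable_EFinP; case: (lf (n k)).
have mg : measurable_fun [set: T] g.
  by apply: measurableT_comp => //; exact: measurable_fun_limn_esup.
have hg : {ae mu, forall x, h k x @[k --> \oo] --> g x}.
  apply: filterS hc => x cx.
  have /cvg_limn_einf_sup[_ E] : (h k x)%:E @[k --> \oo] --> (limn (fun k => h k x))%:E.
    by apply: cvg_EFin => //; exact: nearW.
  by rewrite /g E.
have key m (e : R) M : (forall k, (M <= k)%N -> l2ip (fun x => f m x - h k x) (fun x => f m x - h k x) <= e) ->
    (\int[mu]_x ((f m x - g x) ^+ 2)%:E <= e%:E)%E.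
  move=> He.
  have md k : measurable_fun [set: T] (fun x => ((f m x - h k x) ^+ 2)%:E).
    apply/measurable_EFinP; apply: measurable_funX.
    by apply: measurable_funB; [case: (lf m)|case: (lf (n k))].
  have d0 k x : (0 <= ((f m x - h k x) ^+ 2)%:E)%E by rewrite lee_fin sqr_ge0.
  apply: le_trans (_ : _ <= \int[mu]_x limn_einf (fun k => ((f m x - h k x) ^+ 2)%:E))%E _.
    rewrite le_eqVlt; apply/orP; left; apply/eqP; apply: ge0_ae_eq_integral => //.
    - apply/measurable_EFinP; apply: measurable_funX.
      by apply: measurable_funB => //; case: (lf m).
    - apply: measurableT_comp => //.
      by apply: measurable_fun_limn_esup => k; exact: measurableT_comp (md k).
    - by move=> x _; rewrite lee_fin sqr_ge0.
    - move=> x _; rewrite limn_einf_lim; apply: lime_ge; first exact: is_cvg_einfs.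
      by apply: nearW => k; apply: le_ereal_inf_tmp => _ [i _ <-].
    - apply: filterS hg => x hx _; apply/esym.
      have /cvg_limn_einf_sup[] // : ((f m x - h k x) ^+ 2)%:E @[k --> \oo] --> ((f m x - g x) ^+ 2)%:E.
      apply: cvg_EFin; first exact: nearW.
      have hd : f m x - h k x @[k --> \oo] --> f m x - g x by apply: cvgB => //; exact: cvg_cst.
      exact: (cvgM hd hd).
  apply: le_trans (fatou mu measurableT md (fun k x _ => d0 k x)) _.
  apply: (@limn_einf_le _ _ M) => k Mk.
  by rewrite (l2ip_sqr (l2B (lf _) (lf _))) lee_fin; exact: He.
have lgm m (e : R) M : (forall k, (M <= k)%N -> l2ip (fun x => f m x - h k x) (fun x => f m x - h k x) <= e) ->
    l2 (fun x => f m x - g x).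
  move=> He; split; first by apply: measurable_funB => //; case: (lf m).
  by apply: le_lt_trans (key m e M He) _; rewrite ltry.
have He (e : R) : 0 < e -> exists M, forall m, (M <= m)%N -> forall k, (M <= k)%N ->
    l2ip (fun x => f m x - h k x) (fun x => f m x - h k x) <= e.
  move=> /cf[M MP]; exists M => m Mm k Mk; apply/ltW/MP => //; exact: leq_trans (nk k).
have lg : l2 g.
  have [M MP] := He 1 ltr01.
  have := l2B (lf M) (lgm M 1 M (MP M (leqnn _))); congr l2.
  by apply/funext => x; rewrite subKr.
exists g => // e e0; have [M MP] := He e e0; exists M => m Mm.
by rewrite -lee_fin -(l2ip_sqr (lgm m e M (MP m Mm))); apply: key (MP m Mm).
Qed.

End RealL2.

(** * Logistic cut-offs and uniqueness of densities *)

Section Logistic.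
Variable R : realType.
Implicit Types (t : R) (q : {poly R}).

Definition logistic t : R := (1 + expR (- t))^-1.

Lemma logistic_den t : 0 < 1 + expR (- t). Proof. by rewrite addr_gt0// expR_gt0. Qed.

Lemma logistic_ge0 t : 0 <= logistic t. Proof. by rewrite invr_ge0 ltW// logistic_den. Qed.

Lemma logistic_le1 t : logistic t <= 1.
Proof. by rewrite invf_le1 ?logistic_den// lerDl expR_ge0. Qed.

Lemma logistic_le t : logistic t <= expR t.
Proof.
by rewrite -[expR t]invrK -expRN lef_pV2 ?posrE ?logistic_den ?expR_gt0// lerDr.
Qed.

Lemma logistic_sub1 t : `|logistic t - 1| <= expR (- t).
Proof.
rewrite ler0_norm ?subr_le0 ?logistic_le1// opprB /logistic.
have := logistic_den t; have := expR_gt0 (- t); set e := expR _ => e0 e1.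
have -> : 1 - (1 + e)^-1 = e / (1 + e) by field; rewrite gt_eqF.
by rewrite ler_pdivrMr// mulrDr mulr1 lerDl mulr_ge0// ltW.
Qed.

Lemma logistic_derive t : is_derive t (1 : R) logistic (logistic t - logistic t ^+ 2).
Proof.
have d0 : is_derive t 1 (fun t : R => expR (- t)) (expR (- t) * -1).
  exact: (is_derive1_comp (is_derive_expR _) (is_deriveN (@is_derive_id R R t 1))).
have d1 : is_derive t 1 (fun t : R => 1 + expR (- t)) (0 + expR (- t) * -1).
  exact: (is_deriveD (@is_derive_cst R R R 1 t 1) d0).
have n0 : 1 + expR (- t) != 0 by rewrite gt_eqF ?logistic_den.
have dV := @is_deriveV R (fun t => 1 + expR (- t)) t _ 1 n0 d1.
apply: (is_derive_eq dV); rewrite /logistic /GRing.scale /=.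
by field.
Qed.

Lemma logistic_continuous : continuous logistic.
Proof.
move=> t; have [d _] := logistic_derive t.
exact: (differentiable_continuous (proj1 (derivable1_diffP _ _) d)).
Qed.

(** The summand [k] gives the limit 1 at [t = 0], so that closed half-lines are approximated; the
    factor [k^2] outweighs it at every negative [t]. *)
Lemma logistic_step t :
  logistic (k%:R ^+ 2 * t + k%:R) @[k --> \oo] --> ((0 <= t)%R%:R : R).
Proof.
have E := @cvgn_expR R; have [t0|t0] := leP 0 t.
  apply/cvgrPdist_le => e e0; move/cvgrPdist_le: E => /(_ e e0); apply: filterS => k.
  rewrite sub0r normrN (ger0_norm (expR_ge0 _)) distrC; apply: le_trans.
  apply: le_trans (logistic_sub1 _) _; rewrite ler_expR lerN2 lerDr.
  by rewrite mulr_ge0// exprn_ge0.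
apply/cvgrPdist_le => e e0; move/cvgrPdist_le: E => /(_ e e0) => {}E.
near=> k; have : `|0 - expR (- k%:R) : R| <= e by near: k.
rewrite !sub0r !normrN (ger0_norm (expR_ge0 _)) (ger0_norm (logistic_ge0 _)); apply: le_trans.
apply: le_trans (logistic_le _) _; rewrite ler_expR.
have kt : 2 / - t <= k%:R by near: k; exact: nbhs_infty_ger.
move: kt; rewrite ler_pdivrMr ?oppr_gt0// => kt.
have k0 : 0 <= k%:R :> R by [].
have := ler_wpM2l k0 kt; rewrite expr2; set K := k%:R; nra.
Unshelve. all: by end_near. Qed.

(** Since [logistic' = logistic - logistic^2], the polynomials in a logistic function are closed
    under differentiation, and they are bounded. *)
Lemma moderate_logistic n (j : 'I_n) (a c : R) :
  moderate (fun x : 'rV[R]_n => logistic (a * x ord0 j + c)).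
Proof.
suff h q : moderate (fun x : 'rV[R]_n => q.[logistic (a * x ord0 j + c)]).
  by have := h 'X; congr moderate; apply/funext => x; rewrite hornerX.
apply: (@moderate_coind _ _ (fun m => exists q,
  m = fun x : 'rV[R]_n => q.[logistic (a * x ord0 j + c)])); last by exists q.
move=> {q} _ [q ->]; split=> [x||i].
- have cx : continuous (fun x : 'rV[R]_n => a * x ord0 j + c).
    move=> y; apply: (@continuousD _ _ _ (fun x : 'rV[R]_n => a * x ord0 j) (fun=> c)); last exact: cst_continuous.
    apply: (@continuousM _ _ (fun=> a) (fun x : 'rV[R]_n => x ord0 j)); first exact: cst_continuous.
    exact: coord_continuous.
  have cl := continuous_comp (cx x) (@logistic_continuous _).
  exact: (continuous_comp cl (@continuous_horner _ q _)).
- have [k [M [M0 MP]]] := horner_moderate q.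
  exists 0%N, (M * 2 ^+ k) => x; rewrite expr0 mulr1; apply: le_trans (MP _) _.
  apply: ler_wpM2l => //; apply: lerXn2r; rewrite ?nnegrE ?addr_ge0//.
  by rewrite ger0_norm ?logistic_ge0// -[leRHS]/(1 + 1) lerD2l logistic_le1.
- pose e := unitv R i ord0 j.
  exists (fun x : 'rV[R]_n => ((a * e) *: (q^`() * ('X - 'X ^+ 2))).[logistic (a * x ord0 j + c)]).
    by exists ((a * e) *: (q^`() * ('X - 'X ^+ 2))).
  move=> x; apply/is_derive_line.
  have -> : (fun h : R => q.[logistic (a * (h *: unitv R i + x) ord0 j + c)]) =
      (fun h => q.[logistic (h * (a * e) + (a * x ord0 j + c))]).
    apply/funext => h; have -> : (h *: unitv R i + x) ord0 j = h * e + x ord0 j.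
      by rewrite [LHS]mxE; congr (_ + _); rewrite [LHS]mxE.
    by congr (q.[logistic _]); ring.
  have dq := is_derive1_comp (is_derive_poly q _) (logistic_derive (a * x ord0 j + c)).
  apply: (is_derive_eq (is_derive_affine (a * e) dq)).
  by rewrite !hornerE /=; ring.
Qed.

End Logistic.

Section SchwartzUniqueness.
Variable R : realType.

Lemma gauss_rschwartz n : exists2 G : 'rV[R]_n -> R, rschwartz G & forall x, 0 < G x.
Proof.
elim: n => [|n [G rG G0]]; first by exists (fun=> 1) => //; exact: rschwartz_rV0.
exists (tens 1 G) => [|x]; first exact: tens_rschwartz.
by rewrite /tens /gp hornerC mul1r mulr_gt0// expR_gt0.
Qed.

Definition quadrant n (a : 'rV[R]_n) : set (borelV R n) :=
  [set x | forall j, a ord0 j <= (x : 'rV[R]_n) ord0 j].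

Lemma quadrant_generate n :
  @measurable _ (borelV R n) = <<s [set quadrant a | a in [set: 'rV[R]_n]] >>.
Proof.
pose QT := g_sigma_algebraType [set quadrant a | a in [set: 'rV[R]_n]].
apply/seteqP; split=> A.
  have mid : measurable_fun [set: QT] (fun x : QT => x : borelV R n).
    apply: measurable_to_borelV => j.
    apply: (measurability _ (RGenCInfty.measurableE R)) => _ [_ [a ->] <-]; rewrite setTI.
    (* A half-space is the union of the quadrants whose other corner coordinates are [- k]; a point
       is caught once [k] exceeds its norm. *)
    have -> : (fun x : QT => (x : 'rV[R]_n) ord0 j) @^-1` `[a, +oo[%classic =
        \bigcup_k (quadrant (\row_i if i == j then a else - k%:R) : set QT).
      apply/seteqP; split=> x /=; rewrite in_itv/= andbT.
        move=> ax; exists (Num.truncn `|(x : 'rV[R]_n)|).+1 => // i; rewrite mxE.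
        case: eqP => [->//|_]; rewrite lerNl.
        apply: le_trans (ltW (truncnS_gt _)); rewrite -normrN.
        apply: le_trans (ler_norm _) _; rewrite normrN normrN.
        exact: (@rnorm_coord R n x i).
      by move=> [k _ /(_ j)]; rewrite mxE eqxx.
    apply: bigcupT_measurable => k; apply: sub_sigma_algebra.
    by exists (\row_i if i == j then a else - k%:R).
  by move=> mA; have := mid measurableT A mA; rewrite setTI.
apply: smallest_sub; first exact: sigma_algebra_measurable.
move=> _ [a _ <-].
have -> : quadrant a = \bigcap_(j in [set: 'I_n])
    ((fun x : borelV R n => (x : 'rV[R]_n) ord0 j) @^-1` `[a ord0 j, +oo[%classic).
  apply/seteqP; split=> x /= h j; first by move=> _ /=; rewrite in_itv/= andbT; exact: h.
  by have := h j I; rewrite /= in_itv/= andbT.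
apply: fin_bigcap_measurable => [|j _]; first exact: finite_finset.
rewrite -[X in measurable X]setTI; apply: continuous_borelV => //.
exact: coord_continuous.
Qed.

Variables (n : nat) (mu : {measure set (borelV R n) -> \bar R}).
Hypothesis schwartz_l2 : forall u : 'rV[R]_n -> R, rschwartz u -> l2 mu u.

(* [h] annihilates the Schwartz functions [G * prod_j logistic (k^2 (x_j - a_j) + k)], which
   tend to [G] times the indicator of the quadrant of corner [a]. *)
Lemma l2_unique (h : borelV R n -> R) : l2 mu h ->
  (forall u : 'rV[R]_n -> R, rschwartz u -> l2ip mu h u = 0) ->
  ae_eq mu setT h (fun=> 0).
Proof.
move=> lh h0; have [G rG G0] := gauss_rschwartz n.
have lG := schwartz_l2 rG; have IhG := l2_mul_integrable lh lG.
have mG : measurable_fun [set: borelV R n] (G : borelV R n -> R) by case: lG.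
have mh : measurable_fun [set: borelV R n] h by case: lh.
(* A product of two L^2 functions is integrable, and the positive factor [G] can be divided out at
   the end. *)
pose hG (x : borelV R n) : \bar R := (h x * G x)%:E.
have int0 (u : 'rV[R]_n -> R) : rschwartz u -> (\int[mu]_x (h x * u x)%:E = 0)%E.
  move=> ru; have := h0 u ru; rewrite /l2ip /Rintegral => h1.
  rewrite -[LHS]fineK ?h1//.
  exact: (integral_fune_fin_num measurableT (l2_mul_integrable lh (schwartz_l2 ru))).
have Q0 a : (\int[mu]_(x in quadrant a) hG x = 0)%E.
  pose W (k : nat) (x : 'rV[R]_n) :=
    \prod_(j <- index_enum 'I_n) logistic (k%:R ^+ 2 * x ord0 j + (k%:R - k%:R ^+ 2 * a ord0 j)).
  have rW k : rschwartz (fun x => W k x * G x).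
    rewrite /W; elim: (index_enum 'I_n) => [|j s ih].
      by move: rG; congr rschwartz; apply/funext => x; rewrite big_nil mul1r.
    have := rschwartz_mul (moderate_logistic j (k%:R ^+ 2) (k%:R - k%:R ^+ 2 * a ord0 j)) ih.
    by congr rschwartz; apply/funext => x; rewrite big_cons mulrA.
  have W1 k x : `|W k x| <= 1.
    rewrite /W; elim: (index_enum 'I_n) => [|j s ih]; first by rewrite big_nil normr1.
    rewrite big_cons normrM mulr_ile1// ger0_norm ?logistic_ge0//; exact: logistic_le1.
  have cW x : W k x @[k --> \oo] --> ((x \in quadrant a)%:R : R).
    have -> : ((x \in quadrant a)%:R : R) =
        \prod_(j <- index_enum 'I_n) ((0 <= x ord0 j - a ord0 j)%R%:R : R).
      have [xa|xa] := boolP (x \in quadrant a).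
        rewrite big1// => j _; rewrite subr_ge0.
        by move: xa; rewrite inE => /(_ j) ->.
      have [j xj] : exists j, ~~ (a ord0 j <= x ord0 j).
        apply/existsP; rewrite -negb_forall; apply: contra xa => /forallP xa.
        by rewrite inE => j; exact: xa.
      by rewrite (bigD1 j)//= subr_ge0 (negbTE xj) mul0r.
    pose L j (k : nat) := logistic (k%:R ^+ 2 * x ord0 j + (k%:R - k%:R ^+ 2 * a ord0 j)).
    apply: (@cvg_big R 'I_n *%R 1 xpredT (@mul_continuous R) nat \oo (index_enum 'I_n) L _ _) => j _.
    have := @logistic_step R (x ord0 j - a ord0 j); apply: cvg_trans; apply: near_eq_cvg.
    by apply: nearW => k; congr logistic; ring.
  rewrite integral_mkcond.
  have D : (\int[mu]_x (h x * (W k x * G x))%:E)%E @[k --> \oo] -->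
      (\int[mu]_x (hG \_ (quadrant a)) x)%E.
    apply: (@dominated_cvg _ _ _ mu _ measurableT _ _ (fun x => `|hG x|)%E).
    - move=> k; apply/measurable_EFinP; apply: measurable_funM => //.
      by case: (schwartz_l2 (rW k)).
    - move=> x _.
      have -> : hG \_ (quadrant a) = EFin \o (fun x => h x * ((x \in quadrant a)%:R * G x)).
        apply/funext => z; rewrite patchE /=; case: ifP => _; first by rewrite mul1r.
        by rewrite mul0r mulr0.
      apply: cvg_EFin; first exact: nearW.
      apply: cvgM; first exact: cvg_cst.
      by apply: cvgM; [exact: cW|exact: cvg_cst].
    - by [].
    - exact: integrable_abse.
    - move=> k x _; rewrite /hG /= lee_fin !normrM ler_wpM2l// ler_piMl//.
  rewrite -(cvg_lim _ D)//; apply: lim_near_cst => //.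
  by apply: nearW => k; exact: int0.
have QI : setI_closed [set quadrant a | a in [set: 'rV[R]_n]].
  move=> _ _ [a _ <-] [b _ <-]; exists (\row_j Num.max (a ord0 j) (b ord0 j)) => //.
  apply/seteqP; split=> x /=.
    by move=> ab; split=> j; have := ab j; rewrite mxE ge_max => /andP[].
  by move=> [ax bx] j; rewrite mxE ge_max ax bx.
(* Quadrants are closed under intersection and generate the Borel sets, so the vanishing of
   integrals extends to all of these. Complements use that the integral over the whole space
   vanishes too. *)
have A0 A : measurable A -> (\int[mu]_(x in A) hG x = 0)%E.
  rewrite quadrant_generate.
  apply: (dynkin_induction (quadrant_generate n) QI (P := fun A => (\int[mu]_(x in A) hG x = 0)%E)).
  - exact: int0.
  - by move=> _ [a _ <-]; exact: Q0.
  - move=> S mS S0.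
    have := @integral_setU _ _ _ mu S (~` S) hG mS (measurableC mS).
    rewrite setUv (int0 _ rG : \int[mu]_x hG x = 0)%E S0 add0e => E; apply/esym/E.
      exact: (measurable_int _ IhG).
    by apply/disj_setPS => x [].
  - move=> F mF tF F0; rewrite integral_bigcup//.
      by rewrite eseries0// => i _ _; exact: F0.
    by apply: integrableS IhG => //; exact: bigcup_measurable.
have : ae_eq mu setT hG (fun=> 0%E).
  apply: integral_ae_eq => //.
  by move=> E _ mE; rewrite A0// integral0.
apply: filterS => x /(_ I) hx _; move: hx => [] /eqP.
by rewrite mulf_eq0 (gt_eqF (G0 x)) orbF => /eqP.
Qed.

End SchwartzUniqueness.

(** * Averaged Hilbert spaces and kernels *)

Section AveragedHilbert.
Variables (R : realType) (V : lmodType R[i]) (H : hilbert_space V) (G : zmodType).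
Variables (P : G -> V -> V) (C0 : R).
Hypothesis C0_ge1 : 1 <= C0.
Hypothesis P_lin : forall z (a : R[i]) u v, P z (a *: u + v) = a *: P z u + P z v.
Hypothesis P_ub : forall z u, hnorm H (P z u) <= C0 * hnorm H u.
Hypothesis P_lb : forall z u, C0^-1 * hnorm H u <= hnorm H (P z u).
Hypothesis P_comp : forall z w u v,
  hip H (P z (P w u)) (P z (P w v)) = hip H (P (z + w) u) (P (z + w) v).

(** [P_comp] is asked of inner products only, where the phase by which shifts compose cancels. The
    mean is taken of the real and imaginary parts of [z -> (P z u, P z v)]. Its positivity carries
    the two bounds on [P] over to the averaged norm, which is thereby definite and complete. *)
Lemma averaged_hilbert : exists H' : hilbert_space V,
  (forall u, C0^-1 * hnorm H u <= hnorm H' u <= C0 * hnorm H u) /\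
  forall w u v, hip H' (P w u) (P w v) = hip H' u v.
Proof.
have C00 : 0 < C0 by exact: lt_le_trans C0_ge1.
have [M [ML Mpos M1 Minv]] := invariant_mean R G.
pose F u v z := hip H (P z u) (P z v).
pose Fr u v z := creal (F u v z); pose Fi u v z := cimag (F u v z).
pose B u v := C0 * hnorm H u * (C0 * hnorm H v).
have Fb u v z : cabs (F u v z) <= B u v.
  by apply: le_trans (hip_cauchy_schwarz _ _ _) _; apply: ler_pM; rewrite ?hnorm_ge0.
have Frb u v : bounded_by (B u v) (Fr u v).
  by move=> z; apply: le_trans (le_creal_cabs _) (Fb u v z).
have Fib u v : bounded_by (B u v) (Fi u v).
  by move=> z; apply: le_trans (le_cimag_cabs _) (Fb u v z).
(* Linearity is stated for [a * f + h] on bounded functions, so the constant [c] is written as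
   [(c - 1) * 1 + 1]. *)
have Mc c : M (fun=> c) = c.
  have b1 : bounded_by (1 : R) (fun _ : G => 1 : R) by move=> z; rewrite normr1.
  have := ML (c - 1) _ _ _ _ b1 b1; rewrite M1 mulr1 subrK => E.
  by rewrite -[RHS]E; congr M; apply/funext => z; rewrite mulr1 subrK.
have MN f A : bounded_by A f -> M (fun z => - f z) = - M f.
  move=> fA; have := ML (- 2) _ _ _ _ fA fA.
  have -> : (fun x => - 2 * f x + f x) = (fun z => - f z) by apply/funext => z; ring.
  by move=> ->; ring.
have cb (c : R) : bounded_by `|c| (fun _ : G => c) by move=> z.
have Mge f A c : bounded_by A f -> (forall z, c <= f z) -> c <= M f.
  move=> fA fc; rewrite -subr_ge0.
  have := ML 1 _ _ _ _ fA (cb (- c)); rewrite Mc mul1r => <-.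
  apply: (Mpos _ (`|c| + A)) => z; rewrite mul1r ?subr_ge0//.
  by apply: le_trans (ler_normD _ _) _; rewrite normrN addrC lerD2l.
have Mle f A c : bounded_by A f -> (forall z, f z <= c) -> M f <= c.
  move=> fA fc; rewrite -lerN2 -(MN _ _ fA); apply: (Mge _ A) => z; last by rewrite lerN2.
  by rewrite normrN.
pose ip u v : R[i] := M (Fr u v) +i* M (Fi u v).
have ipr u v : creal (ip u v) = M (Fr u v) by [].
have ipi u v : cimag (ip u v) = M (Fi u v) by [].
have Fuu u z : F u u z = (hnorm H (P z u) ^+ 2)%:C by rewrite /F hip_diag.
have ip_real u : cimag (ip u u) = 0.
  by rewrite ipi -[RHS](Mc 0); congr M; apply/funext => z; rewrite /Fi Fuu.
have ip_lb u : (C0^-1 * hnorm H u) ^+ 2 <= creal (ip u u).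
  rewrite ipr; apply: (Mge _ _ _ (Frb u u)) => z; rewrite /Fr Fuu creal_real.
  apply: lerXn2r (P_lb z u); rewrite nnegrE ?mulr_ge0 ?hnorm_ge0 ?invr_ge0//; exact: ltW.
have ip_ub u : creal (ip u u) <= (C0 * hnorm H u) ^+ 2.
  rewrite ipr; apply: (Mle _ _ _ (Frb u u)) => z; rewrite /Fr Fuu creal_real.
  apply: lerXn2r (P_ub z u); rewrite nnegrE ?mulr_ge0 ?hnorm_ge0//; exact: ltW.
have ip_lin (a : R[i]) u v w : ip (a *: u + v) w = a * ip u w + ip v w.
  have E z : F (a *: u + v) w z = a * F u w z + F v w z.
    by rewrite /F P_lin hipDl hipZl.
  have b (c : R) (f g : G -> R) (A A' : R) : bounded_by A f -> bounded_by A' g ->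
      bounded_by (`|c| * A + A') (fun z => c * f z + g z).
    move=> fA gA z; apply: le_trans (ler_normD _ _) _; rewrite normrM lerD//.
    by rewrite ler_wpM2l.
  apply: complex_ext; rewrite !cE !(ipr, ipi).
    have -> : Fr (a *: u + v) w =
        fun z => creal a * Fr u w z + (- cimag a * Fi u w z + Fr v w z).
      by apply/funext => z; rewrite /Fr /Fi E !cE; ring.
    rewrite (ML _ _ _ _ _ (Frb u w) (b _ _ _ _ _ (Fib u w) (Frb v w))).
    by rewrite (ML _ _ _ _ _ (Fib u w) (Frb v w)); ring.
  have -> : Fi (a *: u + v) w =
      fun z => creal a * Fi u w z + (cimag a * Fr u w z + Fi v w z).
    by apply/funext => z; rewrite /Fr /Fi E !cE; ring.
  rewrite (ML _ _ _ _ _ (Fib u w) (b _ _ _ _ _ (Frb u w) (Fib v w))).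
  by rewrite (ML _ _ _ _ _ (Frb u w) (Fib v w)); ring.
have ip_conj u v : ip v u = cconj (ip u v).
  apply: complex_ext; rewrite !cE !(ipr, ipi).
    by congr M; apply/funext => z; rewrite /Fr /F hip_conj.
  rewrite -(MN _ _ (Fib u v)); congr M; apply/funext => z.
  by rewrite /Fi /F hip_conj.
have ip_pos u : cimag (ip u u) = 0 /\ 0 <= creal (ip u u).
  by split=> //; apply: le_trans (ip_lb u); rewrite sqr_ge0.
have lbN u : C0^-1 * hnorm H u <= Num.sqrt (creal (ip u u)).
  rewrite -[leLHS]ger0_norm ?mulr_ge0 ?hnorm_ge0 ?invr_ge0 ?(ltW C00)// -sqrtr_sqr.
  exact: ler_wsqrtr (ip_lb u).
have ubN u : Num.sqrt (creal (ip u u)) <= C0 * hnorm H u.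
  rewrite -[leRHS]ger0_norm ?mulr_ge0 ?hnorm_ge0 ?(ltW C00)// -sqrtr_sqr.
  exact: ler_wsqrtr (ip_ub u).
have ip_def u : ip u u = 0 -> u = 0.
  move=> u0; apply: (@hnorm_eq0 _ _ H); apply/eqP; rewrite eq_le hnorm_ge0 andbT.
  have := lbN u; rewrite u0 /creal /= sqrtr0 pmulr_rle0 ?invr_gt0//.
have ip_complete (s : nat -> V) :
  (forall e : R, 0 < e -> exists N : nat, forall m n : nat, (N <= m)%N -> (N <= n)%N ->
        Num.sqrt (creal (ip (s m - s n) (s m - s n))) < e) ->
    exists l : V, forall e : R, 0 < e -> exists N : nat, forall n : nat, (N <= n)%N ->
        Num.sqrt (creal (ip (s n - l) (s n - l))) < e.
  move=> cs; have [e e0|l lP] := @hip_complete _ _ H s.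
    have e1 : 0 < C0^-1 * e by rewrite mulr_gt0 ?invr_gt0.
    have [N NP] := cs _ e1.
    exists N => m n Nm Nn; have := le_lt_trans (lbN _) (NP m n Nm Nn).
    by rewrite ltr_pM2l ?invr_gt0.
  exists l => e e0; have [N NP] := lP (e / C0) (divr_gt0 e0 C00).
  exists N => n Nn; apply: le_lt_trans (ubN _) _.
  by rewrite mulrC -ltr_pdivlMr//; exact: NP.
exists (HilbertSpace ip_lin ip_conj ip_pos ip_def ip_complete); split=> [u|w u v].
  by rewrite /hnorm /= lbN ubN.
have E z : F (P w u) (P w v) z = F u v (z + w) by rewrite /F P_comp.
suff: ip (P w u) (P w v) = ip u v by [].
apply: complex_ext; rewrite !(ipr, ipi).
  rewrite -[RHS](Minv _ _ w (Frb u v)); congr M; apply/funext => z.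
  by rewrite /Fr E.
rewrite -[RHS](Minv _ _ w (Fib u v)); congr M; apply/funext => z.
by rewrite /Fi E.
Qed.

End AveragedHilbert.

(** * Complex Schwartz functions and time-frequency shifts *)

Section ComplexSchwartz.
Variables (R : realType) (n : nat).
Local Notation T := 'rV[R]_n.
Implicit Types (phi psi : T -> R[i]) (u v : T -> R) (x xi : T).

Lemma schwartzP phi : schwartz phi <->
  rschwartz (fun x => creal (phi x)) /\ rschwartz (fun x => cimag (phi x)).
Proof.
split=> [[s1 [s2 b]]|[[s1 b1] [s2 b2]]].
  split; split=> // js k; have [M MP] := b js k; exists M => x; apply: le_trans (MP x).
    by apply: ler_wpM2l; [rewrite exprn_ge0|exact: (le_creal_cabs (dpartC js phi x))].
  by apply: ler_wpM2l; [rewrite exprn_ge0|exact: (le_cimag_cabs (dpartC js phi x))].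
split=> //; split=> // js k; have [M1 P1] := b1 js k; have [M2 P2] := b2 js k.
exists (M1 + M2) => x; apply: le_trans (lerD (P1 x) (P2 x)); rewrite -mulrDr.
by apply: ler_wpM2l; [rewrite exprn_ge0|exact: (cabs_le_add (dpartC js phi x))].
Qed.

Lemma schwartz_lin (a : R[i]) phi psi : schwartz phi -> schwartz psi ->
  schwartz (fun x => a * phi x + psi x).
Proof.
move=> /schwartzP[f1 f2] /schwartzP[p1 p2]; apply/schwartzP; split.
  have := rschwartz_lin (creal a) f1 (rschwartz_lin (- cimag a) f2 p1).
  by congr rschwartz; apply/funext => x; rewrite !cE; ring.
have := rschwartz_lin (creal a) f2 (rschwartz_lin (cimag a) f1 p2).
by congr rschwartz; apply/funext => x; rewrite !cE; ring.
Qed.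

Lemma rschwartz0 : rschwartz (fun _ : T => 0 : R).
Proof.
have d0 js : dpart js (fun _ : T => 0 : R) = fun=> 0.
  elim: js => [//|j js ih]; rewrite dpart_cons ih; apply/funext => x.
  exact: derive_cst.
split=> [js|js k]; rewrite d0; last by exists 0 => x; rewrite normr0 mulr0.
by split=> [x|j x]; [exact: cst_continuous|exact: derivable_cst].
Qed.

Lemma schwartz_real u : rschwartz u -> schwartz (fun x => (u x)%:C).
Proof. by move=> ru; apply/schwartzP; split=> //; exact: rschwartz0. Qed.

Lemma schwartz_mul phi (m1 m2 : T -> R) : moderate m1 -> moderate m2 -> schwartz phi ->
  schwartz (fun x => (m1 x +i* m2 x) * phi x).
Proof.
move=> mm1 mm2 /schwartzP[f1 f2]; apply/schwartzP; split.
  have := rschwartzB (rschwartz_mul mm1 f1) (rschwartz_mul mm2 f2).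
  by congr rschwartz; apply/funext => x; rewrite !cE.
have := rschwartzD (rschwartz_mul mm1 f2) (rschwartz_mul mm2 f1).
by congr rschwartz; apply/funext => x; rewrite !cE.
Qed.

Definition tfshift x xi phi : T -> R[i] := fun z => cexpi (dotR (z + x) xi) * phi (z + x).

Lemma schwartz_tfshift x xi phi : schwartz phi -> schwartz (tfshift x xi phi).
Proof.
move=> sf; have /schwartzP[s1 s2] := schwartz_mul (moderate_cos xi) (moderate_sin xi) sf.
by apply/schwartzP; split; [exact: (rschwartz_shift x s1)|exact: (rschwartz_shift x s2)].
Qed.

Lemma dotRDl x y xi : dotR (x + y) xi = dotR x xi + dotR y xi.
Proof. by rewrite /dotR -big_split; apply: eq_bigr => i _ /=; rewrite mxE mulrDl. Qed.

Lemma dotRDr x xi eta : dotR x (xi + eta) = dotR x xi + dotR x eta.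
Proof. by rewrite /dotR -big_split; apply: eq_bigr => i _ /=; rewrite mxE mulrDr. Qed.

Lemma dotR0 x : dotR x 0 = 0.
Proof. by rewrite /dotR big1// => i _; rewrite mxE mulr0. Qed.

Lemma dotR_unitv x (t : R) j : dotR x (t *: unitv R j) = t * x ord0 j.
Proof.
rewrite /dotR (bigD1 j)//= big1 => [|i ij]; last by rewrite !mxE eqxx (negbTE ij) !mulr0.
by rewrite !mxE !eqxx mulr1 addr0 mulrC.
Qed.

(** The phase is the cocycle that keeps time-frequency shifts from being a representation of R^d x
    R^d. *)
Lemma tfshift_comp x xi y eta phi :
  tfshift y eta (tfshift x xi phi) = fun z => cexpi (- dotR x eta) * tfshift (x + y) (xi + eta) phi z.
Proof.
apply/funext => z; rewrite /tfshift !mulrA -!cexpiD -(addrA z) (addrC y) !dotRDr !dotRDl.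
by congr (cexpi _ * _); ring.
Qed.

Definition cseminorm_le N (M : R) phi := forall js x, (size js <= N)%N ->
  (1 + `|x|) ^+ N * cabs (dpartC js phi x) <= M.

Lemma cseminorm_real N (M : R) u : seminorm_le N M u -> cseminorm_le N M (fun x => (u x)%:C).
Proof.
move=> uM js x jsN; have := uM js x jsN; congr (_ * _ <= _); rewrite /dpartC.
have -> : dpart js (fun y => cimag (u y)%:C) x = 0.
  suff -> : dpart js (fun y => cimag (u y)%:C) = fun=> 0 by [].
  elim: js {jsN} => [//|j js ih]; rewrite dpart_cons ih; apply/funext => z.
  exact: derive_cst.
by rewrite -cabs_real.
Qed.

Lemma cseminorm_scale N (M a : R) phi : schwartz phi -> cseminorm_le N M phi ->
  cseminorm_le N (`|a| * M) (fun x => a%:C * phi x).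
Proof.
move=> [s1 [s2 _]] fM js x jsN.
have dZ u : smoothR u -> dpart js (fun x => a * u x) x = a * dpart js u x.
  move=> su; have E := dpart_lin js (a - 1) su su.
  have -> : (fun x => a * u x) = (fun x => (a - 1) * u x + u x) by apply/funext => y; ring.
  by rewrite E; ring.
have -> : dpartC js (fun x => a%:C * phi x) x = a%:C * dpartC js phi x.
  apply: complex_ext; rewrite (crealM, cimagM) creal_real cimag_real mul0r (subr0, addr0).
    apply: etrans (dZ _ s1); congr (dpart js _ x); apply/funext => y.
    by rewrite !cE mul0r subr0.
  apply: etrans (dZ _ s2); congr (dpart js _ x); apply/funext => y.
  by rewrite !cE mul0r addr0.
by rewrite cabsM cabs_real mulrCA ler_wpM2l//; exact: fM.
Qed.

Lemma cseminorm_mono N N' (M : R) phi : (N <= N')%N -> cseminorm_le N' M phi -> cseminorm_le N M phi.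
Proof.
move=> NN fM js x jsN; apply: le_trans (fM js x (leq_trans jsN NN)).
by apply: ler_wpM2r; [exact: cabs_ge0|apply: ler_weXn2l => //; exact: ge1_1Dnorm].
Qed.

End ComplexSchwartz.

Section TempFreqShifts.
Variables (R : realType) (d : nat) (V : lmodType R[i]) (iota : V -> distr R d).
Hypothesis iota_temp : forall v, tempered (iota v).
Hypothesis iota_lin : forall (a : R[i]) (v w : V),
  deq (iota (a *: v + w)) (fun phi => a * iota v phi + iota w phi).
Hypothesis iota_inj : forall v w : V, deq (iota v) (iota w) -> v = w.
Variable P : 'rV[R]_d * 'rV[R]_d -> V -> V.
Hypothesis PE : forall z v, deq (iota (P z v)) (modtrans z.1 z.2 (iota v)).

Lemma iota0 phi : schwartz phi -> iota 0 phi = 0.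
Proof.
move=> sf; have := iota_lin (-1) 0 0 sf.
by rewrite scaler0 addr0 mulN1r addNr.
Qed.

Lemma iotaZ (a : R[i]) v phi : schwartz phi -> iota (a *: v) phi = a * iota v phi.
Proof. by move=> sf; rewrite -[_ *: _]addr0 iota_lin// iota0// addr0. Qed.

Lemma iota_test_scale v (a : R[i]) phi : schwartz phi ->
  iota v (fun x => a * phi x) = a * iota v phi.
Proof.
move=> sf; have [lv _] := iota_temp v; have := lv (a - 1) phi phi sf sf.
have -> : (fun x => (a - 1) * phi x + phi x) = (fun x => a * phi x).
  by apply/funext => x; rewrite mulrBl mul1r subrK.
by rewrite mulrBl mul1r subrK.
Qed.

Lemma shiftE z v phi : schwartz phi -> iota (P z v) phi = iota v (tfshift z.1 z.2 phi).
Proof. exact: PE. Qed.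

(** [P] is only known through the distributions of its values; its algebra is read off on test
    functions and transferred back by the injectivity of [iota]. *)
Lemma shift_lin z (a : R[i]) u v : P z (a *: u + v) = a *: P z u + P z v.
Proof.
apply: iota_inj => phi sf; rewrite iota_lin// !shiftE//.
by rewrite iota_lin//; exact: schwartz_tfshift.
Qed.

Lemma shift_comp z w u : P z (P w u) = cexpi (- dotR z.1 w.2) *: P (z + w) u.
Proof.
apply: iota_inj => phi sf; rewrite iotaZ// !shiftE//; last exact: schwartz_tfshift.
by rewrite tfshift_comp iota_test_scale//; exact: schwartz_tfshift.
Qed.

Lemma shift0 u : P 0 u = u.
Proof.
apply: iota_inj => phi sf; rewrite shiftE//; congr (iota u _); apply/funext => z.
by rewrite /tfshift /= addr0 dotR0 cexpi0 mul1r.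
Qed.

Lemma shift_surj z w : exists v, P z v = w.
Proof.
pose c := cexpi (- dotR z.1 (- z).2).
have PZ v (a : R[i]) : P z (a *: v) = a *: P z v.
  have P00 : P z 0 = 0 by have := shift_lin z (-1) 0 0; rewrite scaler0 addr0 scaleN1r addNr.
  by rewrite -[_ *: v]addr0 shift_lin P00 addr0.
(* The inverse of [P z] is [P (- z)] corrected by the phase of their composition. *)
exists (cexpi (dotR z.1 (- z).2) *: P (- z) w).
rewrite PZ shift_comp subrr shift0 scalerA mulrC.
by rewrite cexpiNr scale1r.
Qed.

End TempFreqShifts.

Section ReproducingKernels.
Variables (R : realType) (d : nat) (V : lmodType R[i]) (H : hilbert_space V).
Variable iota : V -> distr R d.
Hypothesis iota_temp : forall v, tempered (iota v).
Hypothesis iota_lin : forall (a : R[i]) (v w : V),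
  deq (iota (a *: v + w)) (fun phi => a * iota v phi + iota w phi).
Hypothesis iota_cont : forall phi, schwartz phi ->
  exists A : R, forall v, cabs (iota v phi) <= A * hnorm H v.

Lemma kernel_exists : exists k : ('rV[R]_d -> R[i]) -> V,
  forall phi v, schwartz phi -> hip H v (k phi) = iota v phi.
Proof.
have h phi : exists w, schwartz phi -> forall v, hip H v w = iota v phi.
  (* Functions outside the Schwartz class get the default kernel 0. *)
  have [sf|nsf] := pselect (schwartz phi); last by exists 0.
  have [A AP] := iota_cont sf.
  have [w wP] := riesz (fun a u v => iota_lin a u v sf) AP.
  by exists w.
have [k kP] := choice h.
by exists k => phi v sf; exact: kP.
Qed.

Variable k : ('rV[R]_d -> R[i]) -> V.
Hypothesis kP : forall phi v, schwartz phi -> hip H v (k phi) = iota v phi.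

Lemma hip_inj u w : (forall v, hip H v u = hip H v w) -> u = w.
Proof.
move=> E; apply/eqP; rewrite -subr_eq0; apply/eqP.
by apply: (@hip_def _ _ H); rewrite hipBr E subrr.
Qed.

Lemma kernel_lin (a : R[i]) phi psi : schwartz phi -> schwartz psi ->
  k (fun x => a * phi x + psi x) = cconj a *: k phi + k psi.
Proof.
move=> sf sp; apply: hip_inj => v; rewrite hipDr hipZr cconjK !kP//.
  by have [-> //] := iota_temp v.
exact: schwartz_lin.
Qed.

Lemma kernel_scale (a : R[i]) phi : schwartz phi -> k (fun x => a * phi x) = cconj a *: k phi.
Proof.
move=> sf; apply: hip_inj => v; have sa : schwartz (fun x => a * phi x).
  have := schwartz_lin (a - 1) sf sf; congr schwartz.
  by apply/funext => x; rewrite mulrBl mul1r subrK.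
by rewrite hipZr cconjK !kP//; exact: iota_test_scale.
Qed.

(* Were the kernels unbounded on every unit ball of every seminorm, a sequence of them growing
   like [4^n] would contradict the temperedness of a single distribution. *)
Lemma kernel_bound : exists (N : nat) (B : R), 0 <= B /\
  forall phi M, schwartz phi -> cseminorm_le N M phi -> hnorm H (k phi) <= B * M.
Proof.
have [N NP] : exists N : nat, forall phi, schwartz phi -> cseminorm_le N 1 phi ->
    hnorm H (k phi) <= 4 ^+ N.
  apply: contrapT => /forallNP nb.
  have /choice[f fP] : forall N : nat, exists phi,
      [/\ schwartz phi, cseminorm_le N 1 phi & 4 ^+ N <= hnorm H (k phi)].
    move=> N; have := nb N => /existsNP[phi /not_implyP[sf /not_implyP[f1 /negP]]].
    by rewrite -ltNge => /ltW kf; exists phi.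
  apply: (@gliding_hump _ _ H (k \o f)) => [v|N]; last by have [] := fP N.
  have [_ [N [K KP]]] := iota_temp v.
  exists (K * 1), N => n Nn; have [sf f1 _] := fP n.
  rewrite /= kP//; apply: KP => //; exact: (cseminorm_mono Nn f1).
exists N, (4 ^+ N); split=> [|phi M sf fM]; first exact: exprn_ge0.
have M0 : 0 <= M.
  by apply: le_trans (fM [::] 0 _) => //; rewrite mulr_ge0 ?cabs_ge0// exprn_ge0.
apply/ler_addgt0Pr => e e0.
have B0 : 0 < (4 : R) ^+ N by exact: exprn_gt0.
(* [M] may be 0, so [phi] is divided by the slightly larger positive number [r]; the slack returns
   in [4^N r = 4^N M + e]. *)
pose r := M + e / 4 ^+ N; have r0 : 0 < r by rewrite ltr_wpDl// divr_gt0.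
have sr : schwartz (fun x => (r^-1)%:C * phi x).
  have := schwartz_lin ((r^-1)%:C - 1) sf sf; congr schwartz.
  by apply/funext => x; rewrite mulrBl mul1r subrK.
have fr : cseminorm_le N 1 (fun x => (r^-1)%:C * phi x).
  move=> js x jsN; apply: le_trans (cseminorm_scale r^-1 sf fM x jsN) _.
  by rewrite ger0_norm ?invr_ge0 ?(ltW r0)// mulrC ler_pdivrMr// mul1r lerDl divr_ge0// ltW.
have := NP _ sr fr; rewrite kernel_scale// hnormZ cabs_conj cabs_real.
rewrite ger0_norm ?invr_ge0 ?(ltW r0)// mulrC ler_pdivrMr// => h.
apply: le_trans h _; rewrite /r mulrDr.
by rewrite (mulrC _ (e / _)) divfK// gt_eqF.
Qed.

Hypothesis iota_inj : forall v w : V, deq (iota v) (iota w) -> v = w.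
Variable P : 'rV[R]_d * 'rV[R]_d -> V -> V.
Hypothesis PE : forall z v, deq (iota (P z v)) (modtrans z.1 z.2 (iota v)).
Hypothesis P_isom : forall z u v, hip H (P z u) (P z v) = hip H u v.

(** With [k'] the kernel of the shifted function, [(P v, P k') = (v, k') = <v, tfshift phi> = <P v,
    phi>], and every vector is some [P v] by [shift_surj]. *)
Lemma kernel_tfshift x xi phi : schwartz phi -> P (x, xi) (k (tfshift x xi phi)) = k phi.
Proof.
move=> sf; apply: hip_inj => w.
have [v <-] := shift_surj iota_temp iota_lin iota_inj PE (x, xi) w.
rewrite P_isom !kP//; last exact: schwartz_tfshift.
by rewrite (shiftE PE).
Qed.

Lemma kernel_invariant x xi phi psi : schwartz phi -> schwartz psi ->
  hip H (k (tfshift x xi phi)) (k (tfshift x xi psi)) = hip H (k phi) (k psi).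
Proof. by move=> sf sp; rewrite -(P_isom (x, xi)) !kernel_tfshift. Qed.

End ReproducingKernels.

Section KernelForms.
Variables (R : realType) (d : nat) (V : lmodType R[i]) (H : hilbert_space V).
Variable k : ('rV[R]_d -> R[i]) -> V.
Hypothesis k_lin : forall (a : R[i]) phi psi, schwartz phi -> schwartz psi ->
  k (fun x => a * phi x + psi x) = cconj a *: k phi + k psi.
Hypothesis k_bound : exists (N : nat) (B : R), 0 <= B /\
  forall phi M, schwartz phi -> cseminorm_le N M phi -> hnorm H (k phi) <= B * M.
Hypothesis k_inv : forall x xi phi psi, schwartz phi -> schwartz psi ->
  hip H (k (tfshift x xi phi)) (k (tfshift x xi psi)) = hip H (k phi) (k psi).
Implicit Types u v : 'rV[R]_d -> R.

Definition complexify u : 'rV[R]_d -> R[i] := fun x => (u x)%:C.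

Lemma complexify_lin (a : R) u v :
  complexify (fun x => a * u x + v x) = fun x => a%:C * complexify u x + complexify v x.
Proof. by apply/funext => x; apply: complex_ext; rewrite !cE; ring. Qed.

Lemma cconj_real (a : R) : cconj a%:C = a%:C.
Proof. by apply: complex_ext; rewrite !cE ?oppr0. Qed.

Let ku u := k (complexify u).

Lemma kernel_real_lin (a : R) u v : rschwartz u -> rschwartz v ->
  ku (fun x => a * u x + v x) = a%:C *: ku u + ku v.
Proof.
move=> ru rv; rewrite /ku complexify_lin k_lin ?cconj_real//; exact: schwartz_real.
Qed.

(** Compare invariance under the frequencies [t] and [- t]: the cos-cos and sin-sin terms agree,
    while the mixed ones occur with opposite signs and must therefore cancel each other. *)
Lemma kernel_real_mod j (t : R) u v : rschwartz u -> rschwartz v ->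
  hip H (ku (fun x => cos (t * x ord0 j) * u x)) (ku (fun x => sin (t * x ord0 j) * v x)) =
  hip H (ku (fun x => sin (t * x ord0 j) * u x)) (ku (fun x => cos (t * x ord0 j) * v x)).
Proof.
have rc w : rschwartz w -> schwartz (complexify (fun x => cos (t * x ord0 j) * w x)).
  move=> rw; apply: schwartz_real.
  have := rschwartz_mul (moderate_cos (t *: unitv R j)) rw; congr rschwartz.
  by apply/funext => x; rewrite dotR_unitv.
have rs w : rschwartz w -> schwartz (complexify (fun x => sin (t * x ord0 j) * w x)).
  move=> rw; apply: schwartz_real.
  have := rschwartz_mul (moderate_sin (t *: unitv R j)) rw; congr rschwartz.
  by apply/funext => x; rewrite dotR_unitv.
have kE (s : R) w : rschwartz w -> s ^+ 2 = 1 ->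
    k (tfshift 0 ((s * t) *: unitv R j) (complexify w)) =
    (0 -i* s) *: ku (fun x => sin (t * x ord0 j) * w x) + ku (fun x => cos (t * x ord0 j) * w x).
  move=> rw s2; rewrite /ku.
  have <- : cconj (0 +i* s) = 0 -i* s by [].
  rewrite -k_lin; [|exact: rs|exact: rc].
  congr k; apply/funext => z; rewrite /tfshift addr0 dotR_unitv -mulrA.
  have [->|->] : s = 1 \/ s = -1.
    by move/eqP: s2; rewrite sqrf_eq1 => /orP[] /eqP; [left|right].
    by rewrite mul1r; apply: complex_ext; rewrite !cE /creal /cimag /=; ring.
  by rewrite mulN1r; apply: complex_ext; rewrite !cE /creal /cimag /= ?cosN ?sinN; ring.
move=> ru rv.
have E (s : R) : s ^+ 2 = 1 -> _ := fun s2 => k_inv 0 ((s * t) *: unitv R j) (schwartz_real ru) (schwartz_real rv).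
have E1 := E 1 (expr1n _ _); have E2 := E (-1) (etrans (sqrrN 1) (expr1n _ _)).
move: E1 E2; rewrite !kE ?sqrrN ?expr1n//.
set su := ku (fun x => sin _ * u x); set cu := ku (fun x => cos _ * u x).
set sv := ku (fun x => sin _ * v x); set cv := ku (fun x => cos _ * v x).
rewrite !(hipDl, hipDr, hipZl, hipZr) => <-.
set A := hip H su sv; set X := hip H su cv; set Y := hip H cu sv; set D := hip H cu cv => E2.
have Er := congr1 (@creal R) E2; have Ei := congr1 (@cimag R) E2.
by apply: complex_ext; move: Er Ei; rewrite !cE /creal /cimag /=; lra.
Qed.

Lemma schwartz_form_kernel (p : R[i] -> R) :
  (forall (a : R) z w, p (a%:C * z + w) = a * p z + p w) -> (forall z, `|p z| <= cabs z) ->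
  schwartz_form (fun u v => p (hip H (ku u) (ku v))).
Proof.
move=> p_lin p_le; split.
- by move=> a u u' v ru ru' rv; rewrite kernel_real_lin// hipDl hipZl p_lin.
- by move=> a u v v' ru rv rv'; rewrite kernel_real_lin// hipDr hipZr cconj_real p_lin.
- have [N [B [B0 BP]]] := k_bound; exists N, (B ^+ 2); split=> [|u v M M' ru rv uM vM].
    exact: exprn_ge0.
  apply: le_trans (p_le _) _; apply: le_trans (hip_cauchy_schwarz _ _ _) _.
  have -> : B ^+ 2 * (M * M') = (B * M) * (B * M') by ring.
  by apply: ler_pM; rewrite ?hnorm_ge0//; apply: BP; [exact: schwartz_real|exact: cseminorm_real|exact: schwartz_real|exact: cseminorm_real].
- move=> x u v ru rv; congr p; rewrite -(k_inv x 0 (schwartz_real ru) (schwartz_real rv)).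
  have E w : complexify (fun z => w (z + x)) = tfshift x 0 (complexify w).
    by apply/funext => z; rewrite /tfshift dotR0 cexpi0 mul1r.
  by rewrite /ku !E.
- by move=> j t u v ru rv; congr p; exact: kernel_real_mod.
Qed.

End KernelForms.

(** * Representation in L2 *)

Section L2Limits.
Context (d : measure_display) (T : measurableType d) (R : realType).
Variable mu : {measure set T -> \bar R}.

Lemma l2ip_cvg (f : nat -> T -> R) (g h : T -> R) :
  (forall n, l2 mu (f n)) -> l2 mu g -> l2 mu h ->
  l2ip mu (fun x => f n x - g x) (fun x => f n x - g x) @[n --> \oo] --> (0 : R) ->
  l2ip mu (f n) h @[n --> \oo] --> l2ip mu g h.
Proof.
move=> lf lg lh fg; apply/cvgrPdist_le => e e0.
(* With this [t], Young's inequality bounds twice the error by [e] from the term in [f n - g] plus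
   [e] from the term in [h]. *)
have h0 := l2ip_ge0 mu h; pose t := (l2ip mu h h + 1) / e.
have t0 : 0 < t by rewrite divr_gt0// ltr_wpDl.
move/cvgrPdist_le: fg => /(_ _ (divr_gt0 e0 t0)); apply: filterS => n.
rewrite sub0r normrN ger0_norm ?l2ip_ge0// ler_pdivlMr// mulrC => tf.
have lfg := l2B (lf n) lg; have := l2ip_young t0 lfg lh.
have -> : l2ip mu (fun x => f n x - g x) h = l2ip mu (f n) h - l2ip mu g h.
  have := l2ip_linl (-1) lg (lf n) lh; rewrite mulN1r addrC => <-.
  by congr l2ip; apply/funext => x; ring.
rewrite normrM (ger0_norm (ler0n _ _)) distrC => h1.
have h2 : t^-1 * l2ip mu h h <= e.
  rewrite /t invf_div mulrAC ler_pdivrMr ?ltr_wpDl// ler_wpM2l ?lerDl// ltW//.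
by move: h1 h2 tf; set a := t * _; set b := t^-1 * _; lra.
Qed.

Lemma l2ip_cvg_sqr (f : nat -> T -> R) (g : T -> R) :
  (forall n, l2 mu (f n)) -> l2 mu g ->
  l2ip mu (fun x => f n x - g x) (fun x => f n x - g x) @[n --> \oo] --> (0 : R) ->
  l2ip mu (f n) (f n) @[n --> \oo] --> l2ip mu g g.
Proof.
move=> lf lg fg; have c1 := l2ip_cvg lf lg lg fg.
have -> : (fun n => l2ip mu (f n) (f n)) =
    (fun n => l2ip mu (fun x => f n x - g x) (fun x => f n x - g x) + 2 * l2ip mu (f n) g - l2ip mu g g).
  apply/funext => n; have E : (fun x => f n x - g x) = (fun x => -1 * g x + f n x).
    by apply/funext => x; ring.
  have lx := l2_lin (-1) lg (lf n).
  rewrite E l2ip_linl// !l2ip_linr// (l2ipC mu g (f n)); ring.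
have c2 : 2 * l2ip mu (f n) g @[n --> \oo] --> 2 * l2ip mu g g.
  by apply: cvgM => //; exact: cvg_cst.
have := cvgB (cvgD fg c2) (@cvg_cst _ (l2ip mu g g) _ \oo _).
have -> : 0 + 2 * l2ip mu g g - l2ip mu g g = l2ip mu g g by ring.
exact.
Qed.

End L2Limits.

Section HilbertLimits.
Variables (R : realType) (V : lmodType R[i]) (H : hilbert_space V).

Lemma hip_cvg (s : nat -> V) (w u : V) : hcvg H s w ->
  creal (hip H (s n) u) @[n --> \oo] --> creal (hip H w u) /\
  cimag (hip H (s n) u) @[n --> \oo] --> cimag (hip H w u).
Proof.
move=> sw; suff key (p : R[i] -> R) : (forall z z', p (z - z') = p z - p z') ->
    (forall z, `|p z| <= cabs z) -> p (hip H (s n) u) @[n --> \oo] --> p (hip H w u).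
  split; apply: key => *; rewrite ?crealB ?cimagB//.
    exact: le_creal_cabs.
  exact: le_cimag_cabs.
move=> pB p_le; apply/cvgrPdist_le => e e0.
have u0 : 0 < hnorm H u + 1 by rewrite ltr_wpDl// hnorm_ge0.
have [N NP] := sw _ (divr_gt0 e0 u0); exists N => // n /= Nn.
rewrite -pB -hipBl; apply: le_trans (p_le _) _; apply: le_trans (hip_cauchy_schwarz _ _ _) _.
rewrite hnormB; have := NP n Nn; rewrite ltr_pdivlMr// => /ltW; apply: le_trans.
by apply: ler_wpM2l; rewrite ?hnorm_ge0 ?lerDl.
Qed.

Lemma hnorm_cvg (s : nat -> V) (w : V) : hcvg H s w ->
  hnorm H (s n) ^+ 2 @[n --> \oo] --> hnorm H w ^+ 2.
Proof.
move=> sw; have c : hnorm H (s n) @[n --> \oo] --> hnorm H w.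
  apply/cvgrPdist_le => e e0; have [N NP] := sw _ e0; exists N => // n /= Nn.
  apply: le_trans (ltW (NP n Nn)).
  have := hnorm_distm H (s n) w 0; have := hnorm_distm H w (s n) 0.
  by rewrite !subr0 (hnormB _ w) ler_norml => h1 h2; apply/andP; split; lra.
exact: (cvgM c c).
Qed.

End HilbertLimits.

Section ComplexL2.
Context (dd : measure_display) (T : measurableType dd) (R : realType).
Variable mu : {measure set T -> \bar R}.
Implicit Types g h : T -> R[i].

Local Notation re g := (fun x => creal (g x)).
Local Notation im g := (fun x => cimag (g x)).

Definition cl2 g := l2 mu (re g) /\ l2 mu (im g).

(* [int g h] without conjugation: the value at [h] of the distribution [g]. *)
Definition cpair g h : R[i] :=
  (l2ip mu (re g) (re h) - l2ip mu (im g) (im h)) +i* (l2ip mu (re g) (im h) + l2ip mu (im g) (re h)).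

Definition csqnorm g : R := l2ip mu (re g) (re g) + l2ip mu (im g) (im g).

Lemma cpair_linr (a : R[i]) g h h' : cl2 g -> cl2 h -> cl2 h' ->
  cpair g (fun x => a * h x + h' x) = a * cpair g h + cpair g h'.
Proof.
move=> [g1 g2] [h1 h2] [k1 k2].
have Er : (fun x => creal (a * h x + h' x)) =
    (fun x => creal a * creal (h x) + (- cimag a * cimag (h x) + creal (h' x))).
  by apply/funext => x; rewrite !cE; ring.
have Ei : (fun x => cimag (a * h x + h' x)) =
    (fun x => creal a * cimag (h x) + (cimag a * creal (h x) + cimag (h' x))).
  by apply/funext => x; rewrite !cE; ring.
have l1 := l2_lin (- cimag a) h2 k1; have l2_ := l2_lin (cimag a) h1 k2.
rewrite /cpair Er Ei !l2ip_linr//; apply: complex_ext; rewrite !cE /creal /cimag /=; ring.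
Qed.

Lemma cpair_young (c : R) g h : 0 < c -> cl2 g -> cl2 h ->
  `|2 * creal (cpair g h)| <= c * csqnorm h + c^-1 * csqnorm g.
Proof.
move=> c0 [g1 g2] [h1 h2]; have y1 := l2ip_young c0 h1 g1; have y2 := l2ip_young c0 h2 g2.
rewrite (l2ipC mu _ (re g)) in y1; rewrite (l2ipC mu _ (im g)) in y2.
rewrite -[creal _]/(l2ip mu (re g) (re h) - l2ip mu (im g) (im h)) /csqnorm mulrBr !mulrDr.
apply: le_trans (ler_normB _ _) _.
apply: le_trans (lerD y1 y2) _; rewrite le_eqVlt; apply/orP; left; apply/eqP; ring.
Qed.

Lemma cpair_eq0 g h : cl2 g -> cl2 h -> csqnorm h = 0 -> cpair g h = 0.
Proof.
move=> lg lh h0.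
have key a b : l2 mu a -> l2 mu b -> l2ip mu b b = 0 -> l2ip mu a b = 0.
  move=> la lb b0; apply/eqP; rewrite -normr_le0; apply/ler_addgt0Pr => e e0.
  have a0 := l2ip_ge0 mu a; have t0 : 0 < e / (l2ip mu a a + 1) by rewrite divr_gt0// ltr_wpDl.
  have := l2ip_young t0 la lb; rewrite b0 mulr0 addr0 normrM (ger0_norm (ler0n _ _)) add0r => h1.
  have h2 : e / (l2ip mu a a + 1) * l2ip mu a a <= e.
    by rewrite mulrAC ler_pdivrMr ?ltr_wpDl// ler_wpM2l ?lerDl// ltW.
  by have := normr_ge0 (l2ip mu a b); move: h1 h2; set q := e / _ * _; lra.
have [g1 g2] := lg; have [h1 h2] := lh.
have p1 := l2ip_ge0 mu (re h); have p2 := l2ip_ge0 mu (im h).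
have q1 : l2ip mu (re h) (re h) = 0 by move: h0; rewrite /csqnorm; lra.
have q2 : l2ip mu (im h) (im h) = 0 by move: h0; rewrite /csqnorm; lra.
by rewrite /cpair (key _ _ g1 h1 q1) (key _ _ g2 h2 q2) (key _ _ g1 h2 q2) (key _ _ g2 h1 q1) subr0 addr0.
Qed.

Lemma cl2_complete (f : nat -> T -> R[i]) : (forall n, cl2 (f n)) ->
  (forall e : R, 0 < e -> exists N, forall m n, (N <= m)%N -> (N <= n)%N ->
    csqnorm (fun x => f m x - f n x) < e) ->
  exists2 g, cl2 g &
    l2ip mu (fun x => creal (f n x) - creal (g x)) (fun x => creal (f n x) - creal (g x))
      @[n --> \oo] --> (0 : R) /\
    l2ip mu (fun x => cimag (f n x) - cimag (g x)) (fun x => cimag (f n x) - cimag (g x))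
      @[n --> \oo] --> (0 : R).
Proof.
move=> lf cf.
have part (p : R[i] -> R) : (forall n, l2 mu (fun x => p (f n x))) ->
    (forall m n, l2ip mu (fun x => p (f m x) - p (f n x)) (fun x => p (f m x) - p (f n x)) <=
      csqnorm (fun x => f m x - f n x)) ->
    exists2 g, l2 mu g & l2ip mu (fun x => p (f n x) - g x) (fun x => p (f n x) - g x)
      @[n --> \oo] --> (0 : R).
  move=> lp ple; have [e e0|g lg gP] := l2_complete lp.
    have [N NP] := cf e e0; exists N => m n Nm Nn.
    exact: le_lt_trans (ple m n) (NP m n Nm Nn).
  exists g => //; apply/cvgrPdist_le => e e0; have [N NP] := gP e e0; exists N => // n /= Nn.
  by rewrite sub0r normrN ger0_norm ?l2ip_ge0//; exact: NP.
have [n|m n|g1 l1 c1] := part (@creal R); first by case: (lf n).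
  rewrite /csqnorm; have E : (fun x => creal (f m x - f n x)) = (fun x => creal (f m x) - creal (f n x)).
    by apply/funext => x; rewrite crealB.
  by rewrite E lerDl l2ip_ge0.
have [n|m n|g2 l2_ c2] := part (@cimag R); first by case: (lf n).
  rewrite /csqnorm; have E : (fun x => cimag (f m x - f n x)) = (fun x => cimag (f m x) - cimag (f n x)).
    by apply/funext => x; rewrite cimagB.
  by rewrite E lerDr l2ip_ge0.
by exists (fun x => g1 x +i* g2 x).
Qed.

End ComplexL2.

Section L2Representation.
Context (dd : measure_display) (T : measurableType dd) (R : realType).
Variables (mu : {measure set T -> \bar R}) (V : lmodType R[i]) (H : hilbert_space V).
Variables (S : (T -> R[i]) -> Prop) (k : (T -> R[i]) -> V) (c : R).
Hypothesis c0 : 0 < c.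
Hypothesis S0 : S (fun=> 0).
Hypothesis S_lin : forall (a : R[i]) phi psi, S phi -> S psi -> S (fun x => a * phi x + psi x).
Hypothesis S_l2 : forall phi, S phi -> cl2 mu phi.
Hypothesis k_lin : forall (a : R[i]) phi psi, S phi -> S psi ->
  k (fun x => a * phi x + psi x) = cconj a *: k phi + k psi.
Hypothesis kQ : forall phi psi, S phi -> S psi ->
  hip H (k phi) (k psi) = c%:C * cpair mu (fun x => cconj (phi x)) psi.
Hypothesis k_total : forall v, (forall phi, S phi -> hip H v (k phi) = 0) -> v = 0.

Let Sk v := exists2 phi, S phi & v = k phi.

Lemma kernel_sqnorm phi : S phi -> hnorm H (k phi) ^+ 2 = c * csqnorm mu phi.
Proof.
move=> sf; have [l1 l2_] := S_l2 sf.
rewrite hnorm_sqr kQ// !cE mul0r subr0; congr (_ * _).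
rewrite -[LHS]/(l2ip mu (fun x => creal (phi x)) (fun x => creal (phi x)) -
  l2ip mu (fun x => - cimag (phi x)) (fun x => cimag (phi x))) /csqnorm.
by rewrite l2ipNl// opprK.
Qed.

Lemma kernel0 : k (fun=> 0) = 0.
Proof.
have := k_lin (-1) S0 S0; have -> : (fun x : T => -1 * 0 + 0 : R[i]) = fun=> 0.
  by apply/funext => x; rewrite mulr0 addr0.
have -> : cconj (-1 : R[i]) = -1 by apply: complex_ext; rewrite !cE /creal /cimag /= ?oppr0.
by rewrite scaleN1r addNr.
Qed.

Lemma kernel_span (a : R[i]) u v : Sk u -> Sk v -> Sk (a *: u + v).
Proof.
move=> [phi sf ->] [psi sp ->]; exists (fun x => cconj a * phi x + psi x); first exact: S_lin.
by rewrite k_lin// cconjK.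
Qed.

Lemma Sk0 : Sk 0. Proof. by exists (fun=> 0) => //; rewrite kernel0. Qed.

(** By [riesz_on_subspace] and totality, [v] is a limit of kernels [k (f n)], and [kernel_sqnorm]
    makes [f n] Cauchy in L^2, with limit [g]. As [(k phi, k psi)] is [c] times the integral of
    [conj phi psi], the density of [v] is [c conj g]; its square norm is [c^2 |g|^2], against
    [|v|^2 = c |g|^2]. *)
Lemma repr_of_vector v : exists g, [/\ cl2 mu g,
  forall phi, S phi -> hip H v (k phi) = cpair mu g phi &
  hnorm H v ^+ 2 = c^-1 * csqnorm mu g].
Proof.
have [w [wP [s Ss sw]]] : exists w, (forall u, Sk u -> hip H u w = hip H u v) /\
    exists2 s : nat -> V, (forall n, Sk (s n)) & hcvg H s w.
  apply: (@riesz_on_subspace _ _ H Sk (fun u => hip H u v) (hnorm H v ^+ 2) Sk0 kernel_span).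
    by move=> a u u' _ _; rewrite hipDl hipZl.
  move=> u _; have := sqr_ge0 (hnorm H u - hnorm H v).
  have := rip_le H u v; have := ler_norm (creal (hip H u v)); rewrite sqrrB; lra.
have wv : w = v.
  apply/eqP; rewrite -subr_eq0; apply/eqP; apply: k_total => phi sf.
  rewrite hip_conj hipBr wP; last by exists phi.
  by rewrite subrr; apply: complex_ext; rewrite !cE ?oppr0.
rewrite {w wP}wv in sw.
have /choice[f fP] : forall n, exists phi, S phi /\ s n = k phi.
  by move=> n; have [phi sf ->] := Ss n; exists phi.
have sf n : S (f n) by case: (fP n).
have sk n : s n = k (f n) by case: (fP n).
have lf n := S_l2 (sf n).
have dE m n : (fun x => f m x - f n x) = (fun x => -1 * f n x + f m x).
  by apply/funext => x; rewrite mulN1r addrC.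
have sd m n : S (fun x => f m x - f n x) by rewrite dE; exact: S_lin.
have kd m n : k (fun x => f m x - f n x) = k (f m) - k (f n).
  rewrite dE k_lin//.
  have -> : cconj (-1 : R[i]) = -1 by apply: complex_ext; rewrite !cE /creal /cimag /= ?oppr0.
  by rewrite scaleN1r addrC.
have [|g lg [g1P g2P]] := @cl2_complete _ T R mu f lf.
  move=> e e0; have ce : 0 < Num.sqrt (c * e) / 2 by rewrite divr_gt0// sqrtr_gt0 mulr_gt0.
  have [N NP] := sw _ ce; exists N => m n Nm Nn.
  rewrite -(ltr_pM2l c0) -kernel_sqnorm// kd -!sk.
  rewrite -[ltRHS]sqr_sqrtr ?mulr_ge0 ?ltW// ltr_pXn2r ?nnegrE ?hnorm_ge0 ?sqrtr_ge0//.
  apply: le_lt_trans (hnorm_distm H (s m) v (s n)) _.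
  have := NP m Nm; have := NP n Nn; rewrite (hnormB H v); set q := Num.sqrt _; lra.
have [lg1 lg2] := lg.
have lf1 n : l2 mu (fun x => creal (f n x)) by case: (lf n).
have lf2 n : l2 mu (fun x => cimag (f n x)) by case: (lf n).
have lim_unique (u : nat -> R) (a b : R) : u n @[n --> \oo] --> a -> u n @[n --> \oo] --> b -> a = b.
  by move=> ua ub; rewrite -(cvg_lim _ ua)// -(cvg_lim _ ub).
pose h x : R[i] := c%:C * cconj (g x).
have lh : cl2 mu h.
  split.
    have := l2_scale c lg1; congr l2; apply/funext => x.
    by rewrite /h !cE; ring.
  have := l2_scale (- c) lg2; congr l2; apply/funext => x.
  by rewrite /h !cE; ring.
have hr a : l2 mu a -> l2ip mu (fun x => creal (h x)) a = c * l2ip mu (fun x => creal (g x)) a.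
  move=> la; rewrite -l2ip_scalel//; congr l2ip; apply/funext => x.
  by rewrite /h !cE; ring.
have hi a : l2 mu a -> l2ip mu (fun x => cimag (h x)) a = - c * l2ip mu (fun x => cimag (g x)) a.
  move=> la; rewrite -l2ip_scalel//; congr l2ip; apply/funext => x.
  by rewrite /h !cE; ring.
exists h; split=> // [phi sp|].
  have [p1 p2] := S_l2 sp; have [hcr hci] := hip_cvg (k phi) sw.
  have Er n : creal (hip H (s n) (k phi)) = c * (l2ip mu (fun x => creal (f n x)) (fun x => creal (phi x)) +
      l2ip mu (fun x => cimag (f n x)) (fun x => cimag (phi x))).
    rewrite sk kQ// !cE mul0r subr0 -[creal (cpair _ _ _)]/(l2ip mu (fun x => creal (f n x)) (fun x => creal (phi x)) -
      l2ip mu (fun x => - cimag (f n x)) (fun x => cimag (phi x))).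
    by rewrite l2ipNl// opprK.
  have Ei n : cimag (hip H (s n) (k phi)) = c * (l2ip mu (fun x => creal (f n x)) (fun x => cimag (phi x)) -
      l2ip mu (fun x => cimag (f n x)) (fun x => creal (phi x))).
    rewrite sk kQ// !cE mul0r addr0 -[cimag (cpair _ _ _)]/(l2ip mu (fun x => creal (f n x)) (fun x => cimag (phi x)) +
      l2ip mu (fun x => - cimag (f n x)) (fun x => creal (phi x))).
    by rewrite l2ipNl.
  rewrite (eq_cvg _ _ Er) in hcr; rewrite (eq_cvg _ _ Ei) in hci.
  rewrite /cpair !hr// !hi//; apply: complex_ext.
    apply: (lim_unique _ _ _ hcr); rewrite /creal /= mulNr opprK -mulrDr.
    apply: cvgM; first exact: cvg_cst.
    by apply: cvgD; [exact: l2ip_cvg lf1 lg1 p1 g1P|exact: l2ip_cvg lf2 lg2 p2 g2P].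
  apply: (lim_unique _ _ _ hci); rewrite /cimag /= mulNr -mulrBr.
  apply: cvgM; first exact: cvg_cst.
  by apply: cvgB; [exact: l2ip_cvg lf1 lg1 p2 g1P|exact: l2ip_cvg lf2 lg2 p1 g2P].
have hv := hnorm_cvg sw.
have En n : hnorm H (s n) ^+ 2 = c * csqnorm mu (f n) by rewrite sk kernel_sqnorm.
rewrite (eq_cvg _ _ En) in hv; apply: (lim_unique _ _ _ hv).
have [lh1 lh2] := lh.
have -> : c^-1 * csqnorm mu h = c * csqnorm mu g.
  rewrite /csqnorm hr// hi// (l2ipC mu _ (fun x => creal (h x))) (l2ipC mu _ (fun x => cimag (h x))).
  by rewrite hr// hi//; field; rewrite gt_eqF.
apply: cvgM; first exact: cvg_cst.
by apply: cvgD; [exact: l2ip_cvg_sqr lf1 lg1 g1P|exact: l2ip_cvg_sqr lf2 lg2 g2P].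
Qed.

(** The functional that sends [k phi] to the conjugate of the integral of [g phi] is well defined,
    because [k phi = k psi] forces [phi - psi] to have L^2 norm 0. As [|k phi|^2 = c |phi|^2],
    Young's inequality with constant [c] is exactly the lower bound that [riesz_on_subspace]
    requires. *)
Lemma vector_of_repr g : cl2 mu g ->
  exists v, forall phi, S phi -> hip H v (k phi) = cpair mu g phi.
Proof.
move=> lg.
have uniq phi psi : S phi -> S psi -> k phi = k psi -> cpair mu g phi = cpair mu g psi.
  move=> sf sp E; pose d x := -1 * psi x + phi x.
  have sd : S d by exact: S_lin.
  have d0 : csqnorm mu d = 0.
    apply/eqP; rewrite -(mulrI_eq0 _ (mulfI (lt0r_neq0 c0))) -kernel_sqnorm// k_lin// E.
    have -> : cconj (-1 : R[i]) = -1 by apply: complex_ext; rewrite !cE /creal /cimag /= ?oppr0.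
    by rewrite scaleN1r addNr hnorm0 expr0n.
  have := cpair_eq0 lg (S_l2 sd) d0; rewrite cpair_linr//; last 2 first.
  - exact: S_l2.
  - exact: S_l2.
  by rewrite mulN1r addrC => /eqP; rewrite subr_eq0 => /eqP.
have /choice[F FP] : forall u, exists phi, Sk u -> S phi /\ u = k phi.
  move=> u; have [[phi sf ->]|nu] := pselect (Sk u); first by exists phi.
  by exists (fun=> 0).
pose L u := cconj (cpair mu g (F u)).
have LE phi : S phi -> L (k phi) = cconj (cpair mu g phi).
  move=> sf; have [s' E] := FP (k phi) (ex_intro2 _ _ phi sf erefl).
  by rewrite /L (uniq _ _ s' sf).
have [||w [wP _]] := @riesz_on_subspace _ _ H Sk L (c^-1 * csqnorm mu g) Sk0 kernel_span.
- move=> a _ _ [phi sf ->] [psi sp ->].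
  have -> : a *: k phi + k psi = k (fun x => cconj a * phi x + psi x) by rewrite k_lin// cconjK.
  rewrite !LE//; last exact: S_lin.
  rewrite cpair_linr//; [|exact: S_l2|exact: S_l2].
  by rewrite cconjD cconjM cconjK.
- move=> _ [phi sf ->]; rewrite LE// kernel_sqnorm//.
  have := cpair_young c0 lg (S_l2 sf); have := ler_norm (2 * creal (cpair mu g phi)).
  rewrite creal_conj; set a := c * _; set b := c^-1 * _; lra.
exists w => phi sf; rewrite hip_conj wP; last by exists phi.
by rewrite LE// cconjK.
Qed.

End L2Representation.

Section LebesgueL2.
Variables (R : realType) (n : nat) (mu : {sigma_finite_measure set (borelV R n) -> \bar R}).
Hypothesis mu_ge0 : forall f : borelV R n -> \bar R, measurable_fun setT f -> (forall x, 0 <= f x)%E ->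
  intRd (f : 'rV[R]_n -> \bar R) = (\int[mu]_x f x)%E.
Hypothesis mu_int : forall f : borelV R n -> \bar R, mu.-integrable setT f ->
  intRd (f : 'rV[R]_n -> \bar R) = (\int[mu]_x f x)%E.
Implicit Types g phi : 'rV[R]_n -> R[i].

Lemma intRd_cabs_sqr g : borel_measurable (fun x => creal (g x)) ->
  borel_measurable (fun x => cimag (g x)) ->
  intRd (fun x => (cabs (g x) ^+ 2)%:E) =
  (\int[mu]_x (creal (g x) ^+ 2)%:E + \int[mu]_x (cimag (g x) ^+ 2)%:E)%E.
Proof.
move=> /borel_measurableE m1 /borel_measurableE m2.
have E : (fun x : borelV R n => (cabs (g x) ^+ 2)%:E) =
    (fun x => (creal (g x) ^+ 2)%:E + (cimag (g x) ^+ 2)%:E)%E.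
  by apply/funext => x; rewrite cabs_sqr EFinD.
have q1 : measurable_fun setT (fun x : borelV R n => (creal (g x) ^+ 2)%:E).
  by apply/measurable_EFinP; exact: measurable_funX.
have q2 : measurable_fun setT (fun x : borelV R n => (cimag (g x) ^+ 2)%:E).
  by apply/measurable_EFinP; exact: measurable_funX.
rewrite mu_ge0.
- by rewrite E ge0_integralD// => x _; rewrite lee_fin sqr_ge0.
- by rewrite E; exact: emeasurable_funD.
- by move=> x; rewrite lee_fin sqr_ge0.
Qed.

Lemma L2_cl2 g : L2 g <-> cl2 mu (g : borelV R n -> R[i]).
Proof.
have i0 (f : borelV R n -> R) : (0 <= \int[mu]_x (f x ^+ 2)%:E)%E.
  by apply: integral_ge0 => x _; rewrite lee_fin sqr_ge0.
split=> [[m1 [m2]]|[[m1 l1] [m2 l2_]]].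
  rewrite intRd_cabs_sqr// => foo; split; split; try exact/borel_measurableE.
    by apply: le_lt_trans foo; rewrite leeDl.
  by apply: le_lt_trans foo; rewrite leeDr.
have b1 : borel_measurable (fun x => creal (g x)) by apply/borel_measurableE.
have b2 : borel_measurable (fun x => cimag (g x)) by apply/borel_measurableE.
by split=> //; split=> //; rewrite intRd_cabs_sqr// lte_add_pinfty.
Qed.

Lemma L2normE g : L2 g -> L2norm g = Num.sqrt (csqnorm mu (g : borelV R n -> R[i])).
Proof.
move=> lg; have [l1 l2_] := (L2_cl2 g).1 lg; have [m1 [m2 _]] := lg.
by rewrite /L2norm intRd_cabs_sqr// !l2ip_sqr.
Qed.

Lemma distr_of_funE g phi : L2 g -> cl2 mu (phi : borelV R n -> R[i]) ->
  distr_of_fun g phi = cpair mu (g : borelV R n -> R[i]) phi.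
Proof.
move=> /L2_cl2[g1 g2] [p1 p2].
have I (a b : borelV R n -> R) : l2 mu a -> l2 mu b -> mu.-integrable setT (EFin \o (fun x => a x * b x)).
  exact: l2_mul_integrable.
have Er : (fun x => (creal (g x * phi x))%:E) =
    EFin \o (fun x => creal (g x) * creal (phi x) - cimag (g x) * cimag (phi x)).
  by apply/funext => x; rewrite /= crealM.
have Ei : (fun x => (cimag (g x * phi x))%:E) =
    EFin \o (fun x => creal (g x) * cimag (phi x) + cimag (g x) * creal (phi x)).
  by apply/funext => x; rewrite /= cimagM.
have I1 := I _ _ g1 p1; have I2 := I _ _ g2 p2; have I3 := I _ _ g1 p2; have I4 := I _ _ g2 p1.
rewrite /distr_of_fun /cpair Er Ei; congr (_ +i* _).
  rewrite mu_int; first exact: (RintegralB measurableT I1 I2).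
  exact: (integrableB measurableT I1 I2).
rewrite mu_int; first exact: (RintegralD measurableT I3 I4).
exact: (integrableD measurableT I3 I4).
Qed.

End LebesgueL2.

Section KernelInnerProducts.
Variables (R : realType) (n : nat) (mu : {sigma_finite_measure set (borelV R n) -> \bar R}).
Hypothesis mu_ge0 : forall f : borelV R n -> \bar R, measurable_fun setT f -> (forall x, 0 <= f x)%E ->
  intRd (f : 'rV[R]_n -> \bar R) = (\int[mu]_x f x)%E.
Hypothesis mu_int : forall f : borelV R n -> \bar R, mu.-integrable setT f ->
  intRd (f : 'rV[R]_n -> \bar R) = (\int[mu]_x f x)%E.
Variables (V : lmodType R[i]) (H : hilbert_space V) (k : ('rV[R]_n -> R[i]) -> V).
Hypothesis k_lin : forall (a : R[i]) phi psi, schwartz phi -> schwartz psi ->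
  k (fun x => a * phi x + psi x) = cconj a *: k phi + k psi.
Hypothesis k_bound : exists (N : nat) (B : R), 0 <= B /\
  forall phi M, schwartz phi -> cseminorm_le N M phi -> hnorm H (k phi) <= B * M.
Hypothesis k_inv : forall x xi phi psi, schwartz phi -> schwartz psi ->
  hip H (k (tfshift x xi phi)) (k (tfshift x xi psi)) = hip H (k phi) (k psi).
Hypothesis k_neq0 : exists2 phi, schwartz phi & k phi <> 0.

Let ku (u : 'rV[R]_n -> R) := k (complexify u).

Lemma kernel_real_imag phi : schwartz phi ->
  k phi = (0 -i* 1) *: ku (fun x => cimag (phi x)) + ku (fun x => creal (phi x)).
Proof.
move=> /schwartzP[s1 s2]; have -> : 0 -i* 1 = cconj (0 +i* 1) :> R[i] by [].
rewrite -k_lin; [|exact: schwartz_real|exact: schwartz_real].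
by congr k; apply/funext => x; apply: complex_ext; rewrite !cE /creal /cimag /=; ring.
Qed.

(** [form_is_L2] is applied to the real and the imaginary part. On the diagonal it makes [|k u|^2]
    equal to [c1] times the integral of [u^2]; a nonzero kernel forces [c1 > 0], and square
    integrability of Schwartz functions is read off from this identity. The imaginary part vanishes
    on the diagonal, so [c2 = 0]. *)
Lemma kernel_inner_L2 : (forall u, rschwartz u -> l2 mu (u : borelV R n -> R)) /\
  exists2 c : R, 0 < c & forall u v, rschwartz u -> rschwartz v ->
    hip H (ku u) (ku v) = (c * l2ip mu (u : borelV R n -> R) v)%:C.
Proof.
have formP (p : R[i] -> R) := @schwartz_form_kernel R n V H k k_lin k_bound k_inv p.
have f1 : schwartz_form (fun u v => creal (hip H (ku u) (ku v))).
  apply: formP => [a z w|z]; last exact: le_creal_cabs.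
  by rewrite !cE mul0r subr0.
have f2 : schwartz_form (fun u v => cimag (hip H (ku u) (ku v))).
  apply: formP => [a z w|z]; last exact: le_cimag_cabs.
  by rewrite !cE mul0r addr0.
have [c1 c1P] := form_is_L2 f1; have [c2 c2P] := form_is_L2 f2.
have mE u : rschwartz u -> measurable_fun setT (u : borelV R n -> R).
  by move=> [su _]; apply: continuous_borelV; exact: smoothR_continuous.
have sqE u : rschwartz u -> (hnorm H (ku u) ^+ 2)%:E = (c1%:E * \int[mu]_x (u x ^+ 2)%:E)%E.
  move=> ru; rewrite hnorm_sqr c1P//; congr (_ * _)%E; rewrite -mu_ge0.
  - by congr intRd.
  - by apply/measurable_EFinP; apply: measurable_funX; exact: mE.
  - by move=> x; rewrite lee_fin sqr_ge0.
have i0 (u : borelV R n -> R) : (0 <= \int[mu]_x (u x ^+ 2)%:E)%E.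
  by apply: integral_ge0 => x _; rewrite lee_fin sqr_ge0.
have [u0 r0 k0] : exists2 u, rschwartz u & ku u <> 0.
  have [phi sf kf] := k_neq0; have /schwartzP[s1 s2] := sf.
  have [E|] := pselect (ku (fun x => cimag (phi x)) = 0); last by exists (fun x => cimag (phi x)).
  exists (fun x => creal (phi x)) => // E'; apply: kf.
  by rewrite kernel_real_imag// E E' scaler0 addr0.
have kp : 0 < hnorm H (ku u0) ^+ 2.
  rewrite exprn_gt0// lt_def hnorm_ge0 andbT; apply/eqP => /hnorm_eq0.
  exact: k0.
have c10 : 0 < c1.
  rewrite ltNge; apply/negP => c1n; have := sqE _ r0 => E.
  have : ((hnorm H (ku u0) ^+ 2)%:E <= 0)%E by rewrite E mule_le0_ge0// lee_fin.
  by rewrite lee_fin leNgt kp.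
have lE u : rschwartz u -> l2 mu (u : borelV R n -> R).
  move=> ru; split; first exact: mE.
  have := sqE u ru; case E : (\int[mu]_x _)%E => [r| |]; first by rewrite ltry.
    by rewrite mulry gtr0_sg// mul1e.
  by have := i0 u; rewrite E.
have pE (a b : 'rV[R]_n -> R) : rschwartz a -> rschwartz b ->
    intRd (fun x => (a x * b x)%:E) = (l2ip mu (a : borelV R n -> R) b)%:E.
  move=> ra rb; have Iab := l2_mul_integrable (lE a ra) (lE b rb).
  rewrite (mu_int Iab) /l2ip /Rintegral fineK//.
  exact: (integral_fune_fin_num measurableT Iab).
have r1 u v : rschwartz u -> rschwartz v ->
    creal (hip H (ku u) (ku v)) = c1 * l2ip mu (u : borelV R n -> R) v.
  by move=> ru rv; have := c1P u v ru rv; rewrite pE// -EFinM => -[].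
have r2 u v : rschwartz u -> rschwartz v ->
    cimag (hip H (ku u) (ku v)) = c2 * l2ip mu (u : borelV R n -> R) v.
  by move=> ru rv; have := c2P u v ru rv; rewrite pE// -EFinM => -[].
have c20 : c2 = 0.
  have := r2 _ _ r0 r0; rewrite hip_diag cimag_real => /esym/eqP.
  rewrite mulf_eq0 => /orP[/eqP //|/eqP E].
  by have := r1 _ _ r0 r0; rewrite E mulr0 -hnorm_sqr => E'; rewrite E' ltxx in kp.
split=> //; exists c1 => // u v ru rv; apply: complex_ext; first by rewrite r1.
by rewrite r2// c20 mul0r.
Qed.

Lemma kernel_inner_complex : (forall phi, schwartz phi -> cl2 mu (phi : borelV R n -> R[i])) /\
  exists2 c : R, 0 < c & forall phi psi, schwartz phi -> schwartz psi ->
    hip H (k phi) (k psi) = c%:C * cpair mu (fun x : borelV R n => cconj (phi x)) psi.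
Proof.
have [l2P [c c0 cP]] := kernel_inner_L2; split.
  by move=> phi /schwartzP[s1 s2]; split; exact: l2P.
exists c => // phi psi sf sp; rewrite (kernel_real_imag sf) (kernel_real_imag sp).
have /schwartzP[f1 f2] := sf; have /schwartzP[p1 p2] := sp.
rewrite !(hipDl, hipDr, hipZl, hipZr) !cP//.
have lf1 := l2P _ f1; have lf2 := l2P _ f2; have lp1 := l2P _ p1; have lp2 := l2P _ p2.
rewrite /cpair (l2ipNl lf2 lp1) (l2ipNl lf2 lp2).
by apply: complex_ext; rewrite !cE /creal /cimag /=; ring.
Qed.

End KernelInnerProducts.

Unset Implicit Arguments.

Theorem theorem1p3 (R : realType) (d : nat) (hd : (0 < d)%N)
    (V : lmodType R[i]) (H : hilbert_space V) (iota : V -> distr R d) (C0 : R)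
    (* iota is a continuous linear embedding of H into S'(R^d) *)
    (iota_temp : forall v, tempered (iota v))
    (iota_lin : forall (a : R[i]) (v w : V),
        deq (iota (a *: v + w)) (fun phi => a * iota v phi + iota w phi))
    (iota_inj : forall v w : V, deq (iota v) (iota w) -> v = w)
    (iota_cont : forall phi, schwartz phi ->
        forall (v0 : V) (e : R), 0 < e -> exists2 delta : R, 0 < delta &
          forall v : V, hnorm H (v - v0) < delta ->
            cabs (iota v phi - iota v0 phi) < e)
    (* invariance under time-frequency shifts *)
    (hC0 : 1 <= C0)
    (tf_inv : forall (f : V) (x xi : 'rV[R]_d), exists g : V,
        deq (iota g) (modtrans x xi (iota f)) /\ hnorm H g <= C0 * hnorm H f)
    (* H <> {0} *)
    (Hnz : exists v : V, v <> 0) :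
  (* H = L^2(R^d) as subspaces of S'(R^d) ... *)
  (forall v : V, exists g, L2 g /\ deq (iota v) (distr_of_fun g)) /\
  (forall g, L2 g -> exists v : V, deq (iota v) (distr_of_fun g)) /\
  (* ... with equivalent norms *)
  (exists2 C : R, 0 < C & forall (v : V) (g : 'rV[R]_d -> R[i]),
      L2 g -> deq (iota v) (distr_of_fun g) ->
      C0^-1 * C * L2norm g <= hnorm H v /\ hnorm H v <= C0 * C * L2norm g).
Proof.
have C00 : 0 < C0 by exact: lt_le_trans hC0.
have [P0 P0P] := choice (fun fz : V * ('rV[R]_d * 'rV[R]_d) => tf_inv fz.1 fz.2.1 fz.2.2).
pose P z f := P0 (f, z).
have PE z v : deq (iota (P z v)) (modtrans z.1 z.2 (iota v)) by have [] := P0P (v, z).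
have P_ub z v : hnorm H (P z v) <= C0 * hnorm H v by have [] := P0P (v, z).
have P_comp := shift_comp iota_temp iota_lin iota_inj PE.
have P_lin := shift_lin iota_lin iota_inj PE.
(* [P (- z)] undoes [P z] up to a phase of modulus 1, so the upper bound for the former is a lower
   bound for the latter. *)
have P_lb z u : C0^-1 * hnorm H u <= hnorm H (P z u).
  rewrite mulrC ler_pdivrMr// mulrC.
  have := P_ub (- z) (P z u); rewrite P_comp addNr (shift0 iota_inj PE) hnormZ cabs_expi.
  by rewrite mul1r.
have [|H' [HH' P_isom]] := averaged_hilbert hC0 P_lin P_ub P_lb.
  move=> z w u v; rewrite !P_comp hipZl hipZr mulrA.
  set t := cexpi _; have -> : t * cconj t = 1.
    apply: complex_ext; rewrite !cE /t /cexpi /creal /cimag /=.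
      by rewrite mulrN opprK -!expr2 cos2Dsin2.
    by ring.
  by rewrite mul1r.
(* Continuity at 0 with tolerance 1 becomes a linear bound after scaling [v] to norm at most
   [e / 2]. A positive [t] above the norm of [v] is used for scaling, so that [v = 0] is no
   exception; the factor [C0] passes to the averaged norm. *)
have cont' phi : schwartz phi -> exists A : R, forall v, cabs (iota v phi) <= A * hnorm H' v.
  move=> sf; have [e e0 eP] := iota_cont phi sf 0 1 ltr01.
  exists (2 / e * C0) => v.
  have bound (t : R) : 0 < t -> hnorm H v <= t -> cabs (iota v phi) <= 2 / e * t.
    move=> t0 vt; pose s := e / (2 * t).
    have s0 : 0 < s by rewrite divr_gt0// mulr_gt0.
    have sv : hnorm H (s%:C *: v - 0) < e.
      rewrite subr0 hnormZ cabs_real ger0_norm ?(ltW s0)//.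
      apply: le_lt_trans (ler_wpM2l (ltW s0) vt) _.
      have -> : s * t = e / 2 by rewrite /s; field; rewrite gt_eqF.
      by rewrite ltr_pdivrMr// ltr_pMr// ltr1n.
    have := eP _ sv; rewrite (iota0 iota_lin)// subr0 (iotaZ iota_lin)// cabsM cabs_real.
    rewrite ger0_norm ?(ltW s0)// mulrC -ltr_pdivlMr// => /ltW; congr (_ <= _).
    by rewrite /s; field; rewrite !gt_eqF.
  have h1 : hnorm H v <= C0 * hnorm H' v.
    by have /andP[] := HH' v; rewrite mulrC ler_pdivrMr// mulrC.
  apply/ler_addgt0Pr => r r0; have h0 := hnorm_ge0 H' v.
  have q0 : 0 < r * e / 2 by rewrite divr_gt0// mulr_gt0.
  apply: le_trans (bound (C0 * hnorm H' v + r * e / 2) _ _) _.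
  - by rewrite ltr_wpDl// mulr_ge0// ltW.
  - by apply: le_trans h1 _; rewrite lerDl ltW.
  - by rewrite le_eqVlt; apply/orP; left; apply/eqP; field; rewrite gt_eqF.
have [k kP] := kernel_exists iota_lin cont'.
have k_lin := kernel_lin iota_temp kP.
have k_bound := kernel_bound iota_temp kP.
have k_inv := kernel_invariant iota_temp iota_lin kP iota_inj PE P_isom.
have k_total v : (forall phi, schwartz phi -> hip H' v (k phi) = 0) -> v = 0.
  move=> v0; apply: iota_inj => phi sf; rewrite (iota0 iota_lin)// -kP//.
  exact: v0.
have k_neq0 : exists2 phi, schwartz phi & k phi <> 0.
  apply: contrapT => nk; have [v nv] := Hnz; apply: nv; apply: k_total => phi sf.
  have -> : k phi = 0 by apply: contrapT => kf; apply: nk; exists phi.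
  by rewrite hip0r.
have [mu [mu_ge0 mu_int]] := lebesgue_measureV R d.
have [S_l2 [c c0 kQ]] := kernel_inner_complex mu_ge0 mu_int k_lin k_bound k_inv k_neq0.
have S0 : schwartz (fun _ : 'rV[R]_d => 0 : R[i]) := schwartz_real (rschwartz0 R d).
have toL2 := @repr_of_vector _ (borelV R d) R mu V H' (@schwartz R d) k c c0 S0 (@schwartz_lin R d) S_l2 k_lin kQ k_total.
have ofL2 := @vector_of_repr _ (borelV R d) R mu V H' (@schwartz R d) k c c0 S0 (@schwartz_lin R d) S_l2 k_lin kQ.
have pairE g phi : L2 g -> schwartz phi -> distr_of_fun g phi = cpair mu (g : borelV R d -> R[i]) phi.
  by move=> lg sf; apply: distr_of_funE => //; exact: S_l2.
split=> [v|].
  have [g [lg gP _]] := toL2 v; have Lg : L2 g by exact/(L2_cl2 mu_ge0).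
  by exists g; split=> // phi sf; rewrite pairE// -gP// kP.
split=> [g Lg|].
  have [v vP] := ofL2 _ ((L2_cl2 mu_ge0 g).1 Lg).
  by exists v => phi sf; rewrite pairE// -vP// kP.
exists (Num.sqrt c^-1) => [|v g Lg vg]; first by rewrite sqrtr_gt0 invr_gt0.
(* Here [g] is any density of [v], whereas the norm formula is known for the density [g'] built from
   [v]; uniqueness of densities makes their square norms equal. *)
have [g' [lg' g'P g'n]] := toL2 v; have lg := (L2_cl2 mu_ge0 g).1 Lg.
have rl2 u : rschwartz u -> l2 mu (u : borelV R d -> R).
  by move=> ru; have [] := S_l2 _ (schwartz_real ru).
(* Real test functions suffice: on them the real and imaginary parts of the pairing involve those of
   the density separately. *)
have eqg (u : 'rV[R]_d -> R) : rschwartz u ->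
    cpair mu (g : borelV R d -> R[i]) (complexify u) = cpair mu g' (complexify u).
  move=> ru; have su := schwartz_real ru.
  by rewrite -pairE// -g'P// kP// vg.
have z0 (a : borelV R d -> R) : l2 mu a -> l2ip mu a (fun=> 0) = 0.
  by move=> la; rewrite l2ipC /l2ip; under eq_Rintegral do rewrite mul0r; rewrite Rintegral_cst// mul0r.
have [g1 g2] := lg; have [g1' g2'] := lg'.
have part (a b : borelV R d -> R) : l2 mu a -> l2 mu b ->
    (forall u, rschwartz u -> l2ip mu a (u : borelV R d -> R) = l2ip mu b u) -> l2ip mu a a = l2ip mu b b.
  move=> la lb ab; have := l2_unique rl2 (l2B la lb).
  case=> [u ru|N [mN N0 NP]].
    have lu := rl2 u ru; have E : (fun x => a x - b x) = (fun x => -1 * b x + a x).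
      by apply/funext => x; ring.
    by rewrite E l2ip_linl// mulN1r ab// addNr.
  have [ma _] := la; have [mb _] := lb.
  rewrite /l2ip /Rintegral; congr fine; apply: ae_eq_integral => //.
  - by apply/measurable_EFinP; exact: measurable_funM.
  - by apply/measurable_EFinP; exact: measurable_funM.
  exists N; split=> // x /= nx; apply: NP => /= h; apply: nx => _.
  by move: (h I) => /eqP; rewrite subr_eq0 => /eqP ->.
have gg' : csqnorm mu (g : borelV R d -> R[i]) = csqnorm mu g'.
  rewrite /csqnorm; congr (_ + _); apply: part => // u ru; have lu := rl2 u ru.
    have := congr1 (@creal R) (eqg u ru).
    by rewrite /cpair /creal /= !z0// !subr0.
  have := congr1 (@cimag R) (eqg u ru).
  by rewrite /cpair /cimag /= !z0// !add0r.
have nE : hnorm H' v = Num.sqrt c^-1 * L2norm g.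
  rewrite (L2normE mu_ge0 Lg) gg' -sqrtrM ?invr_ge0 ?(ltW c0)// -g'n.
  by rewrite sqrtr_sqr ger0_norm ?hnorm_ge0.
rewrite -!mulrA -nE; have /andP[h1 h2] := HH' v; split.
  by rewrite mulrC ler_pdivrMr// mulrC.
by move: h1; rewrite mulrC ler_pdivrMr// mulrC.
Qed.
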